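(* Let $M=G/K$ be a homogeneous space, where $G$ is a Lie group with Lie algebra $\mathfrak{g}$ and $K$ is a compact Lie subgroup with Lie algebra $\mathfrak{k}$, and let $G$ be equipped with a Riemannian metric that is left invariant and bi-invariant with respect to $K$. Let $\pi:G\to M$ be the quotient map and $\mathfrak{k}^\perp$ the orthogonal complement of $\mathfrak{k}$ in $\mathfrak{g}$. Let $K$ act on the right on $G\times L^2([0,1],\mathfrak{k}^\perp)$ by $(\alpha_0,q)\ast y=(\alpha_0y,\,y^{-1}qy)$. Then $Q$ induces a bijection $$(G\times L^2([0,1],\mathfrak{k}^\perp))/K\to AC([0,1],M),$$ sending the $K$-orbit of $(\alpha_0,q)$ to $\pi\circ\alpha$, where $\alpha$ is the absolutely continuous curve in $G$ with $Q(\alpha)=(\alpha_0,q)$.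
   Context: $AC([0,1],N)$ denotes the set of absolutely continuous curves $[0,1]\to N$. ''Bi-invariant with respect to $K$'' means invariant under both left and right translation by elements of $K$. $L_g$ denotes left translation by $g$, on $G$ and on tangent vectors; $y^{-1}qy$ denotes the pointwise adjoint action $t\mapsto \mathrm{Ad}(y^{-1})q(t)$. The map $Q: AC([0,1],G)\to G\times L^2([0,1],\mathfrak{g})$, $Q(\alpha)=(\alpha(0),q)$, with $q(t)=L_{\alpha(t)^{-1}}\alpha'(t)/\sqrt{\|\alpha'(t)\|}$ where $\alpha'(t)\ne0$ and $q(t)=0$ where $\alpha'(t)=0$, is a bijection. It restricts to a bijection from the set $AC^\perp([0,1],G)$ of absolutely continuous curves in $G$ that are orthogonal to each coset $gK$ they meet (equivalently $L_{\alpha(t)^{-1}}\alpha'(t)\perp\mathfrak{k}$ for a.e. $t$) onto $G\times L^2([0,1],\mathfrak{k}^\perp)$. *)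

(* Defs.v *)
From HB Require Import structures.
From mathcomp Require Import all_boot all_order all_algebra.
From mathcomp Require Import all_classical all_reals all_analysis.

Set Implicit Arguments.
Unset Strict Implicit.
Unset Printing Implicit Defensive.

Import Order.TTheory GRing.Theory Num.Theory.
Import numFieldNormedType.Exports.

Local Open Scope classical_set_scope.
Local Open Scope ring_scope.

(* [Ck k U f]: all iterated directional derivatives of [f] up to order [k]
   exist and are continuous at the points of the open set [U].  For a
   finite-dimensional [E] this is the usual class C^k. *)
Fixpoint Ck {R : realType} {E F : normedModType R} (k : nat)
    (U : set E) (f : E -> F) : Prop :=
  (forall x, U x -> {for x, continuous f}) /\
  if k is k'.+1 then
    (forall x v, U x -> derivable f x v) /\ (forall v, Ck k' U ('D_v f))
  else True.

Definition smooth_on {R : realType} {E F : normedModType R}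
    (U : set E) (f : E -> F) : Prop := forall k, Ck k U f.

(* [cfun] and [cinv] are total functions; only the values of [cfun] on [cdom]
   and those of [cinv] on [cfun @` cdom] are meaningful. *)
Record chart (R : realType) (E : normedModType R) (M : Type) := Chart {
  cdom : set M ;
  cfun : M -> E ;
  cinv : E -> M }.

Definition is_chart {R : realType} {E : normedModType R}
    {M : topologicalType} (c : chart E M) : Prop :=
  [/\ open (cdom c),
      open (cfun c @` cdom c),
      (forall x, cdom c x -> cinv c (cfun c x) = x),
      (forall x, cdom c x -> {for x, continuous (cfun c)}) &
      (forall u, (cfun c @` cdom c) u -> {for u, continuous (cinv c)})].

Definition prod_chart {R : realType} {E F : normedModType R} {M N : Type}
    (c : chart E M) (d : chart F N) : chart (E * F)%type (M * N)%type :=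
  Chart (cdom c `*` cdom d)
        (fun p => (cfun c p.1, cfun d p.2))
        (fun u => (cinv c u.1, cinv d u.2)).

Definition chart_smooth {R : realType} {E F : normedModType R} {M N : Type}
    (c : chart E M) (d : chart F N) (f : M -> N) : Prop :=
  smooth_on (cfun c @` (cdom c `&` f @^-1` cdom d))
            (cfun d \o f \o cinv c).

(* [chart_at x] selects a chart around [x].  It identifies the tangent space
   T_x M with ['rV[R]_n], and all tangent vectors below are represented in
   this way. *)
HB.mixin Record isManifold (R : realType) (n : nat) M of Topological M := {
  atlas : set (chart 'rV[R]_n M) ;
  chart_at : M -> chart 'rV[R]_n M ;
  atlas_chart : forall c, atlas c -> is_chart c ;
  atlas_chart_at : forall x, atlas (chart_at x) ;
  mem_chart_at : forall x, cdom (chart_at x) x ;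
  atlas_compatible : forall c d, atlas c -> atlas d -> chart_smooth c d id ;
  manifold_hausdorff : hausdorff_space M ;
  manifold_second_countable : @second_countable M }.

#[short(type="manifoldType")]
HB.structure Definition Manifold (R : realType) (n : nat) :=
  {M of Topological M & isManifold R n M}.

Definition smooth_map {R : realType} {m n : nat}
    {M : manifoldType R m} {N : manifoldType R n} (f : M -> N) : Prop :=
  continuous f /\
  forall c d, atlas c -> atlas d -> chart_smooth c d f.

(* The differential T_x M -> T_(f x) N. *)
Definition mdiff {R : realType} {m n : nat}
    {M : manifoldType R m} {N : manifoldType R n} (f : M -> N) (x : M) :
    'rV[R]_m -> 'rV[R]_n :=
  'd (cfun (chart_at (f x)) \o f \o cinv (chart_at x)) (cfun (chart_at x) x).

Definition immersion {R : realType} {m n : nat}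
    {M : manifoldType R m} {N : manifoldType R n} (f : M -> N) : Prop :=
  smooth_map f /\ forall x, injective (mdiff f x).

Definition submersion {R : realType} {m n : nat}
    {M : manifoldType R m} {N : manifoldType R n} (f : M -> N) : Prop :=
  smooth_map f /\ forall x w, exists v, mdiff f x v = w.

HB.mixin Record isLieGroup (R : realType) (n : nat) G
    of Manifold R n G & Group G := {
  mulg_continuous : continuous (fun p : G * G => (p.1 * p.2)%g) ;
  mulg_smooth : forall c1 c2 d : chart 'rV[R]_n G,
    atlas c1 -> atlas c2 -> atlas d ->
    chart_smooth (prod_chart c1 c2) d (fun p : G * G => (p.1 * p.2)%g) ;
  invg_smooth : smooth_map (fun x : G => x^-1%g) }.

#[short(type="lieGroupType")]
HB.structure Definition LieGroup (R : realType) (n : nat) :=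
  {G of Manifold R n G & Group G & isLieGroup R n G}.

(* [iota] exhibits the Lie group [K] as a Lie subgroup of [G]. *)
Definition lie_subgroup {R : realType} {n k : nat}
    {G : lieGroupType R n} {K : lieGroupType R k} (iota : K -> G) : Prop :=
  [/\ injective iota,
      (forall x y, iota (x * y)%g = (iota x * iota y)%g) &
      immersion iota].

(* [proj : G -> M] is the quotient map onto M = G/K: its fibres are the left
   cosets x K, and the manifold structure of M is the quotient one, that is,
   the only one for which [proj] is a submersion. *)
Definition homogeneous_space {R : realType} {n k m : nat}
    {G : lieGroupType R n} {K : lieGroupType R k} {M : manifoldType R m}
    (iota : K -> G) (proj : G -> M) : Prop :=
  [/\ (forall p, exists x, proj x = p),
      (forall x y, proj x = proj y <-> exists h, y = (x * iota h)%g) &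
      submersion proj].

Record riemannian_metric {R : realType} {n : nat} {M : manifoldType R n}
    (g : M -> 'rV[R]_n -> 'rV[R]_n -> R) : Prop := {
  metric_sym : forall x u v, g x u v = g x v u ;
  metric_linear : forall x a u v w, g x (a *: u + v) w = a * g x u w + g x v w ;
  metric_pos : forall x v, v != 0 -> 0 < g x v v ;
  (* the coefficients in every chart of the atlas are smooth *)
  metric_smooth : forall (c : chart 'rV[R]_n M) (v w : 'rV[R]_n), atlas c ->
    smooth_on (cfun c @` cdom c) (fun u =>
      let: x := cinv c u in
      g x ('d (cfun (chart_at x) \o cinv c) u v)
          ('d (cfun (chart_at x) \o cinv c) u w) : R^o) }.

Definition isometry {R : realType} {n : nat} {M : manifoldType R n}
    (g : M -> 'rV[R]_n -> 'rV[R]_n -> R) (f : M -> M) : Prop :=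
  forall x v w, g (f x) (mdiff f x v) (mdiff f x w) = g x v w.

Definition left_invariant {R : realType} {n : nat} {G : lieGroupType R n}
    (g : G -> 'rV[R]_n -> 'rV[R]_n -> R) : Prop :=
  forall h, isometry g (fun x => (h * x)%g).

Definition bi_invariant_wrt {R : realType} {n k : nat}
    {G : lieGroupType R n} {K : lieGroupType R k} (iota : K -> G)
    (g : G -> 'rV[R]_n -> 'rV[R]_n -> R) : Prop :=
  forall h, isometry g (fun x => (iota h * x)%g) /\
            isometry g (fun x => (x * iota h)%g).

Definition metric_norm {R : realType} {n : nat} {M : manifoldType R n}
    (g : M -> 'rV[R]_n -> 'rV[R]_n -> R) (x : M) (v : 'rV[R]_n) : R :=
  Num.sqrt (g x v v).

(* The orthogonal complement of the Lie algebra of K in that of G. *)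
Definition lie_perp {R : realType} {n k : nat}
    {G : lieGroupType R n} {K : lieGroupType R k} (iota : K -> G)
    (g : G -> 'rV[R]_n -> 'rV[R]_n -> R) : set 'rV[R]_n :=
  [set v | forall w, range (mdiff iota 1%g) w -> g 1%g v w = 0].

Definition Ad {R : realType} {n : nat} {G : lieGroupType R n} (y : G) :
    'rV[R]_n -> 'rV[R]_n :=
  mdiff (fun x : G => (y * x * y^-1)%g) 1%g.

Definition unit_interval (R : realType) := set_type `[0 : R, 1].

(* Absolute continuity of the restriction of [f] to [a, b]. *)
Definition abs_continuous {R : realType} {E : normedModType R}
    (a b : unit_interval R) (f : unit_interval R -> E) : Prop :=
  forall e : R, 0 < e -> exists2 d : R, 0 < d &
  forall (N : nat) (s t : 'I_N -> unit_interval R),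
    (forall i, val a <= val (s i) <= val (t i) /\ val (t i) <= val b) ->
    (forall i j, i != j ->
       val (t i) <= val (s j) \/ val (t j) <= val (s i)) ->
    \sum_i (val (t i) - val (s i)) < d ->
    \sum_i `|f (t i) - f (s i)| < e.

(* AC([0,1], M): continuous curves that are absolutely continuous in the
   charts, on every subinterval which they map into the domain. *)
Definition ac_curves {R : realType} {n : nat} (M : manifoldType R n) :
    set (unit_interval R -> M) :=
  [set alpha : unit_interval R -> M | continuous alpha /\
    forall (c : chart 'rV[R]_n M) (a b : unit_interval R), atlas c ->
      (forall t : unit_interval R, val a <= val t <= val b -> cdom c (alpha t)) ->
      abs_continuous a b (cfun c \o alpha)].
Arguments ac_curves {R n} M.

Lemma clamp_subproof (R : realType) (t : R) :
  Num.max 0 (Num.min 1 t) \in `[0 : R, 1]%classic.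
Proof.
by rewrite inE /= in_itv /= le_max lexx /= ge_max ler01 ge_min lexx.
Qed.

Definition clamp {R : realType} (t : R) : unit_interval R :=
  SigSub (clamp_subproof t).

(* The velocity at time [t], meaningful for 0 < t < 1 at which the curve is
   differentiable, hence for almost every [t] if the curve is in [ac_curves M]. *)
Definition velocity {R : realType} {n : nat} {M : manifoldType R n}
    (alpha : unit_interval R -> M) (t : R) : 'rV[R]_n :=
  derive1 (cfun (chart_at (alpha (clamp t))) \o alpha \o @clamp R) t.

(* Elements of L^2([0,1], g) are represented by the equivalence classes, for
   equality almost everywhere on [0,1], of square integrable functions; the
   values outside [0,1] are irrelevant. *)
Definition square_integrable {R : realType} {n : nat} {G : lieGroupType R n}
    (g : G -> 'rV[R]_n -> 'rV[R]_n -> R) : set (R -> 'rV[R]_n) :=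
  [set q : R -> 'rV[R]_n |
    (forall i, measurable_fun `[0 : R, 1] (fun t : R => q t 0 i : R)) /\
    (\int[@lebesgue_measure R]_(t in `[0%R, 1%R])
        ((metric_norm g 1%g (q t)) ^+ 2)%:E < +oo)%E].

Definition L2_class {R : realType} {n : nat} {G : lieGroupType R n}
    (g : G -> 'rV[R]_n -> 'rV[R]_n -> R) (q : R -> 'rV[R]_n) :
    set (R -> 'rV[R]_n) :=
  [set p | square_integrable g p /\
    {ae @lebesgue_measure R, forall t : R, 0 <= t <= 1 -> p t = q t}].

Definition L2_space {R : realType} {n : nat} {G : lieGroupType R n}
    (g : G -> 'rV[R]_n -> 'rV[R]_n -> R) (V : set 'rV[R]_n) :
    set (set (R -> 'rV[R]_n)) :=
  [set L2_class g q | q in [set q | square_integrable g q /\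
    {ae @lebesgue_measure R, forall t : R, 0 <= t <= 1 -> V (q t)}]].

Definition srv {R : realType} {n : nat} {G : lieGroupType R n}
    (g : G -> 'rV[R]_n -> 'rV[R]_n -> R) (alpha : unit_interval R -> G)
    (t : R) : 'rV[R]_n :=
  let x := alpha (clamp t) in
  let v := velocity alpha t in
  if v == 0 then 0
  else (Num.sqrt (metric_norm g x v))^-1 *:
         mdiff (fun h : G => (x^-1 * h)%g) x v.

Definition srv_map {R : realType} {n : nat} {G : lieGroupType R n}
    (g : G -> 'rV[R]_n -> 'rV[R]_n -> R) (alpha : unit_interval R -> G) :
    G * set (R -> 'rV[R]_n) :=
  (alpha (clamp 0), L2_class g (srv g alpha)).

(* The right action (a, q) * y = (a y, Ad(y^-1) q) of K; as Ad(y^-1) is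
   invertible, it maps L^2-classes onto L^2-classes. *)
Definition K_act {R : realType} {n k : nat}
    {G : lieGroupType R n} {K : lieGroupType R k} (iota : K -> G)
    (x : G * set (R -> 'rV[R]_n)) (y : K) : G * set (R -> 'rV[R]_n) :=
  ((x.1 * iota y)%g, [set Ad (iota y)^-1%g \o q | q in x.2]).

Definition K_orbit {R : realType} {n k : nat}
    {G : lieGroupType R n} {K : lieGroupType R k} (iota : K -> G)
    (x : G * set (R -> 'rV[R]_n)) : set (G * set (R -> 'rV[R]_n)) :=
  range (K_act iota x).

(* Main.v *)
(* With p = alpha^-1 alpha' the logarithmic derivative of alpha, Q(alpha) is the
   pair of alpha(0) and q = p / sqrt|p|, and p = |q| q; so square integrable q
   correspond to integrable p, and Q is inverted by solving the Caratheodory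
   equation alpha' = alpha p, which has a unique absolutely continuous solution.
   A curve alpha.y with y in K has logarithmic derivative Ad(y^-1) p, and Ad(y^-1)
   preserves the metric and the complement of the Lie algebra of K, so Q turns
   right translation by K into the given action.  It remains to see that every
   absolutely continuous curve in M has a horizontal lift, unique up to right
   translation by K.  The lifting equation is again of Caratheodory type, because
   the kernel of d(proj) is the left translate of the Lie algebra of K; a local
   solution lifts the curve from every point of a fibre after translation by K,
   and local lifts are concatenated. *)
Require Import Defs.
From HB Require Import structures.
From mathcomp Require Import all_boot all_order all_algebra.
From mathcomp Require Import all_classical all_reals all_analysis.
From mathcomp Require Import measurable_realfun.
From mathcomp Require Import ring lra.

Set Implicit Arguments.
Unset Strict Implicit.
Unset Printing Implicit Defensive.

Import Order.TTheory GRing.Theory Num.Theory.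
Import numFieldNormedType.Exports.

Local Open Scope classical_set_scope.
Local Open Scope ring_scope.

(** * Absolutely continuous functions *)

(** The data are only integrable in time, so equations hold almost everywhere, and uniqueness rests
    on the fact that an absolutely continuous function is the integral of its derivative. That fact
    comes from Radon-Nikodym, applied to Lebesgue-Stieltjes measures of monotone functions. In a
    chart both equations have the form u' = p A(u), with p integrable in t and A locally Lipschitz;
    Picard iteration contracts where the integral of |p| is small.

    Results on [0,1] are assembled from short intervals by one induction ([cousin_ind]). For
    solutions this needs a window length that does not depend on the starting point. Left
    translations of G supply it when p is integrated, right translations by K when a curve is
    lifted.

    No relation between the dimensions of G, K and M is assumed, so it has to be proved that the
    kernel of d(proj) is no larger than the translated Lie algebra of K. A kernel vector is realised
    as the velocity of a curve inside a coset. This curve comes from a curve in K, which compactness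
    of K makes continuous at the identity; that is enough to show that the velocity is tangent to
    K. *)

Section clip.
Context {R : realType}.
Implicit Types a b s t : R.

Definition clip a b t := Num.max a (Num.min b t).

Lemma clip_ge a b t : a <= clip a b t.
Proof. by rewrite le_max lexx. Qed.

Lemma clip_le a b t : a <= b -> clip a b t <= b.
Proof. by move=> ab; rewrite ge_max ab ge_min lexx. Qed.

Lemma clip_id a b t : a <= t -> t <= b -> clip a b t = t.
Proof. by move=> at_ tb; rewrite /clip (min_r tb) (max_r at_). Qed.

Lemma clip_homo a b s t : s <= t -> clip a b s <= clip a b t.
Proof.
by move=> st; rewrite ge_max !le_max lexx/= le_min !ge_min lexx st !orbT.
Qed.

Lemma clip_lipschitz a b s t : `|clip a b t - clip a b s| <= `|t - s|.
Proof.
wlog st : s t / s <= t => [H|].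
  by case: (leP s t) => [/H//|/ltW /H]; rewrite distrC [leRHS]distrC.
rewrite !ger0_norm ?subr_ge0 ?clip_homo//.
have min_lip x y : x <= y -> Num.min b y - Num.min b x <= y - x.
  by move=> xy; case: (leP b x); case: (leP b y); lra.
have max_lip x y : x <= y -> Num.max a y - Num.max a x <= y - x.
  by move=> xy; case: (leP a x); case: (leP a y); lra.
apply: le_trans (max_lip _ _ _) (min_lip _ _ st).
by rewrite le_min !ge_min lexx st orbT.
Qed.

End clip.

(** Compactness of [a, b] as an induction principle: the supremum of the end points reached from a
    is reached, and equals b. The short intervals near t need not contain t. *)
Lemma cousin_ind {R : realType} (a b : R) (P : R -> R -> Prop) : a <= b ->
  (forall t, a <= t <= b -> exists2 d, 0 < d &
     forall s r, a <= s -> s <= r -> r <= b -> t - d < s -> r < t + d -> P s r) ->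
  (forall s r t, a <= s -> s <= r -> r <= t -> t <= b ->
     P s r -> P r t -> P s t) ->
  P a b.
Proof.
move=> ab loc cat.
pose S := [set x | a <= x <= b /\ P a x].
have Sa : S a.
  have [|d d0 H] := loc a; first by rewrite lexx.
  by split; [rewrite lexx|apply: H; lra].
have hS : has_sup S.
  by split; [exists a|exists b => x [/andP[]]].
have ac : a <= sup S by apply: ub_le_sup => //; exact: hS.2.
have cb : sup S <= b by apply: ge_sup; [exists a|move=> x [/andP[]]].
have [|d d0 H] := loc (sup S); first by rewrite ac cb.
have [x [/andP[ax xb] Pax] dx] := sup_adherent d0 hS.
have xc : x <= sup S by apply: ub_le_sup; [exact: hS.2|split => //; rewrite ax].
(* The window around [sup S] allows a step from x to y. As y is then reached it cannot exceed
   [sup S], which leaves only y = b. *)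
pose y := Num.min b (sup S + d / 2).
have xy : x <= y by rewrite le_min xb /=; lra.
have yb : y <= b by rewrite ge_min lexx.
have yd : y < sup S + d by rewrite gt_min; apply/orP; right; lra.
have Pay : P a y by apply: (cat a x y) => //; exact: H.
have yS : y <= sup S.
  by apply: ub_le_sup; [exact: hS.2|split => //; rewrite yb andbT; lra].
suff <- : y = b by [].
move: yS; rewrite /y; case: (leP b (sup S + d / 2)) => //; lra.
Qed.

Section absolutely_continuous.
Context {R : realType}.
Implicit Types (x y : R * R) (l : seq (R * R)).

Definition separated x y := (x.2 <= y.1) || (y.2 <= x.1).

Definition within_segment (a b : R) x := [&& a <= x.1, x.1 <= x.2 & x.2 <= b].

Definition total_length l := \sum_(x <- l) (x.2 - x.1).

Definition variation {E : normedModType R} (f : R -> E) l :=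
  \sum_(x <- l) `|f x.2 - f x.1|.

Definition AC {E : normedModType R} (a b : R) (f : R -> E) :=
  forall e, 0 < e -> exists2 d, 0 < d & forall l,
    all (within_segment a b) l -> pairwise separated l -> total_length l < d ->
    variation f l < e.

Lemma AC_sub {E : normedModType R} (a b a' b' : R) (f : R -> E) :
  a <= a' -> b' <= b -> AC a b f -> AC a' b' f.
Proof.
move=> aa bb acf e e0; have [d d0 H] := acf e e0; exists d => // l wl pl ld.
apply: H => //; apply: sub_all wl => x /and3P[x1 x2 x3].
by rewrite /within_segment x2 (le_trans aa)// (le_trans x3).
Qed.

Lemma AC_dominated {E F : normedModType R} (a b L : R) (f : R -> E) (h : R -> F) :
  (forall s t, a <= s -> s <= t -> t <= b -> `|h t - h s| <= L * `|f t - f s|) ->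
  AC a b f -> AC a b h.
Proof.
move=> dom acf e e0.
have [|d d0 H] := acf (e / (`|L| + 1)); first by rewrite divr_gt0// ltr_wpDl.
exists d => // l wl pl ld; have := H l wl pl ld.
rewrite ltr_pdivlMr ?ltr_wpDl// mulr_suml.
apply: le_lt_trans; rewrite /variation !big_seq; apply: ler_sum => x xl.
have /and3P[x1 x2 x3] := allP wl _ xl.
rewrite (le_trans (dom _ _ x1 x2 x3))// mulrC ler_wpM2l//.
by rewrite (le_trans (ler_norm _))// lerDl.
Qed.

Lemma eq_AC {E : normedModType R} (a b : R) (f h : R -> E) :
  (forall t, a <= t -> t <= b -> f t = h t) -> AC a b f -> AC a b h.
Proof.
move=> fh; apply: (@AC_dominated _ _ _ _ 1) => s t as_ st tb.
by rewrite mul1r !fh// ?(le_trans as_)// (le_trans st).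
Qed.

(** Both end points of every segment are truncated at b. A segment on one side of b becomes
    degenerate on the other side and contributes nothing there, so no segment has to be
    discarded. *)
Lemma split_separated {E : normedModType R} (a b c : R) (f : R -> E) l :
  a <= b -> b <= c -> all (within_segment a c) l -> pairwise separated l ->
  exists lo hi,
   [/\ all (within_segment a b) lo /\ pairwise separated lo,
       all (within_segment b c) hi /\ pairwise separated hi,
       total_length lo <= total_length l, total_length hi <= total_length l &
       variation f l <= variation f lo + variation f hi].
Proof.
move=> ab bc wl pl.
have ler_len (m : seq (R * R)) k : m = [seq k x | x <- l] ->
    (forall x, x.1 <= x.2 -> (k x).2 - (k x).1 <= x.2 - x.1) ->
    total_length m <= total_length l.
  move=> -> km; rewrite /total_length big_map !big_seq; apply: ler_sum => x xl.
  by apply: km; have /and3P[] := allP wl _ xl.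
exists [seq (Num.min x.1 b, Num.min x.2 b) | x <- l].
exists [seq (Num.max x.1 b, Num.max x.2 b) | x <- l].
split; [split|split|..].
- apply/allP => _ /mapP[x xl ->]; have /and3P[x1 x2 x3] := allP wl _ xl.
  rewrite /within_segment/= le_min x1 ab/=.
  by rewrite le_min !ge_min x2 lexx !orbT.
- rewrite pairwise_map; apply: sub_pairwise pl => x y /orP[] xy; apply/orP.
    by left; rewrite /= le_min !ge_min xy lexx orbT.
  by right; rewrite /= le_min !ge_min xy lexx orbT.
- apply/allP => _ /mapP[x xl ->]; have /and3P[x1 x2 x3] := allP wl _ xl.
  by rewrite /within_segment/= !ge_max !le_max x2 x3 bc lexx !orbT.
- rewrite pairwise_map; apply: sub_pairwise pl => x y /orP[] xy; apply/orP.
    by left; rewrite /= ge_max !le_max xy lexx !orbT.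
  by right; rewrite /= ge_max !le_max xy lexx !orbT.
- by apply: ler_len => // x /= x12; case: (leP x.1 b); case: (leP x.2 b); lra.
- by apply: ler_len => // x /= x12; case: (leP x.1 b); case: (leP x.2 b); lra.
rewrite /variation !big_map -big_split/= !big_seq; apply: ler_sum => x xl.
have /and3P[x1 x2 x3] := allP wl _ xl.
case: (leP x.1 b) => xb1; case: (leP x.2 b) => xb2.
- by rewrite lerDl.
- by rewrite addrC (le_trans _ (ler_normD _ _))// addrA subrK.
- lra.
- by rewrite lerDr.
Qed.

Lemma AC_cat {E : normedModType R} (a b c : R) (f : R -> E) :
  a <= b -> b <= c -> AC a b f -> AC b c f -> AC a c f.
Proof.
move=> ab bc f1 f2 e e0; have e20 : 0 < e / 2 by rewrite divr_gt0.
have [d1 d10 H1] := f1 _ e20; have [d2 d20 H2] := f2 _ e20.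
exists (Num.min d1 d2); first by rewrite lt_min d10.
move=> l wl pl; rewrite lt_min => /andP[ld1 ld2].
have [lo [hi [[wlo plo] [whi phi] llo lhi lf]]] := split_separated f ab bc wl pl.
rewrite [e]splitr; apply: le_lt_trans lf _; apply: ltrD.
  by apply: H1 => //; exact: le_lt_trans ld1.
by apply: H2 => //; exact: le_lt_trans ld2.
Qed.

Lemma AC_local {E : normedModType R} (a b : R) (f : R -> E) : a <= b ->
  (forall t, a <= t <= b -> exists2 d, 0 < d &
     forall s r, a <= s -> s <= r -> r <= b -> t - d < s -> r < t + d -> AC s r f) ->
  AC a b f.
Proof.
move=> ab loc; apply: (cousin_ind ab loc) => s r t _ sr rt _.
exact: AC_cat.
Qed.

Lemma AC_dist {E : normedModType R} (a b : R) (f : R -> E) : AC a b f ->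
  forall e, 0 < e -> exists2 d, 0 < d &
    forall s t, a <= s -> s <= t -> t <= b -> t - s < d -> `|f t - f s| < e.
Proof.
move=> acf e e0; have [d d0 H] := acf e e0; exists d => // s t as_ st tb tsd.
have := H [:: (s, t)].
by rewrite /variation /total_length !big_seq1/= /within_segment/= as_ st tb; apply.
Qed.

(** The list is not sorted. Its head y separates the other segments into those that end before y and
    those that begin after it, and the induction on the size applies to both groups. *)
Lemma total_length_le (a b : R) l : a <= b ->
  all (within_segment a b) l -> pairwise separated l -> total_length l <= b - a.
Proof.
have [k] := ubnP (size l); elim: k l a b => // k IH [|y l] a b /=.
  by rewrite /total_length big_nil => _ ab _ _; lra.
rewrite ltnS => lk ab /andP[/and3P[y1 y2 y3] wl] /andP[sy pl].
pose P (x : R * R) := x.2 <= y.1.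
have Hl : total_length (seq.filter P l) <= y.1 - a.
  apply: IH => //; first by rewrite (leq_ltn_trans _ lk)// size_filter count_size.
    by apply/allP => x; rewrite mem_filter => /andP[Px] /(allP wl)/and3P[x1 x2 _];
      rewrite /within_segment x1 x2.
  exact: pairwise_filter.
have Hr : total_length (seq.filter (predC P) l) <= b - y.2.
  apply: IH => //; first by rewrite (leq_ltn_trans _ lk)// size_filter count_size.
    apply/allP => x; rewrite mem_filter => /andP[/negP Px] xl.
    have /and3P[x1 x2 x3] := allP wl _ xl; apply/and3P; split => //.
    by have /orP[//|/Px] := allP sy _ xl.
  exact: pairwise_filter.
rewrite /total_length big_cons -/(total_length l).
have -> : total_length l = total_length (seq.filter P l) + total_length (seq.filter (predC P) l).
  by rewrite /total_length !big_filter (bigID P).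
lra.
Qed.

Definition TV {E : normedModType R} (f : R -> E) (a b : R) : R :=
  sup [set variation f l | l in [set l |
    all (within_segment a b) l /\ pairwise separated l]].

(** With d the modulus for the value 1, families inside an interval shorter than d have variation at
    most 1, and bounds add up under concatenation. *)
Lemma AC_variation_bounded {E : normedModType R} (a b : R) (f : R -> E) :
  a <= b -> AC a b f -> exists C, forall l,
    all (within_segment a b) l -> pairwise separated l -> variation f l <= C.
Proof.
move=> ab acf; have [d d0 H] := acf 1 ltr01.
pose P s r := exists C, forall l,
  all (within_segment s r) l -> pairwise separated l -> variation f l <= C.
apply: (cousin_ind (P := P) ab) => [t tab|s r t sa sr rt tb [C HC] [D HD]].
  exists (d / 2); first lra.
  move=> s r as_ sr rb ts rt; exists 1 => l wl pl; apply/ltW/H => //.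
    by apply: sub_all wl => x /and3P[x1 x2 x3]; apply/and3P; split => //; lra.
  apply: (@le_lt_trans _ _ (r - s)); last lra.
  exact: total_length_le.
exists (C + D) => l wl pl.
have [lo [hi [[wlo plo] [whi phi] _ _ lf]]] := split_separated f sr rt wl pl.
by apply: le_trans lf _; apply: lerD; [exact: HC|exact: HD].
Qed.

Section total_variation.
Context {E : normedModType R} (a b : R) (f : R -> E).
Hypotheses (ab : a <= b) (acf : AC a b f).

Let TV_has_sup s t : a <= s -> t <= b -> has_sup [set variation f l | l in [set l |
    all (within_segment s t) l /\ pairwise separated l]].
Proof.
move=> as_ tb; have [C HC] := AC_variation_bounded ab acf.
split; first by exists (variation f [::]), [::].
exists C => _ [l [wl pl] <-]; apply: HC => //.
apply: sub_all wl => x /and3P[x1 x2 x3]; apply/and3P; split => //; lra.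
Qed.

Lemma variation_le_TV s t l : a <= s -> t <= b ->
  all (within_segment s t) l -> pairwise separated l -> variation f l <= TV f s t.
Proof.
move=> as_ tb wl pl; apply: ub_le_sup; first exact: (TV_has_sup as_ tb).2.
by exists l.
Qed.

Lemma TV_le s t C : a <= s -> t <= b ->
  (forall l, all (within_segment s t) l -> pairwise separated l ->
     variation f l <= C) -> TV f s t <= C.
Proof.
move=> as_ tb H; apply: ge_sup; first exact: (TV_has_sup as_ tb).1.
by move=> _ [l [wl pl] <-]; exact: H.
Qed.

Lemma TV_split_le s r t : a <= s -> s <= r -> r <= t -> t <= b ->
  TV f s t <= TV f s r + TV f r t.
Proof.
move=> as_ sr rt tb; apply: TV_le => // l wl pl.
have [lo [hi [[wlo plo] [whi phi] _ _ lf]]] := split_separated f sr rt wl pl.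
apply: le_trans lf _; apply: lerD; apply: variation_le_TV => //; lra.
Qed.

(** A family in [a, s] extended by the segment (s, t) is a family in [a, t]. For real f the
    inequality makes both [TV f a] and [TV f a - f] nondecreasing. *)
Lemma dist_le_TV s t : a <= s -> s <= t -> t <= b ->
  `|f t - f s| <= TV f a t - TV f a s.
Proof.
move=> as_ st tb; rewrite lerBrDr -lerBrDl; apply: TV_le => //; first lra.
move=> l wl pl; rewrite lerBrDl.
have -> : `|f t - f s| + variation f l = variation f ((s, t) :: l).
  by rewrite /variation big_cons.
apply: variation_le_TV => //=.
  rewrite {1}/within_segment/= as_ st lexx/=.
  by apply: sub_all wl => x /and3P[x1 x2 x3]; apply/and3P; split => //; lra.
rewrite pl andbT; apply: sub_all wl => x /and3P[x1 x2 x3].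
by rewrite /separated/= x3 orbT.
Qed.

Lemma TV_homo s t : a <= s -> s <= t -> t <= b -> TV f a s <= TV f a t.
Proof.
move=> as_ st tb; rewrite -subr_ge0; apply: le_trans (dist_le_TV as_ st tb) => //.
Qed.

(** The suprema are resolved one at a time: on the segments of [l1] the total variation still
    stands, while [l2] collects the partitions already chosen. Each step replaces the head of [l1]
    by an arbitrary partition of it, moved into [l2]. *)
Let sum_TV_variation (e d : R) l1 l2 :
  (forall l, all (within_segment a b) l -> pairwise separated l ->
    total_length l < d -> variation f l <= e) ->
  all (within_segment a b) (l1 ++ l2) -> pairwise separated (l1 ++ l2) ->
  total_length (l1 ++ l2) < d ->
  \sum_(x <- l1) TV f x.1 x.2 + variation f l2 <= e.
Proof.
move=> H; elim: l1 l2 => [|y l1 IH] l2 /=.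
  by rewrite big_nil add0r; exact: H.
move=> /andP[/and3P[y1 y2 y3] wl] /andP[sl pl] ld.
rewrite big_cons -addrA -lerBrDr; apply: TV_le => // m wm pm.
rewrite lerBrDr addrCA.
have -> : variation f m + variation f l2 = variation f (m ++ l2).
  by rewrite /variation big_cat.
apply: IH.
- move: wl; rewrite !all_cat => /andP[-> ->]; rewrite andbT/=.
  by apply: sub_all wm => x /and3P[x1 x2 x3]; apply/and3P; split => //; lra.
- have ysep x z : within_segment y.1 y.2 x -> separated y z -> separated x z.
    by move=> /and3P[x1 x2 x3] /orP[] h; apply/orP; [left|right]; lra.
  have sepC x z : separated x z = separated z x by rewrite /separated orbC.
  move: pl sl; rewrite !pairwise_cat all_cat pm.
  move=> /and3P[p12 -> ->]/= /andP[sy1 sy2]; rewrite andbT.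
  apply/andP; split; apply/allrelP => x z xl.
    rewrite mem_cat => /orP[zm|zl2]; last exact: (allrelP p12).
    by rewrite sepC; apply: ysep (allP wm _ zm) (allP sy1 _ xl).
  by move=> zl2; exact: ysep (allP wm _ xl) (allP sy2 _ zl2).
- apply: le_lt_trans ld; rewrite /total_length !big_cons !big_cat/=.
  by rewrite addrCA lerD2r total_length_le.
Qed.

Lemma AC_TV : AC a b (fun t => TV f a t : R^o).
Proof.
move=> e e0; have e20 : 0 < e / 2 by lra.
have [d d0 H] := acf e20; exists d => // l wl pl ld.
(* Suprema preserve only weak inequalities, hence the modulus for e / 2. *)
apply: (@le_lt_trans _ _ (e / 2)); last lra.
have := @sum_TV_variation (e / 2) d l [::].
rewrite cats0 {2}/variation big_nil addr0.
move=> /(_ _ wl pl ld) H'; apply: le_trans (H' _); last first.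
  by move=> *; apply/ltW/H.
rewrite /variation !big_seq; apply: ler_sum => x xl.
have /and3P[x1 x2 x3] := allP wl _ xl.
rewrite ger0_norm ?subr_ge0 ?TV_homo// lerBlDl.
by apply: TV_split_le => //; lra.
Qed.

End total_variation.

End absolutely_continuous.

(** * Absolute continuity of Lebesgue-Stieltjes measures and integral representation *)

Section lebesgue_stieltjes_AC.
Context {R : realType}.
Implicit Types (x y : R * R) (l : seq (R * R)).
Notation mu := (@lebesgue_measure R).

(* Overlapping intervals are replaced by their hull until none is left. *)
Lemma separated_cover (a b : R) l : all (within_segment a b) l ->
  exists l', [/\ all (within_segment a b) l', pairwise separated l',
    (size l' <= size l)%N, total_length l' <= total_length l &
    forall t, has (fun x => x.1 < t <= x.2) l -> has (fun x => x.1 < t <= x.2) l'].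
Proof.
have [k] := ubnP (size l); elim: k l => // k IH [|y l] /=.
  by move=> _ _; exists [::].
rewrite ltnS => lk /andP[wy wl].
have [l1 [wl1 pl1 sl1 tl1 cl1]] := IH l lk wl.
have [sy|] := boolP (all (separated y) l1).
  exists (y :: l1); split => //=; rewrite ?wy ?sy ?ltnS//.
    by rewrite /total_length !big_cons lerD2l.
  by move=> t /orP[->//|/cl1 ->]; rewrite orbT.
move=> /allPn[z zl1]; rewrite /separated negb_or -!ltNge => /andP[zy yz].
pose h := (Num.min y.1 z.1, Num.max y.2 z.2).
have wz := allP wl1 _ zl1.
have pz : perm_eq l1 (z :: rem z l1) by exact: perm_to_rem.
have tz : total_length l1 = (z.2 - z.1) + total_length (rem z l1).
  by rewrite /total_length (perm_big _ pz) big_cons.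
have szE : size (h :: rem z l1) = size l1 by rewrite (perm_size pz).
have sz : (size (h :: rem z l1) < k)%N by rewrite szE (leq_ltn_trans sl1).
have [|l2 [wl2 pl2 sl2 tl2 cl2]] := IH _ sz.
  rewrite /= (sub_all _ (_ : all (within_segment a b) (rem z l1))) => //; last first.
    by apply/allP => u /mem_rem; exact: (allP wl1).
  rewrite andbT; move: wy wz => /and3P[y1 y2 y3] /and3P[z1 z2 z3].
  by rewrite /within_segment/= le_min ge_max le_max ge_min y1 y2 y3 z1 z3.
exists l2; split => //.
- by rewrite (leq_trans sl2)// szE (leq_trans sl1).
- apply: le_trans tl2 _; rewrite /total_length !big_cons -!/(total_length _).
  move: tl1; rewrite tz => tl1.
  have : h.2 - h.1 <= (y.2 - y.1) + (z.2 - z.1).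
    rewrite /h/=; move: wy wz => /and3P[? ? ?] /and3P[? ? ?].
    by case: (leP y.1 z.1); case: (leP y.2 z.2); lra.
  lra.
move=> t tl; apply: cl2 => /=; move: tl => /orP[ty|/cl1].
  by rewrite gt_min le_max; lra.
rewrite (perm_has _ pz)/= => /orP[/andP[t1 t2]|->]; last by rewrite orbT.
by rewrite gt_min le_max t1 t2 !orbT.
Qed.

Variable F : cumulative R R.
Local Notation nu := (lebesgue_stieltjes_measure F).

Lemma lebesgue_stieltjes_ocitv (s t : R) : s <= t -> nu `]s, t]%classic = (F t - F s)%:E.
Proof.
move=> st; rewrite /lebesgue_stieltjes_measure /measure_extension.
rewrite measurable_mu_extE/=; last exact: is_ocitv.
exact: wlength_itv_bnd.
Qed.

Let nu_le l (A : set R) : all (fun x => x.1 <= x.2) l -> measurable A ->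
  (forall t, A t -> has (fun x => x.1 < t <= x.2) l) ->
  (nu A <= (variation F l)%:E)%E.
Proof.
elim: l A => [|x l IH] A /=.
  move=> _ mA A0; have -> : A = set0 by apply/seteqP; split => // t /A0.
  by rewrite measure0 /variation big_nil.
move=> /andP[x12 xl] mA Al.
have -> : A = (A `&` `]x.1, x.2]%classic) `|` (A `\` `]x.1, x.2]%classic).
  by rewrite setUIDK.
apply: le_trans (measureU2 _ _ _) _.
- exact: measurableI.
- exact: measurableD.
rewrite /variation big_cons EFinD; apply: leeD.
  apply: (@le_trans _ _ (nu `]x.1, x.2]%classic)).
    by apply: le_measure; rewrite ?inE//; exact: measurableI.
  by rewrite lebesgue_stieltjes_ocitv// lee_fin ler_norm.
apply: IH => //; first exact: measurableD.
move=> t [/Al /orP[tx|//] tnx]; exfalso; apply: tnx.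
by rewrite /= in_itv.
Qed.

(** A null set is covered by countably many half-open intervals of total length below the modulus d
    of F. Finitely many of them, made separated, have F-variation below e, and continuity from below
    gives the bound e for the whole cover. *)
Lemma lebesgue_stieltjes_null (a b : R) (N : set R) : a <= b -> AC a b (F : R -> R^o) ->
  measurable N -> mu N = 0%E -> nu (N `&` `]a, b]%classic) = 0%E.
Proof.
move=> ab acF mN N0; apply/eqP; rewrite eq_le measure_ge0 andbT.
apply/lee_addgt0Pr => e e0; rewrite add0e.
have [d d0 H] := acF e e0.
have : (mu N < d%:E)%E by rewrite N0 lte_fin.
rewrite /lebesgue_measure /lebesgue_stieltjes_measure /measure_extension.
move=> /ereal_inf_lt[_ [A [mA NA] <-] Ad].
have /choice[p Hp] : forall k, exists x, x.1 <= x.2 /\ A k = `]x.1, x.2]%classic.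
  move=> k; have /ocitvP[->|[x x12 ->]] := mA k.
    by exists (0, 0); split => //=; rewrite set_itvoc0.
  by exists x; rewrite ltW.
(* Clipping keeps the part of each interval in ]a, b] and does not increase its length. *)
pose q k := (clip a b (p k).1, clip a b (p k).2).
have q12 k : (q k).1 <= (q k).2.
  by have [p12 _] := Hp k; exact: clip_homo.
have wq k : within_segment a b (q k).
  by apply/and3P; split; [exact: clip_ge|exact: q12|exact: clip_le].
pose U n := \bigcup_(k in `I_n) `](q k).1, (q k).2]%classic.
have mU n : measurable (U n) by apply: bigcup_measurable.
have sub : N `&` `]a, b]%classic `<=` \bigcup_n U n.
  move=> t [/NA[k _ Akt]] /=; rewrite in_itv/= => /andP[at_ tb].
  exists k.+1 => //; exists k => //=.
  have [_ Ak] := Hp k; move: Akt; rewrite Ak /= !in_itv/= => /andP[pt tp].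
  rewrite /q /clip/= gt_max at_ gt_min pt orbT/= le_max le_min tb tp.
  by rewrite orbT.
have mbU : measurable (\bigcup_n U n) by apply: bigcup_measurable.
apply: (@le_trans _ _ (nu (\bigcup_n U n))).
  by apply: le_measure; rewrite ?inE//; exact: measurableI.
have cvU : nu \o U @ \oo --> nu (\bigcup_n U n).
  apply: nondecreasing_cvg_mu => // m n mn; apply/subsetPset => t [k /= km qt].
  by exists k => //=; exact: leq_trans mn.
rewrite -(cvg_lim _ cvU)//; apply: lime_le; first by apply/cvg_ex; exists (nu (\bigcup_n U n)).
apply: nearW => n /=.
have [|l' [wl' pl' _ tl' cl']] := @separated_cover a b [seq q k | k <- iota 0 n].
  by apply/allP => _ /mapP[k _ ->].
apply: (@le_trans _ _ (variation F l')%:E).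
  apply: nu_le => //.
    by apply: sub_all wl' => x /and3P[].
  move=> t [k /= kn]; rewrite in_itv/= => qt; apply: cl'.
  by apply/hasP; exists (q k) => //; apply/map_f; rewrite mem_iota.
rewrite lee_fin ltW//; apply: H => //.
apply: le_lt_trans tl' _; rewrite -lte_fin; apply: le_lt_trans Ad.
rewrite /total_length big_map -sumEFin.
apply: le_trans (nneseries_lim_ge n _) => /=; last first.
  by move=> k _ _; exact: wlength_ge0.
rewrite /index_iota subn0; apply: lee_sum => k _.
have [p12 ->] := Hp k; rewrite wlength_itv_bnd// lee_fin /= /q /=.
by have := clip_lipschitz a b (p k).1 (p k).2; rewrite !ger0_norm ?subr_ge0 ?clip_homo.
Qed.

End lebesgue_stieltjes_AC.

Section AC_integral.
Context {R : realType}.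
Notation mu := (@lebesgue_measure R).

(* Radon-Nikodym for the Lebesgue-Stieltjes measure of f, which is absolutely continuous. *)
Let AC_homo_integral (a b : R) (f : R -> R) : a <= b -> AC a b (f : R -> R^o) ->
  (forall s t, a <= s -> s <= t -> t <= b -> f s <= f t) ->
  exists2 h : R -> R, mu.-integrable setT (EFin \o h) &
    forall t, a <= t -> t <= b -> f t - f a = \int[mu]_(x in `[a, t]) h x.
Proof.
move=> ab acf fnd.
(* F is constant on both sides of [a, b], so it is nondecreasing and right continuous on the whole
   line, as a Lebesgue-Stieltjes measure requires. *)
pose F t := f (clip a b t).
have Fnd : nondecreasing F.
  by move=> s t st; apply: fnd; [exact: clip_ge|exact: clip_homo|exact: clip_le].
have Frc : right_continuous F.
  move=> x; apply/cvgrPdist_lt => e e0; have [d d0 H] := AC_dist acf e0.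
  near=> t.
  have xt : x <= t by near: t; exact: nbhs_right_ge.
  rewrite distrC; apply: H; [exact: clip_ge|exact: clip_homo|exact: clip_le|].
  have := clip_lipschitz a b x t; rewrite !ger0_norm ?subr_ge0 ?clip_homo// => /le_lt_trans; apply.
  rewrite ltrBlDl.
  by near: t; apply: nbhs_right_lt; rewrite ltrDl.
pose FC : cumulative R R := HB.pack F (isCumulative.Build R _ R F Fnd Frc).
have acF : AC a b (FC : R -> R^o).
  by apply: eq_AC acf => t at_ tb; rewrite /= /F clip_id.
pose nu0 := lebesgue_stieltjes_measure FC.
have mab : measurable (`]a, b]%classic : set (measurableTypeR R)) by exact: measurable_itv.
have fin : (nu0 `]a, b]%classic < +oo)%E.
  by rewrite /nu0 lebesgue_stieltjes_ocitv// ltry.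
pose nu : {finite_measure set (measurableTypeR R) -> \bar R} := mfrestr mab fin.
have numu : nu `<< mu.
  apply/null_content_dominatesP => N mN N0.
  exact: (lebesgue_stieltjes_null ab acF).
have [h [h0 hfin hint hE]] := radon_nikodym_sigma_finite numu.
have hfE : EFin \o (fine \o h) = h by apply/funext => x /=; rewrite fineK.
exists (fine \o h); first by rewrite hfE.
move=> t at_ tb; rewrite -Rintegral_itv_obnd_cbnd; last first.
  by rewrite hfE; apply: integrableS hint => //; exact: measurable_itv.
rewrite /Rintegral.
have -> : (\int[mu]_(x in `]a, t]) (((fine \o h) x)%:E) = \int[mu]_(x in `]a, t]) h x)%E.
  by apply: eq_integral => x _ /=; rewrite fineK.
rewrite -hE; last exact: measurable_itv.
rewrite /nu /= /mfrestr /mrestr setIidl; last first.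
  by move=> x /=; rewrite !in_itv/= => /andP[->/=] xt; exact: le_trans tb.
by rewrite lebesgue_stieltjes_ocitv//= /F !clip_id.
Unshelve. all: by end_near. Qed.

(** Jordan decomposition: f = T - (T - f) with T its total variation, and both terms are
    nondecreasing and absolutely continuous. *)
Theorem AC_integral (a b : R) (f : R -> R) : a <= b -> AC a b (f : R -> R^o) ->
  exists2 h : R -> R, mu.-integrable setT (EFin \o h) &
    forall t, a <= t -> t <= b -> f t - f a = \int[mu]_(x in `[a, t]) h x.
Proof.
move=> ab acf; pose T t := TV (f : R -> R^o) a t.
have acT : AC a b (T : R -> R^o) by exact: AC_TV.
have Tf s t : a <= s -> s <= t -> t <= b -> `|f t - f s| <= T t - T s.
  exact: (dist_le_TV ab acf).
have [h1 ih1 H1] : exists2 h : R -> R, mu.-integrable setT (EFin \o h) &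
    forall t, a <= t -> t <= b -> T t - T a = \int[mu]_(x in `[a, t]) h x.
  by apply: AC_homo_integral => // s t as_ st tb; rewrite -subr_ge0; apply: le_trans (Tf _ _ as_ st tb).
have [h2 ih2 H2] : exists2 h : R -> R, mu.-integrable setT (EFin \o h) &
    forall t, a <= t -> t <= b -> (T t - f t) - (T a - f a) = \int[mu]_(x in `[a, t]) h x.
  apply: AC_homo_integral => //.
    apply: (@AC_dominated _ _ _ a b 2 (T : R -> R^o)) acT => s t as_ st tb.
    have -> : T t - f t - (T s - f s) = (T t - T s) - (f t - f s) by lra.
    apply: le_trans (ler_normB _ _) _; have := Tf _ _ as_ st tb.
    by have := ler_norm (T t - T s); lra.
  move=> s t as_ st tb; have := Tf s t as_ st tb.
  by have := ler_norm (f t - f s); lra.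
exists (fun x => h1 x - h2 x).
  by have := integrableB measurableT ih1 ih2; apply: eq_integrable.
move=> t at_ tb; rewrite RintegralB//.
- by rewrite -H1// -H2//; lra.
- exact: integrableS ih1.
- exact: integrableS ih2.
Qed.

End AC_integral.

(** * Primitives of integrable curves *)

Section lebesgue_ae.
Context {R : realType}.
Notation mu := (@lebesgue_measure R).
Implicit Types P Q : R -> Prop.

Lemma lebesgue_aeS P Q : (forall x, P x -> Q x) ->
  {ae mu, forall x, P x} -> {ae mu, forall x, Q x}.
Proof. by have F := ae_filter_ringOfSetsType mu; move=> PQ; exact: filterS. Qed.

Lemma lebesgue_aeI P Q : {ae mu, forall x, P x} -> {ae mu, forall x, Q x} ->
  {ae mu, forall x, P x /\ Q x}.
Proof. by have F := ae_filter_ringOfSetsType mu; move=> aP aQ; exact: filterI. Qed.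

Lemma lebesgue_ae_forall (n : nat) (P : 'I_n -> R -> Prop) :
  (forall i, {ae mu, forall x, P i x}) -> {ae mu, forall x, forall i, P i x}.
Proof.
(* The finite family becomes a sequence whose members of index at least n are vacuous, so that the
   countable intersection of full sets applies. *)
move=> aeP; pose Q k x := forall i : 'I_n, val i = k -> P i x.
have : {ae mu, forall x, forall k, Q k x}.
  apply: (ae_foralln (mu := mu)) => k; have [kn|nk] := ltnP k n.
    apply: lebesgue_aeS (aeP (Ordinal kn)) => x Px i ik.
    by rewrite (_ : i = Ordinal kn)//; exact: val_inj.
  apply: lebesgue_aeS (_ : {ae mu, forall x, True}).
    by move=> x _ i ik; move: (ltn_ord i); rewrite ik ltnNge nk.
  by exists set0; split; [exact: measurable0|exact: measure0|move=> x; apply].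
by apply: lebesgue_aeS => x Qx i; exact: Qx (val i) i erefl.
Qed.

Lemma lebesgue_ae_neq (a : R) : {ae mu, forall x, x != a}.
Proof.
exists [set a]; split; first exact: measurable_set1.
  exact: lebesgue_measure_set1.
by move=> x /= /negP; rewrite negbK => /eqP.
Qed.

End lebesgue_ae.

Section mx_norm_bounds.
Context {R : realType}.

Lemma norm_mx_coord_le {m n : nat} (A : 'M[R]_(m, n)) i j : `|A i j| <= `|A|.
Proof.
by rewrite [leRHS]/Num.Def.normr/= mx_normrE; exact: (le_bigmax _ (fun ij => `|A ij.1 ij.2|) (i, j)).
Qed.

Lemma norm_mx_le {m n : nat} (A : 'M[R]_(m, n)) c :
  0 <= c -> (forall i j, `|A i j| <= c) -> `|A| <= c.
Proof.
by move=> c0 H; rewrite [leLHS]/Num.Def.normr/= mx_normrE; apply: bigmax_le.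
Qed.

Lemma norm_rV_le_sum {n : nat} (v : 'rV[R]_n) : `|v| <= \sum_i `|v 0 i|.
Proof.
apply: norm_mx_le => [|i j]; first exact: sumr_ge0.
by rewrite (ord1 i) (bigD1 j)//= lerDl sumr_ge0.
Qed.

End mx_norm_bounds.

Section vector_integral.
Context {R : realType} {n : nat}.
Notation mu := (@lebesgue_measure R).
Implicit Types (h : R -> 'rV[R]_n) (a b s t : R).

(** Integrability is asked on the whole line, so that passing to a subinterval carries no side
    condition. *)
Definition row_integrable h := forall i, mu.-integrable setT (EFin \o (fun x => h x 0 i)).

Definition row_integral s t h : 'rV[R]_n :=
  \row_i \int[mu]_(x in `[s, t]) h x 0 i.

Definition primitive a b (f h : R -> 'rV[R]_n) :=
  row_integrable h /\
  forall t, a <= t -> t <= b -> f t = f a + row_integral a t h.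

Lemma row_integrable_sub h i s t : row_integrable h ->
  mu.-integrable `[s, t] (EFin \o (fun x => h x 0 i)).
Proof. by move=> ih; apply: integrableS (ih i) => //; exact: measurable_itv. Qed.

Lemma row_integral_cat h a s t : row_integrable h -> a <= s -> s <= t ->
  row_integral a t h = row_integral a s h + row_integral s t h.
Proof.
move=> ih as_ st; apply/rowP => i; rewrite !mxE.
have := @Rintegral_itvB R (fun x => h x 0 i) (BLeft a) (BRight t) s.
move=> /(_ (row_integrable_sub _ _ _ ih)); rewrite !bnd_simp => /(_ as_ st).
rewrite Rintegral_itv_obnd_cbnd; last first.
  by apply: integrableS (ih i) => //; exact: measurable_itv.
by move=> <-; rewrite addrC subrK.
Qed.

Lemma row_integral_le h (k : R -> R) s t : row_integrable h ->
  mu.-integrable setT (EFin \o k) ->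
  (forall x, s <= x -> x <= t -> `|h x| <= k x) ->
  `|row_integral s t h| <= \int[mu]_(x in `[s, t]) k x.
Proof.
move=> ih ik hk; have mst : measurable (`[s, t]%classic : set (measurableTypeR R)).
  exact: measurable_itv.
have hk' x : `[s, t]%classic x -> `|h x| <= k x.
  by rewrite /= in_itv/= => /andP[]; exact: hk.
apply: norm_mx_le => [|i j].
  by apply: Rintegral_ge0 => x /hk'; apply: le_trans.
rewrite (ord1 i) mxE; apply: le_trans (le_normr_Rintegral _ _) _ => //.
  exact: row_integrable_sub.
apply: le_Rintegral => //.
- by have /integrable_norm := row_integrable_sub j s t ih.
- by apply: integrableS ik.
- by move=> x /hk'; apply: le_trans; exact: norm_mx_coord_le.
Qed.

Lemma integrable_sum_norm h : row_integrable h ->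
  mu.-integrable setT (EFin \o (fun x => \sum_i `|h x 0 i|)).
Proof.
move=> ih.
have -> : EFin \o (fun x => \sum_i `|h x 0 i|) =
    (fun x => \sum_(i <- index_enum 'I_n) (`|h x 0 i|)%:E)%E.
  by apply/funext => x /=; rewrite sumEFin.
apply: integrable_sum => //= i _.
by have /integrable_norm := ih i.
Qed.

Lemma primitive_sub a b a' b' f h : a <= a' -> a' <= b -> b' <= b ->
  primitive a b f h -> primitive a' b' f h.
Proof.
move=> aa ab bb [ih H]; split => // t at_ tb.
have a't : a <= t by exact: le_trans at_.
have tb' : t <= b by exact: le_trans bb.
by rewrite (H _ a't tb') (H _ aa ab) (row_integral_cat ih aa at_) addrA.
Qed.

Lemma primitiveB a b f h s t : primitive a b f h -> a <= s -> s <= t -> t <= b ->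
  f t = f s + row_integral s t h.
Proof.
move=> pf as_ st tb; have [_ ->//] := primitive_sub as_ (le_trans st tb) (lexx b) pf.
Qed.

Lemma AC_primitive a b (f : R -> 'rV[R]_n) : a <= b -> AC a b f ->
  exists h, primitive a b f h.
Proof.
move=> ab acf.
have /choice[h H] : forall i, exists h : R -> R, mu.-integrable setT (EFin \o h) /\
    forall t, a <= t -> t <= b -> f t 0 i - f a 0 i = \int[mu]_(x in `[a, t]) h x.
  move=> i; have [|h ih H] := @AC_integral R a b (fun t => f t 0 i) ab.
    apply: (@AC_dominated _ _ _ _ _ 1) acf => s t _ _ _; rewrite mul1r.
    by have := norm_mx_coord_le (f t - f s) 0 i; rewrite !mxE.
  by exists h.
exists (fun x => \row_i h i x); split => [i|t at_ tb].
  by have [+ _] := H i; apply: eq_integrable => // x _ /=; rewrite mxE.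
apply/rowP => i; rewrite !mxE; have [_ /(_ t at_ tb) Hi] := H i.
rewrite -(subrK (f a 0 i) (f t 0 i)) Hi addrC; congr (_ + _).
by apply: eq_Rintegral => x _; rewrite mxE.
Qed.

(** The variation over a separated family is at most the integral of the coordinate sum of |h| over
    its union, which is small with the measure of that union. *)
Lemma primitive_AC a b f h : primitive a b f h -> AC a b f.
Proof.
move=> pf; have [ih _] := pf; have ik := integrable_sum_norm ih.
move=> e e0; have [d [d0 H]] := integral_normr_continuous ik e0.
exists d => // l wl pl ld.
pose k x := \sum_i `|h x 0 i|.
have k0 x : 0 <= k x by apply: sumr_ge0.
(* Half-open intervals make segments that share an end point disjoint. *)
pose U (l : seq (R * R)) : set R := [set t | has (fun x => x.1 < t <= x.2) l].
have Ucons x l' : U (x :: l') = `]x.1, x.2]%classic `|` U l'.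
  apply/seteqP; split => t /=; rewrite in_itv/=.
    by move=> /orP[]; [left|right].
  by move=> [xt|lt]; apply/orP; [left|right].
have mU l' : measurable (U l' : set (measurableTypeR R)).
  elim: l' => [|x l' IH]; last by rewrite Ucons; apply: measurableU => //; exact: measurable_itv.
  by rewrite (_ : U [::] = set0)//; apply/seteqP; split.
have step l' : all (within_segment a b) l' -> pairwise separated l' ->
    mu (U l') = (total_length l')%:E /\ variation f l' <= \int[mu]_(x in U l') k x.
  elim: l' => [|x l' IH] /=.
    have -> : U [::] = set0 by apply/seteqP; split.
    by rewrite measure0 Rintegral_set0 /variation /total_length !big_nil.
  move=> /andP[/and3P[x1 x2 x3] wl'] /andP[sx pl'].
  have [muE fE] := IH wl' pl'.
  have dis : `]x.1, x.2]%classic `&` U l' = set0.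
    apply/seteqP; split => // t [] /=; rewrite in_itv/= => /andP[xt tx].
    move=> /hasP[y yl' /andP[yt ty]]; have := allP sx _ yl'.
    rewrite /separated => /orP[xy|yx].
      by have := lt_le_trans (lt_le_trans yt tx) xy; rewrite ltxx.
    by have := lt_le_trans (lt_le_trans xt ty) yx; rewrite ltxx.
  have mx : measurable (`]x.1, x.2]%classic : set (measurableTypeR R)).
    exact: measurable_itv.
  rewrite Ucons; split.
    have -> : (mu (`]x.1, x.2] `|` U l') = mu `]x.1, x.2] + mu (U l'))%E.
      exact: (measureU mu mx (mU l') dis).
    have -> : mu `]x.1, x.2]%classic = (x.2 - x.1)%:E.
      exact: (lebesgue_stieltjes_ocitv idfun x2).
    by rewrite muE /total_length big_cons -EFinD.
  have ikU : mu.-integrable (`]x.1, x.2]%classic `|` U l') (EFin \o k).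
    by apply: (integrableS measurableT _ _ ik) => //; exact: measurableU.
  have disb : [disjoint `]x.1, x.2]%classic & U l'] by exact/disj_set2P.
  rewrite /variation big_cons (Rintegral_setU mx (mU l') ikU disb).
  apply: lerD => //.
  rewrite (primitiveB pf x1 x2 x3) addrAC subrr add0r.
  rewrite Rintegral_itv_obnd_cbnd; last first.
    by apply: integrableS ik => //; exact: measurable_itv.
  by apply: row_integral_le => // y _ _; exact: norm_rV_le_sum.
have [muE fE] := step l wl pl.
apply: le_lt_trans fE _.
have Ud : (mu (U l) < d%:E)%E by rewrite muE lte_fin.
rewrite (_ : \int[mu]_(x in U l) k x = \int[mu]_(x in U l) `|k x|).
  exact: H (U l) (mU l) Ud.
by apply: eq_Rintegral => x _; rewrite ger0_norm.
Qed.

Lemma row_integral_eq_ae s t h1 h2 : row_integrable h1 -> row_integrable h2 ->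
  {ae mu, forall x, s < x < t -> h1 x = h2 x} ->
  row_integral s t h1 = row_integral s t h2.
Proof.
move=> i1 i2 h12; apply/rowP => i; rewrite !mxE.
have o h : row_integrable h -> \int[mu]_(x in `[s, t]) h x 0 i = \int[mu]_(x in `]s, t[) h x 0 i.
  move=> ih; rewrite -Rintegral_itv_obnd_cbnd; last first.
    by apply: integrableS (ih i) => //; exact: measurable_itv.
  by rewrite -Rintegral_itv_bndo_bndc//; apply: integrableS (ih i) => //; exact: measurable_itv.
rewrite !o//; congr fine; apply: ae_eq_integral => //.
- exact: (measurable_funS measurableT (@subsetT _ _) (measurable_int mu (i1 i))).
- exact: (measurable_funS measurableT (@subsetT _ _) (measurable_int mu (i2 i))).
apply: (lebesgue_aeS _ h12) => x H; rewrite /= in_itv/= => xst.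
by rewrite H.
Qed.

Lemma primitive_ae_derivable a b f h : primitive a b f h ->
  {ae mu, forall t, a < t < b -> derivable f t 1 /\ derive1 f t = h t}.
Proof.
move=> [ih H].
have Hi i : {ae mu, forall t, a < t < b ->
    derivable (fun x => f x 0 i) t 1 /\ derive1 (fun x => f x 0 i) t = h t 0 i}.
  have li : locally_integrable setT (fun x => h x 0 i).
    by apply: open_integrable_locally => //; exact: openT.
  apply: lebesgue_aeS (@FTC1 R (fun x => h x 0 i) (BLeft a)
    (fun y => row_integrable_sub i a y ih) li) => t Ht /andP[at_ tb]; have [d1 d2] := Ht at_.
  have fE : \near t, f a 0 i + \int[mu]_(x in `[a, t]) h x 0 i = f t 0 i.
    near=> x; rewrite [in RHS]H ?mxE//; apply/ltW.
      by near: x; exact: lt_nbhsr.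
    by near: x; exact: lt_nbhsl.
  have D : is_derive t (1:R) (fun x => f a 0 i + \int[mu]_(x in `[a, x]) h x 0 i) (h t 0 i).
    rewrite -[h t 0 i]add0r -d2 derive1E; apply: is_deriveD.
    exact: derivableP.
  have [D1 D2] := near_eq_is_derive fE D.
  by split; [exact: D1|rewrite derive1E; exact: D2].
apply: (lebesgue_aeS _ (lebesgue_ae_forall Hi)) => t Ht atb.
have df : derivable f t 1.
  by apply/derivable_mxP => i j; rewrite (ord1 i); exact: (Ht j atb).1.
split => //; rewrite derive1E derive_mx//; apply/rowP => i.
by rewrite mxE -derive1E; exact: (Ht i atb).2.
Unshelve. all: by end_near. Qed.

(** Both functions are primitives of integrands that agree almost everywhere. The common value may
    be given at any point c of the interval, because local lifts are started at an interior time. *)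
Lemma eq_of_ae_derive a b (f1 f2 : R -> 'rV[R]_n) c : AC a b f1 -> AC a b f2 ->
  a <= c -> c <= b -> f1 c = f2 c ->
  {ae mu, forall t, a < t < b ->
     derivable f1 t 1 -> derivable f2 t 1 -> derive1 f1 t = derive1 f2 t} ->
  forall t, a <= t -> t <= b -> f1 t = f2 t.
Proof.
move=> ac1 ac2 ac cb fc df; have ab := le_trans ac cb.
have [h1 p1] := AC_primitive ab ac1; have [h2 p2] := AC_primitive ab ac2.
have [i1 H1] := p1; have [i2 H2] := p2.
have h12 : {ae mu, forall t, a < t < b -> h1 t = h2 t}.
  apply: lebesgue_aeS (lebesgue_aeI df (lebesgue_aeI
    (primitive_ae_derivable p1) (primitive_ae_derivable p2))) => t [H [D1 D2]] atb.
  by have [d1 <-] := D1 atb; have [d2 <-] := D2 atb; exact: H.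
have E t : t <= b -> row_integral a t h1 = row_integral a t h2.
  move=> tb; apply: row_integral_eq_ae => //; apply: lebesgue_aeS h12 => x H /andP[ax xt].
  by apply: H; rewrite ax (lt_le_trans xt).
have fa : f1 a = f2 a.
  by apply: (addIr (row_integral a c h1)); rewrite -H1// E// -H2.
by move=> t at_ tb; rewrite H1// H2// fa E.
Qed.

End vector_integral.

(** * Differential equations with integrable coefficients *)

Section row_integral_bounds.
Context {R : realType} {n : nat}.
Notation mu := (@lebesgue_measure R).
Implicit Types (h : R -> 'rV[R]_n) (a b s t : R).

Lemma row_integral_le_ae h (k : R -> R) s t : row_integrable h ->
  mu.-integrable setT (EFin \o k) -> (forall x, 0 <= k x) ->
  {ae mu, forall x, s < x < t -> `|h x| <= k x} ->
  `|row_integral s t h| <= \int[mu]_(x in `[s, t]) k x.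
Proof.
move=> ih ik k0 hk.
apply: norm_mx_le => [|i j]; first by apply: Rintegral_ge0.
rewrite (ord1 i) mxE; apply: le_trans (le_normr_Rintegral _ _) _.
- exact: measurable_itv.
- exact: row_integrable_sub.
have ij := ih j.
have inj : mu.-integrable setT (EFin \o (fun x => `|h x 0 j|)).
  by have /integrable_norm := ij.
have sub f : mu.-integrable setT (EFin \o f) -> mu.-integrable `[s, t] (EFin \o f).
  by move=> If; apply: integrableS If => //; exact: measurable_itv.
have fin f : mu.-integrable setT (EFin \o f) -> (\int[mu]_(x in `[s, t]) (f x)%:E)%E \is a fin_num.
  by move=> /sub; apply: integrable_fin_num; exact: measurable_itv.
apply: fine_le; [exact: fin|exact: fin|].
apply: ae_ge0_le_integral => //.
- exact: (measurable_funS measurableT (@subsetT _ _) (measurable_int mu inj)).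
- by move=> x _; rewrite lee_fin.
- exact: (measurable_funS measurableT (@subsetT _ _) (measurable_int mu ik)).
apply: (lebesgue_aeS _ (lebesgue_aeI hk (lebesgue_aeI (lebesgue_ae_neq s) (lebesgue_ae_neq t)))).
move=> x [H [xs xt]]; rewrite /= in_itv/= => /andP[sx tx].
rewrite lee_fin; apply: le_trans (norm_mx_coord_le _ _ _) (H _).
by rewrite !lt_neqAle sx tx xt eq_sym xs.
Qed.

Lemma row_integralB h1 h2 s t : row_integrable h1 -> row_integrable h2 ->
  row_integral s t (fun x => h1 x - h2 x) = row_integral s t h1 - row_integral s t h2.
Proof.
move=> i1 i2; apply/rowP => i; rewrite !mxE -RintegralB.
- by apply: eq_Rintegral => x _; rewrite !mxE.
- exact: measurable_itv.
- exact: row_integrable_sub.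
- exact: row_integrable_sub.
Qed.

Lemma row_integrableB h1 h2 : row_integrable h1 -> row_integrable h2 ->
  row_integrable (fun x => h1 x - h2 x).
Proof.
move=> i1 i2 i.
have := integrableB measurableT (i1 i) (i2 i).
by apply: eq_integrable => // x _ /=; rewrite !mxE.
Qed.

Lemma row_integralxx h a : row_integral a a h = 0.
Proof. by apply/rowP => i; rewrite !mxE set_itv1 Rintegral_set1. Qed.

Lemma Rintegral_itv_le (k : R -> R) a b s t : mu.-integrable setT (EFin \o k) ->
  (forall x, 0 <= k x) -> a <= s -> t <= b ->
  \int[mu]_(x in `[s, t]) k x <= \int[mu]_(x in `[a, b]) k x.
Proof.
move=> ik k0 as_ tb.
have sub u v : mu.-integrable `[u, v] (EFin \o k).
  by apply: integrableS ik => //; exact: measurable_itv.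
apply: fine_le.
- by apply: integrable_fin_num => //; exact: measurable_itv.
- by apply: integrable_fin_num => //; exact: measurable_itv.
apply: ge0_subset_integral.
- exact: measurable_itv.
- exact: measurable_itv.
- exact: (measurable_funS measurableT (@subsetT _ _) (measurable_int mu ik)).
- by move=> x _; rewrite lee_fin.
by move=> x /=; rewrite !in_itv/= => /andP[sx xt]; rewrite (le_trans as_)// (le_trans xt).
Qed.

Lemma small_integral (k : R -> R) (t0 e : R) : mu.-integrable setT (EFin \o k) ->
  0 < e -> exists2 d, 0 < d & \int[mu]_(x in `[t0 - d, t0 + d]) `|k x| < e.
Proof.
move=> ik e0; have [d [d0 H]] := integral_normr_continuous ik e0.
exists (d / 3); first lra.
set D := (X in Rintegral _ X _).
have md : (mu D < d%:E)%E.
  rewrite lebesgue_measure_itv/= lte_fin ifT; last lra.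
  by rewrite -EFinD lte_fin; lra.
exact: H D (measurable_itv _) md.
Qed.

Lemma AC_clip_continuous a b (f : R -> 'rV[R]_n) : a <= b -> AC a b f ->
  continuous (fun t => f (clip a b t)).
Proof.
move=> ab acf x.
pose c := clip a b; have ac t : a <= c t by exact: clip_ge.
have cb t : c t <= b by exact: clip_le.
apply/cvgrPdist_lt => e e0; have [d d0 H] := AC_dist acf e0.
near=> y; have xy : `|y - x| < d.
  by near: y; apply: cvgr_distC_lt d0; exact: cvg_id.
have cxy : `|c y - c x| < d := le_lt_trans (clip_lipschitz a b x y) xy.
case: (leP (c x) (c y)) => h.
  by rewrite distrC; apply: (H (c x) (c y) (ac x) h (cb y)); exact: le_lt_trans (ler_norm _) cxy.
rewrite distrC in cxy.
by apply: (H (c y) (c x) (ac y) (ltW h) (cb x)); exact: le_lt_trans (ler_norm _) cxy.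
Unshelve. all: by end_near. Qed.

End row_integral_bounds.

Section lip_near.
Context {R : realType} {U : normedModType R}.
Implicit Types (u : U) (f g : U -> R).

Definition lip_near u0 f := exists r L, [/\ 0 < r, 0 <= L &
  forall u v, `|u - u0| < r -> `|v - u0| < r -> `|f u - f v| <= L * `|u - v|].

Lemma lip_near_fin (I : finType) u0 (f : I -> U -> R) :
  (forall i, lip_near u0 (f i)) -> exists r L, [/\ 0 < r, 0 <= L &
  forall i u v, `|u - u0| < r -> `|v - u0| < r -> `|f i u - f i v| <= L * `|u - v|].
Proof.
move=> H.
suff : forall s : seq I, exists r L, [/\ 0 < r, 0 <= L &
    forall i u v, i \in s -> `|u - u0| < r -> `|v - u0| < r ->
      `|f i u - f i v| <= L * `|u - v|].
  move=> /(_ (enum I))[r [L [r0 L0 HL]]]; exists r, L; split => // i u v.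
  by apply: HL; rewrite mem_enum.
elim=> [|i s [r [L [r0 L0 HL]]]]; first by exists 1, 0.
have [r1 [L1 [r10 L10 HL1]]] := H i.
exists (Num.min r r1), (L + L1); split; [by rewrite lt_min r0|exact: addr_ge0|].
move=> j u v; rewrite inE !lt_min => /orP[/eqP ->|js] /andP[ur ur1] /andP[vr vr1].
  by rewrite (le_trans (HL1 _ _ ur1 vr1))// ler_wpM2r// lerDr.
by rewrite (le_trans (HL _ _ _ js ur vr))// ler_wpM2r// lerDl.
Qed.

End lip_near.

Lemma row_integrable_mulmx {R : realType} {d N : nat} (p : R -> 'rV[R]_d)
    (B : R -> 'M[R]_(d, N)) (C : R) : row_integrable p ->
  (forall i j, measurable_fun setT (fun x => B x i j)) ->
  (forall x i j, `|B x i j| <= C) -> row_integrable (fun x => p x *m B x).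
Proof.
move=> ip mB BC j.
have ipB i : (@lebesgue_measure R).-integrable setT (EFin \o (fun x => p x 0 i * B x i j)).
  apply: (@integrableMl _ _ _ (@lebesgue_measure R) setT measurableT
    (EFin \o (fun x => p x 0 i)) (fun x => B x i j) (ip i)); first exact: mB.
  exists C; split => [|M CM x _]; first by rewrite num_real.
  by rewrite /= (le_trans (BC _ _ _))// ltW.
have -> : EFin \o (fun x => (p x *m B x) 0 j) =
    (fun x => (\sum_(i <- index_enum 'I_d) (p x 0%R i * B x i j)%:E)%E).
  by apply/funext => x /=; rewrite sumEFin mxE.
by apply: integrable_sum => //= i _; exact: ipB.
Qed.

(** * Picard iteration for u' = p A(u) with p integrable *)

Section ode.
Context {R : realType} {d N : nat}.
Notation mu := (@lebesgue_measure R).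
Variables (A : 'rV[R]_N -> 'M[R]_(d, N)) (p : R -> 'rV[R]_d).
Hypothesis ip : row_integrable p.

Let addrBB (x y z w v : 'rV[R]_N) : x + y - z - (x + w - v) = (y - w) - (z - v).
Proof. by apply/rowP => i; rewrite !mxE; ring. Qed.

Let addrBK (x y z : 'rV[R]_N) : x + y - z - x = y - z.
Proof. by apply/rowP => i; rewrite !mxE; ring. Qed.

Let k (x : R) : R := \sum_i `|p x 0 i|.
Let k0 x : 0 <= k x. Proof. exact: sumr_ge0. Qed.
Let ik : mu.-integrable setT (EFin \o k). Proof. exact: integrable_sum_norm. Qed.

Let mul_le (x c : R) (B : 'M[R]_(d, N)) : 0 <= c -> (forall i j, `|B i j| <= c) ->
  `|p x *m B| <= k x * c.
Proof.
move=> c0 Bc; apply: norm_mx_le => [|i j]; first exact: mulr_ge0.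
rewrite (ord1 i) mxE mulr_suml; apply: le_trans (ler_norm_sum _ _ _) _.
by apply: ler_sum => l _; rewrite normrM ler_wpM2l.
Qed.

Let ikc c : mu.-integrable setT (EFin \o (fun x => k x * c)).
Proof.
by have := integrableZr measurableT c ik; apply: eq_integrable.
Qed.

Section global.
Variables (C L : R) (u0 : 'rV[R]_N).
Hypotheses (C0 : 0 <= C) (L0 : 0 <= L).
Hypothesis AC_ : forall u i j, `|A u i j| <= C.
Hypothesis AL : forall u v i j, `|A u i j - A v i j| <= L * `|u - v|.

Lemma ode_rhs_integrable (u : R -> 'rV[R]_N) : continuous u ->
  row_integrable (fun x => p x *m A (u x)).
Proof.
move=> cu; apply: (row_integrable_mulmx ip (C := C)) => // i j.
apply: continuous_measurable_fun => x; apply/cvgrPdist_le => e e0; near=> y.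
apply: le_trans (AL _ _ _ _) _.
have uxy : `|u x - u y| <= e / (L + 1).
  near: y; apply: cvgr_dist_le; first exact: cu.
  by rewrite divr_gt0// ltr_wpDl.
apply: le_trans (ler_wpM2l L0 uxy) _.
rewrite mulrCA ger_pMr// ler_pdivrMr ?ltr_wpDl//; lra.
Unshelve. all: by end_near. Qed.

Variables (a b t0 : R).
Hypotheses (at0 : a <= t0) (t0b : t0 <= b).
Let K := \int[mu]_(x in `[a, b]) k x.
(** Makes [Phi] below a contraction with ratio 1/2. The factor 2 counts the two integrals in
    [Phi]. *)
Hypothesis KL : 2 * (K * L) <= 2^-1.

Let K0 : 0 <= K. Proof. exact: Rintegral_ge0. Qed.

Let ac t : a <= clip a b t. Proof. exact: clip_ge. Qed.
Let cb t : clip a b t <= b. Proof. exact/clip_le/(le_trans at0). Qed.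

Let g (u : R -> 'rV[R]_N) x := p x *m A (u x).
Let I (u : R -> 'rV[R]_N) t := row_integral a t (g u).
(** The integral from t0 to t is a difference of two integrals from a, which covers t < t0 without
    oriented integrals. Clipping t makes [Phi u] a continuous function on the whole line. *)
Let Phi u t := u0 + I u (clip a b t) - I u t0.

Let row_integral_kc (w : R -> 'rV[R]_N) c t : 0 <= c -> row_integrable w ->
  a <= t -> t <= b ->
  (forall x, a <= x -> x <= b -> `|w x| <= k x * c) -> `|row_integral a t w| <= K * c.
Proof.
move=> c0 iw at_ tb wk.
have le1 : `|row_integral a t w| <= \int[mu]_(x in `[a, t]) (k x * c).
  by apply: row_integral_le => // x ax xt; apply: wk => //; exact: le_trans tb.
apply: le_trans le1 _.
apply: (@le_trans _ _ (\int[mu]_(x in `[a, b]) (k x * c))).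
  by apply: Rintegral_itv_le => // x; exact: mulr_ge0.
rewrite RintegralZr//.
by apply: integrableS ik => //; exact: measurable_itv.
Qed.

Let Phi_cont u : continuous u -> continuous (Phi u).
Proof.
move=> cu x.
apply: cvgB; last exact: cvg_cst.
apply: cvgD; first exact: cvg_cst.
apply: (@AC_clip_continuous _ _ a b (I u)); first exact: le_trans t0b.
apply: primitive_AC; split; first exact: ode_rhs_integrable cu.
by move=> t _ _; rewrite /I row_integralxx add0r.
Qed.

Let Phi_lip u v M t : continuous u -> continuous v -> 0 <= M ->
  (forall x, `|u x - v x| <= M) -> `|Phi u t - Phi v t| <= 2^-1 * M.
Proof.
move=> cu cv M0 uv; rewrite /Phi.
have iu := ode_rhs_integrable cu; have iv := ode_rhs_integrable cv.
have guv s : a <= s -> s <= b -> `|I u s - I v s| <= K * (L * M).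
  move=> as_ sb; rewrite /I -row_integralB//; apply: row_integral_kc => //.
  - exact: mulr_ge0.
  - exact: row_integrableB.
  move=> x _ _; rewrite /g -mulmxBr; apply: mul_le; first exact: mulr_ge0.
  by move=> i j; rewrite !mxE (le_trans (AL _ _ _ _))// ler_wpM2l.
have -> : u0 + I u (clip a b t) - I u t0 - (u0 + I v (clip a b t) - I v t0) =
    (I u (clip a b t) - I v (clip a b t)) - (I u t0 - I v t0).
  exact: addrBB.
apply: le_trans (ler_normB _ _) _.
have h1 := guv _ (ac t) (cb t); have h2 := guv _ at0 t0b.
apply: le_trans (lerD h1 h2) _.
have -> : K * (L * M) + K * (L * M) = 2 * (K * L) * M.
  by rewrite -!mulrA mulr_natl mulr2n.
exact: (ler_wpM2r M0 KL).
Qed.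

Let Phi_bound u t : continuous u -> `|Phi u t - u0| <= 2 * (K * C).
Proof.
move=> cu; have iu := ode_rhs_integrable cu.
have bd s : a <= s -> s <= b -> `|I u s| <= K * C.
  by move=> as_ sb; apply: row_integral_kc => // x _ _; exact: mul_le.
have -> : Phi u t - u0 = I u (clip a b t) - I u t0.
  exact: addrBK.
apply: le_trans (ler_normB _ _) _.
have h1 := bd _ (ac t) (cb t); have h2 := bd _ at0 t0b.
by apply: le_trans (lerD h1 h2) _; rewrite mulr_natl mulr2n lexx.
Qed.

Let U n := iter n Phi (cst u0).
Let cU n : continuous (U n).
Proof. by elim: n => [|n IH] /=; [exact: cst_continuous|exact: Phi_cont]. Qed.

Let B := 2 * (K * C).
Let B0 : 0 <= B. Proof. by rewrite /B mulr_ge0// mulr_ge0. Qed.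

Let U_step n t : `|U n.+1 t - U n t| <= B / 2 ^+ n.
Proof.
elim: n t => [|n IH] t; first by rewrite expr0 divr1; exact: (Phi_bound t (@cU 0)).
have := @Phi_lip (U n.+1) (U n) (B / 2 ^+ n) t (@cU n.+1) (@cU n) _ IH.
rewrite exprS invfM mulrCA; apply.
by rewrite divr_ge0// exprn_ge0.
Qed.

Let U_dist n j t : `|U (n + j)%N t - U n t| <= 2 * (B / 2 ^+ n).
Proof.
(* The bound is strengthened by the tail of the geometric series, so that the induction on j
   closes. *)
suff : `|U (n + j)%N t - U n t| <= 2 * (B / 2 ^+ n) - 2 * (B / 2 ^+ (n + j)).
  by move=> /le_trans; apply; rewrite gerBl mulr_ge0// divr_ge0// exprn_ge0.
elim: j => [|j IH]; first by rewrite addn0 !subrr normr0.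
have := U_step (n + j) t; rewrite addnS => Us.
rewrite -(subrKA (U (n + j)%N t)); apply: le_trans (ler_normD _ _) _.
apply: le_trans (lerD Us IH) _.
rewrite (exprS _ (n + j)) invfM.
suff -> : 2 * (B * (2^-1 / 2 ^+ (n + j))) = B / 2 ^+ (n + j) by lra.
by rewrite mulrCA mulVKf// pnatr_eq0.
Qed.

Let Bn_small e : 0 < e -> exists n, 2 * (B / 2 ^+ n) < e.
Proof.
move=> e0.
have : (fun n => B / 2 ^+ n) @ \oo --> B * 0.
  by apply: cvgM; [exact: cvg_cst|under eq_fun do rewrite -exprVn; apply: cvg_expr; rewrite ger0_norm ?invf_lt1//; lra].
rewrite mulr0 => /cvgrPdist_lt /(_ (e / 2)) []; first lra.
move=> m _ /(_ m (leqnn m)) /=; rewrite sub0r normrN => /ltr_normlW; exists m; lra.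
Qed.

Let U_cvg t : cvg (U n t @[n --> \oo]).
Proof.
apply/cauchy_cvgP; apply: cauchy_exP => e e0.
have [n Hn] := Bn_small e0; exists (U n t).
exists n => // m /= nm; rewrite -ball_normE /= distrC -(subnKC nm).
exact: le_lt_trans (U_dist _ _ _) Hn.
Qed.

Let u t := lim (U n t @[n --> \oo]).

Let u_dist n t : `|u t - U n t| <= 2 * (B / 2 ^+ n).
Proof.
apply/ler_addgt0Pr => e e0.
have /cvgrPdist_le/(_ e e0)[m _ Hm] : U n t @[n --> \oo] --> u t by exact: U_cvg.
have := Hm (n + m)%N (leq_addl _ _) => /= h.
rewrite -(subrKA (U (n + m)%N t)); apply: le_trans (ler_normD _ _) _.
by rewrite addrC lerD// U_dist.
Qed.

Let cu : continuous u.
Proof.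
move=> x; apply/cvgrPdist_lt => e e0.
have [|n Hn] := @Bn_small (e / 3); first lra.
near=> y.
have h : `|U n x - U n y| < e / 3.
  by near: y; apply: cvgr_dist_lt; [exact: cU|lra].
rewrite -(subrKA (U n x)) -(subrKA (U n y) (U n x)).
have h1 := u_dist n x; have h2 := u_dist n y; rewrite distrC in h2.
apply: le_lt_trans (ler_normD _ _) _.
have := ler_normD (U n x - U n y) (U n y - u y); lra.
Unshelve. all: by end_near. Qed.

Let u_fix t : Phi u t = u t.
Proof.
apply/eqP; rewrite -subr_eq0 -normr_le0; apply/ler_addgt0Pr => e e0.
rewrite add0r.
have [|n Hn] := @Bn_small (e / 2); first lra.
have Bn0 : 0 <= 2 * (B / 2 ^+ n) by rewrite mulr_ge0// divr_ge0// exprn_ge0.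
have h1 := @Phi_lip u (U n) _ t cu (@cU n) Bn0 (u_dist n).
have h2 := u_dist n.+1 t; rewrite distrC in h2.
rewrite -(subrKA (U n.+1 t)); apply: le_trans (ler_normD _ _) _.
apply: le_trans (lerD h1 h2) _.
have : B / 2 ^+ n.+1 <= B / 2 ^+ n.
  by rewrite ler_wpM2l// lef_pV2 ?posrE ?exprn_gt0// ler_eXn2l// ltr1n.
lra.
Qed.

Lemma ode_global : exists u : R -> 'rV[R]_N, [/\ u t0 = u0, continuous u,
  (forall t, `|u t - u0| <= 2 * (K * C)) &
  primitive a b u (fun x => p x *m A (u x))].
Proof.
exists u; split.
- by rewrite -u_fix /Phi clip_id// addrK.
- exact: cu.
- by move=> t; rewrite -u_fix; exact: Phi_bound cu.
split; first exact: ode_rhs_integrable cu.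
have ab : a <= b by exact: le_trans t0b.
move=> t at_ tb; rewrite -[LHS]u_fix -[u a]u_fix /Phi !clip_id//.
have Ia : I u a = 0 by exact: row_integralxx.
by rewrite Ia addr0 addrAC.
Qed.

End global.
End ode.

Section ode_local.
Context {R : realType} {d N : nat}.
Notation mu := (@lebesgue_measure R).
Variables (A : 'rV[R]_N -> 'M[R]_(d, N)) (p : R -> 'rV[R]_d) (u0 : 'rV[R]_N).
Hypothesis ip : row_integrable p.
Hypothesis lA : forall i j, lip_near u0 (fun u => A u i j).

Let k (x : R) : R := \sum_i `|p x 0 i|.
Let k0 x : 0 <= k x. Proof. exact: sumr_ge0. Qed.
Let ik : mu.-integrable setT (EFin \o k). Proof. exact: integrable_sum_norm. Qed.

Let small_k t0 e : 0 < e ->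
  exists2 h, 0 < h & \int[mu]_(x in `[t0 - h, t0 + h]) k x < e.
Proof.
move=> /(small_integral t0 ik)[h h0 H]; exists h => //.
rewrite (_ : Rintegral _ _ _ = \int[mu]_(x in `[t0 - h, t0 + h]) `|k x|)//.
by apply: eq_Rintegral => x _; rewrite ger0_norm.
Qed.

Let lipA : exists r L, [/\ 0 < r, 0 <= L & forall i j u v,
  `|u - u0| < r -> `|v - u0| < r -> `|A u i j - A v i j| <= L * `|u - v|].
Proof.
have [|r [L [r0 L0 H]]] := @lip_near_fin R _ ('I_d * 'I_N)%type u0 (fun ij u => A u ij.1 ij.2).
  by move=> [i j]; exact: lA.
by exists r, L; split => // i j; exact: (H (i, j)).
Qed.

(** A is controlled only near u0. Precomposing it with T, which truncates every coordinate of u - u0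
    to [-r', r'], gives a bounded and globally Lipschitz coefficient B. For small h the solution for
    B stays within r' of u0, where A and B agree. *)
Lemma ode_exists (t0 rho : R) : 0 < rho -> exists h u, [/\ 0 < h, u t0 = u0,
  continuous u, (forall t, `|u t - u0| < rho) &
  primitive (t0 - h) (t0 + h) u (fun x => p x *m A (u x))].
Proof.
move=> rho0; have [r [L [r0 L0 lip]]] := lipA.
pose r' := Num.min r rho / 2.
have m0 : 0 < Num.min r rho by rewrite lt_min r0.
have r'0 : 0 < r' by rewrite /r'; lra.
have r'r : r' < r.
  by have : Num.min r rho <= r by [rewrite ge_min lexx]; rewrite /r'; lra.
have r'rho : r' < rho.
  by have : Num.min r rho <= rho by [rewrite ge_min lexx orbT]; rewrite /r'; lra.
pose tr (v : 'rV[R]_N) : 'rV[R]_N := \row_j clip (- r') r' (v 0 j).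
have tr_le v : `|tr v| <= r'.
  apply: norm_mx_le => [|i j]; first exact: ltW.
  by rewrite mxE ler_norml clip_ge clip_le//; lra.
have tr_lip v w : `|tr v - tr w| <= `|v - w|.
  apply: norm_mx_le => // i j; rewrite !mxE.
  apply: le_trans (clip_lipschitz _ _ _ _) _.
  by have := norm_mx_coord_le (v - w) 0 j; rewrite !mxE.
have tr_id v : `|v| <= r' -> tr v = v.
  move=> vr; apply/rowP => j; rewrite mxE.
  have := le_trans (norm_mx_coord_le v 0 j) vr.
  by rewrite ler_norml => /andP[v1 v2]; rewrite clip_id.
pose T u := u0 + tr (u - u0).
have T0 u : `|T u - u0| < r by rewrite /T addrC addKr (le_lt_trans (tr_le _)).
pose B u := A (T u).
pose C := (\sum_i \sum_j `|A u0 i j|) + L * r.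
have s0 : 0 <= \sum_i \sum_j `|A u0 i j| by apply: sumr_ge0 => i _; exact: sumr_ge0.
have C0 : 0 <= C by rewrite addr_ge0// mulr_ge0// ltW.
have BC u i j : `|B u i j| <= C.
  have h1 : `|B u i j - A u0 i j| <= L * r.
    apply: le_trans (lip _ _ _ _ (T0 u) _) _; first by rewrite subrr normr0.
    by rewrite ler_wpM2l// ltW.
  have h2 : `|A u0 i j| <= \sum_i \sum_j `|A u0 i j|.
    rewrite (bigD1 i)//= (bigD1 j)//= -addrA lerDl addr_ge0 ?sumr_ge0// => i' _.
    by rewrite sumr_ge0.
  rewrite -(subrK (A u0 i j) (B u i j)).
  by apply: le_trans (ler_normD _ _) _; rewrite [leLHS]addrC; exact: lerD.
have BL u v i j : `|B u i j - B v i j| <= L * `|u - v|.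
  apply: le_trans (lip _ _ _ _ (T0 u) (T0 v)) _.
  rewrite ler_wpM2l// /T opprD addrACA subrr add0r.
  by apply: le_trans (tr_lip _ _) _; rewrite opprB addrA subrK.
(* The first bound on the integral of |p| yields the contraction hypothesis of [ode_global], the
   second keeps the solution within r' of u0. *)
pose e := Num.min (1 / (4 * (L + 1))) (r' / (2 * (C + 1))).
have e0 : 0 < e by rewrite lt_min !divr_gt0// ?mulr_gt0// ltr_wpDl.
have [h h0 Kh] := small_k t0 e0.
have [t0h ht0] : t0 - h <= t0 /\ t0 <= t0 + h by lra.
set K := Rintegral _ _ _ in Kh.
have K0 : 0 <= K by apply: Rintegral_ge0.
have [K1 K2] : K * (4 * (L + 1)) < 1 /\ K * (2 * (C + 1)) < r'.
  by move: Kh; rewrite lt_min => /andP[]; rewrite !ltr_pdivlMr ?mulr_gt0 ?ltr_wpDl.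
have KL : 2 * (K * L) <= 2^-1.
  clear Kh K2; move: K0 K1; move: K => x x0; rewrite (_ : x * (4 * (L + 1)) = 4 * (x * L) + 4 * x); last by ring.
  lra.
have KC : 2 * (K * C) <= r'.
  clear Kh K1 KL; move: K0 K2; move: K => x x0; rewrite (_ : x * (2 * (C + 1)) = 2 * (x * C) + 2 * x); last by ring.
  lra.
have [u [ut0 cu ub pu]] := @ode_global R d N B p ip C L u0 C0 L0 BC BL _ _ t0 t0h ht0 KL.
have ur t : `|u t - u0| <= r' by exact: le_trans (ub t) KC.
exists h, u; split => //.
  by move=> t; exact: le_lt_trans (ur t) r'rho.
suff -> : (fun x => p x *m A (u x)) = (fun x => p x *m B (u x)) by [].
by apply/funext => x; rewrite /B /T tr_id// addrC subrK.
Qed.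

(** Derivability is a premise: absolutely continuous functions have it almost everywhere anyway, so
    users need not establish it. *)
Definition ode_sol (s t : R) (u : R -> 'rV[R]_N) :=
  {ae mu, forall x, s < x < t -> derivable u x 1 -> derive1 u x = p x *m A (u x)}.

(** On an interval where the integral of |p| times L is at most 1/2, a bound M on the distance of
    two solutions improves to M / 2; iterating from 2 r gives 0. The window h and the radius depend
    on u0 and t0 only, and the solutions may start to agree at any s in the window. *)
Lemma ode_unique (t0 : R) : exists h rho, [/\ 0 < h, 0 < rho &
  forall s t u v, t0 - h <= s -> s <= t -> t <= t0 + h ->
  AC s t u -> AC s t v -> ode_sol s t u -> ode_sol s t v ->
  (forall x, s <= x -> x <= t -> `|u x - u0| < rho /\ `|v x - u0| < rho) ->
  u s = v s -> forall x, s <= x -> x <= t -> u x = v x].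
Proof.
have [r [L [r0 L0 lip]]] := lipA.
have [|h h0 Kh] := @small_k t0 (1 / (2 * (L + 1))).
  by rewrite divr_gt0// mulr_gt0// ltr_wpDl.
exists h, r; split => // s t u v hs st th acu acv su sv uv us.
have [hu pu] := AC_primitive st acu; have [hv pv] := AC_primitive st acv.
have [ihu Hu] := pu; have [ihv Hv] := pv.
have hE : {ae mu, forall x, s < x < t -> hu x - hv x = p x *m (A (u x) - A (v x))}.
  apply: lebesgue_aeS (lebesgue_aeI su (lebesgue_aeI sv (lebesgue_aeI
    (primitive_ae_derivable pu) (primitive_ae_derivable pv)))) => x [H1 [H2 [H3 H4]]] sxt.
  have [d1 <-] := H3 sxt; have [d2 <-] := H4 sxt.
  by rewrite H1// H2// mulmxBr.
set K := Rintegral _ _ _ in Kh.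
have K0 : 0 <= K by apply: Rintegral_ge0.
have KL : K * L <= 2^-1.
  move: Kh K0; rewrite ltr_pdivlMr ?mulr_gt0 ?ltr_wpDl//; move: K => x.
  rewrite (_ : x * (2 * (L + 1)) = 2 * (x * L) + 2 * x); last by ring.
  lra.
have step M : 0 <= M -> (forall x, s <= x -> x <= t -> `|u x - v x| <= M) ->
    forall x, s <= x -> x <= t -> `|u x - v x| <= M / 2.
  move=> M0 HM x sx xt; rewrite Hu// Hv// us opprD addrACA subrr add0r -row_integralB//.
  have ikc : mu.-integrable setT (EFin \o (fun x => k x * (L * M))).
    by have := integrableZr measurableT (L * M) ik; apply: eq_integrable.
  have : `|row_integral s x (fun y => hu y - hv y)| <= \int[mu]_(y in `[s, x]) (k y * (L * M)).
    apply: row_integral_le_ae => //.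
    - exact: row_integrableB.
    - by move=> y; rewrite mulr_ge0// mulr_ge0.
    apply: lebesgue_aeS hE => y H /andP[sy yx].
    have yt : y < t by exact: lt_le_trans xt.
    rewrite H ?sy ?yt//.
    have [uy vy] := uv y (ltW sy) (ltW yt).
    apply: norm_mx_le => [|i j]; first by rewrite mulr_ge0// mulr_ge0.
    rewrite (ord1 i) mxE mulr_suml; apply: le_trans (ler_norm_sum _ _ _) _.
    apply: ler_sum => l _; rewrite normrM ler_wpM2l// !mxE.
    by apply: le_trans (lip _ _ _ _ uy vy) _; rewrite ler_wpM2l// HM// ltW.
  move=> /le_trans; apply.
  apply: (@le_trans _ _ (\int[mu]_(y in `[t0 - h, t0 + h]) (k y * (L * M)))).
    apply: Rintegral_itv_le => //; last exact: le_trans th.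
    by move=> y; rewrite mulr_ge0// mulr_ge0.
  rewrite RintegralZr//.
  - rewrite -/K mulrA [M / 2]mulrC; exact: (ler_wpM2r M0 KL).
  - by apply: integrableS ik => //; exact: measurable_itv.
have dist n x : s <= x -> x <= t -> `|u x - v x| <= 2 * r / 2 ^+ n.
  elim: n x => [|n IH] x sx xt.
    rewrite expr0 divr1; have [h1 h2] := uv x sx xt.
    rewrite -(subrKA u0); apply: le_trans (ler_normD _ _) _.
    by rewrite (distrC u0); lra.
  apply: le_trans (step _ _ IH _ sx xt) _; last by rewrite exprSr invfM mulrA.
  by rewrite divr_ge0// ?exprn_ge0// mulr_ge0// ltW.
move=> x sx xt; apply/eqP; rewrite -subr_eq0 -normr_le0.
apply/ler_addgt0Pr => e e0; rewrite add0r.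
have : (fun n => (2 * r) / 2 ^+ n) @ \oo --> (2 * r) * 0.
  apply: cvgM; first exact: cvg_cst.
  by under eq_fun do rewrite -exprVn; apply: cvg_expr; rewrite ger0_norm ?invf_lt1//; lra.
rewrite mulr0 => /cvgrPdist_lt /(_ e e0)[m _ /(_ m (leqnn m)) /=].
rewrite sub0r normrN => /ltr_normlW /ltW; apply: le_trans.
exact: dist.
Qed.

End ode_local.

(** * Calculus and local Lipschitz continuity *)

Lemma norm_mx_coordB_le {R : realType} {m n : nat} (A B : 'M[R]_(m, n)) i j :
  `|A i j - B i j| <= `|A - B|.
Proof. by have := norm_mx_coord_le (A - B) i j; rewrite !mxE. Qed.

Section mean_value.
Context {R : realType} {E : normedModType R}.

Lemma derivable_line (F : normedModType R) (f : E -> F) (z v : E) (s : R) :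
  derivable f (s *: v + z) v ->
  is_derive s (1 : R) (fun x : R => f (x *: v + z)) ('D_v f (s *: v + z)).
Proof.
move=> df.
have E1 : (fun h : R => h^-1 *: (((fun x : R => f (x *: v + z)) \o shift s) (h *: (1 : R)) - f (s *: v + z))) =
  (fun h : R => h^-1 *: ((f \o shift (s *: v + z)) (h *: v) - f (s *: v + z))).
  by apply/funext => h /=; rewrite (_ : h *: (1 : R) = h) ?scalerDl ?addrA//; exact: mulr1.
by apply: DeriveDef; [rewrite /derivable E1|rewrite /derive E1].
Qed.

(** As the norm is the maximum of the coordinates, the scalar mean value theorem can be used in each
    coordinate with its own intermediate point. *)
Lemma mean_value_line {n : nat} (f : E -> 'rV[R]_n) (z v : E) (l : 'rV[R]_n)
    (a b e : R) : a <= b ->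
  (forall s, a <= s -> s <= b -> derivable f (s *: v + z) v) ->
  (forall s, a <= s -> s <= b -> `|'D_v f (s *: v + z) - l| <= e) ->
  `|f (b *: v + z) - f (a *: v + z) - (b - a) *: l| <= e * (b - a).
Proof.
move=> ab df dl; have e0 : 0 <= e by exact: le_trans (dl a (lexx _) ab).
apply: norm_mx_le => [|i j]; first by rewrite mulr_ge0// subr_ge0.
rewrite (ord1 i) !mxE.
pose phi s := f (s *: v + z) 0 j.
have dphi s : a <= s -> s <= b -> is_derive s (1 : R) phi ('D_v f (s *: v + z) 0 j).
  move=> as_ sb; have [D1 D2] := derivable_line (df s as_ sb).
  have D3 := (derivable_mxP _ _ _).1 D1 0 j.
  apply: DeriveDef; first exact: D3.
  by have := derive_mx D1; rewrite D2 => ->; rewrite mxE.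
have [||c] := @MVT_segment R phi (fun s => 'D_v f (s *: v + z) 0 j) a b ab.
- by move=> x; rewrite in_itv/= => /andP[/ltW ax /ltW xb]; exact: dphi.
- apply: derivable_within_continuous => x; rewrite in_itv/= => /andP[ax xb].
  by have [] := dphi x ax xb.
rewrite in_itv/= => /andP[ac cb]; rewrite /phi => ->.
rewrite mulrC -mulrBr normrM (ger0_norm (_ : 0 <= b - a)) ?subr_ge0// mulrC.
rewrite ler_wpM2r ?subr_ge0//; apply: le_trans (dl c ac cb).
by have := norm_mx_coord_le ('D_v f (c *: v + z) - l) 0 j; rewrite !mxE.
Qed.

End mean_value.

Section Ck_calculus.
Context {R : realType}.

Context {m n : nat}.
Implicit Types (U : set 'rV[R]_m) (f : 'rV[R]_m -> 'rV[R]_n).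
Notation e_ i := (delta_mx 0 i : 'rV[R]_m).

Lemma C1_estimate (f : 'rV[R]_m -> 'rV[R]_n) (u0 : 'rV[R]_m) (r e : R)
    (l : 'I_m -> 'rV[R]_n) : 0 <= e ->
  (forall z i, `|z - u0| < r -> derivable f z (e_ i)) ->
  (forall z i, `|z - u0| < r -> `|'D_(e_ i) f z - l i| <= e) ->
  forall x y, `|x - u0| < r -> `|y - u0| < r ->
    `|f y - f x - \sum_i (y 0 i - x 0 i) *: l i| <= e * \sum_i `|y 0 i - x 0 i|.
Proof.
move=> e0 df dl x y xr yr.
(* the coordinates of x are replaced one by one with those of y *)
pose z k : 'rV[R]_m := \row_j if (j < k)%N then y 0 j else x 0 j.
(* Balls of the maximum norm are boxes, so convexity along a coordinate direction is checked
   coordinate by coordinate. *)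
have ball_segment (a b c : R) (w : 'rV[R]_m) i : a <= c -> c <= b ->
    `|a *: e_ i + w - u0| < r -> `|b *: e_ i + w - u0| < r ->
    `|c *: e_ i + w - u0| < r.
  move=> ac cb ra rb; apply: le_lt_trans (_ : Num.max `|a *: e_ i + w - u0| `|b *: e_ i + w - u0| < r); last by rewrite gt_max ra.
  apply: norm_mx_le => [|i' j]; first by rewrite le_max normr_ge0.
  have ha := norm_mx_coord_le (a *: e_ i + w - u0) i' j.
  have hb := norm_mx_coord_le (b *: e_ i + w - u0) i' j.
  move: ha hb; rewrite !mxE; case: (_ && _) => /=; rewrite ?mulr1 ?mulr0; last by move=> ha _; rewrite le_max ha.
  rewrite le_max => ha hb; apply/orP.
  have [c0|c0] := leP 0 (c + w i' j - u0 i' j).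
    by right; apply: le_trans hb; rewrite ger0_norm// (le_trans _ (ler_norm _))//; lra.
  by left; apply: le_trans ha; rewrite ltr0_norm// -normrN (le_trans _ (ler_norm _))//; lra.
have step i (w : 'rV[R]_m) a b : `|a *: e_ i + w - u0| < r -> `|b *: e_ i + w - u0| < r ->
    `|f (b *: e_ i + w) - f (a *: e_ i + w) - (b - a) *: l i| <= e * `|b - a|.
  wlog ab : a b / a <= b => [H ra rb|ra rb].
    case: (leP a b) => [ab|/ltW ba]; first exact: H.
    have -> : f (b *: e_ i + w) - f (a *: e_ i + w) - (b - a) *: l i =
        - (f (a *: e_ i + w) - f (b *: e_ i + w) - (a - b) *: l i).
      by apply/rowP => j; rewrite !mxE; ring.
    by rewrite normrN (distrC b a); exact: H.
  rewrite (ger0_norm (_ : 0 <= b - a)) ?subr_ge0//.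
  apply: mean_value_line => // s as_ sb; [apply: df|apply: dl]; exact: ball_segment sb ra rb.
have zr k : `|z k - u0| < r.
  apply: le_lt_trans (_ : Num.max `|x - u0| `|y - u0| < r); last by rewrite gt_max xr.
  apply: norm_mx_le => [|i j]; first by rewrite le_max normr_ge0.
  have hx := norm_mx_coord_le (x - u0) 0 j; have hy := norm_mx_coord_le (y - u0) 0 j.
  move: hx hy; rewrite (ord1 i) !mxE => hx hy; rewrite le_max.
  by case: ifP; rewrite ?hx ?hy ?orbT.
have main k : (k <= m)%N -> `|f (z k) - f x - \sum_(i < m | (i < k)%N) (y 0 i - x 0 i) *: l i|
    <= e * \sum_(i < m | (i < k)%N) `|y 0 i - x 0 i|.
  elim: k => [_|k IH km].
    rewrite !big_pred0_eq mulr0 subr0 (_ : z 0 = x) ?subrr ?normr0//.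
    by apply/rowP => j; rewrite mxE ltn0.
  pose i0 := Ordinal km.
  have S (V : zmodType) (g : 'I_m -> V) : \sum_(i < m | (i < k.+1)%N) g i = g i0 + \sum_(i < m | (i < k)%N) g i.
    rewrite (bigD1 i0)//=; congr (_ + _); apply: eq_bigl => i.
    by rewrite ltnS [RHS]ltn_neqAle andbC.
  rewrite !S mulrDr.
  have zk1 : z k.+1 = (y 0 i0 - x 0 i0) *: e_ i0 + z k.
    apply/rowP => j; rewrite !mxE eqxx/= ltnS.
    have [->|ji] := eqVneq j i0; first by rewrite leqnn ltnn mulr1 subrK.
    rewrite mulr0 add0r leq_eqVlt (_ : (val j == k) = false)//.
    by apply/negbTE; apply: contra ji => /eqP jk; apply/eqP/val_inj.
  have zk0 : z k = 0 *: e_ i0 + z k by rewrite scale0r add0r.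
  have := @step i0 (z k) 0 (y 0 i0 - x 0 i0).
  rewrite -zk0 -zk1 subr0 => /(_ (zr _) (zr _)) h.
  apply: le_trans (lerD h (IH (ltnW km))).
  apply: le_trans (ler_normD _ _); rewrite le_eqVlt; apply/orP; left; apply/eqP; congr (`| _ |).
  by apply/rowP => j; rewrite !mxE; ring.
have := main m (leqnn m).
have -> : z m = y by apply/rowP => j; rewrite mxE ltn_ord.
rewrite (eq_bigl xpredT) 1?[X in _ <= e * X -> _](eq_bigl xpredT)//; by move=> i; rewrite ltn_ord.
Qed.

Lemma Ck_weaken U f j k : (j <= k)%N -> Ck k U f -> Ck j U f.
Proof.
elim: k j f => [|k IH] [|j] f jk.
- by [].
- by [].
- by case.
by move=> [cf [H1 H2]]; split; [|split => // v; exact: IH (H2 v)].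
Qed.

Lemma open_ballP U u0 : open U -> U u0 ->
  exists2 r, 0 < r & forall z, `|z - u0| < r -> U z.
Proof.
move=> oU Uu0; have /nbhs_ballP[r /= r0 H] := open_nbhs_nbhs (conj oU Uu0).
by exists r => // z zr; apply: H; rewrite -ball_normE /= distrC.
Qed.

(** Strict differentiability at u0, from continuity of the partial derivatives. Fixing x = u0 gives
    the Frechet derivative, and letting both points vary gives a local Lipschitz constant. *)
Lemma C1_approx U f u0 e : open U -> Ck 1 U f -> U u0 -> 0 < e ->
  exists2 r, 0 < r & forall x y, `|x - u0| < r -> `|y - u0| < r -> 
    `|f y - f x - \sum_i (y 0 i - x 0 i) *: 'D_(e_ i) f u0| <= e * `|y - x|.
Proof.
move=> oU [cf [df cdf]] Uu0 e0.
have [r r0 Ur] := open_ballP oU Uu0.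
(* The sum of the m coordinate increments is at most m times the norm of y - x; adding 1 keeps the
   divisor positive for m = 0. *)
have m0 : 0 < m%:R + 1 :> R by rewrite ltr_wpDl.
have e'0 : 0 < e / (m%:R + 1) by rewrite divr_gt0.
have H : \forall z \near u0, forall i : 'I_m, `|'D_(e_ i) f u0 - 'D_(e_ i) f z| <= e / (m%:R + 1).
  apply: (@filter_forall _ _ (fun i z => `|'D_(e_ i) f u0 - 'D_(e_ i) f z| <= e / (m%:R + 1))
    _ (nbhs_filter u0)) => i.
  have /cvgrPdist_le/(_ _ e'0) h : {for u0, continuous ('D_(e_ i) f)} by exact: (cdf (e_ i)).1 Uu0.
  exact: h.
have /nbhs_ballP[r1 /= r10 H1] := H.
exists (Num.min r r1); first by rewrite lt_min r0.
move=> x y xr yr.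
have := @C1_estimate f u0 (Num.min r r1) (e / (m%:R + 1)) (fun i => 'D_(e_ i) f u0) (ltW e'0) _ _ x y xr yr.
move=> h; apply: le_trans (h _ _) _.
- by move=> z i; rewrite lt_min => /andP[zr _]; exact/df/Ur.
- move=> z i; rewrite lt_min => /andP[_ zr1]; rewrite distrC; apply: H1.
  by rewrite -ball_normE /= distrC.
rewrite -mulrA ler_wpM2l//; first exact: ltW.
rewrite mulrC ler_pdivrMr//.
apply: (@le_trans _ _ (\sum_(i < m) `|y - x|)).
  apply: ler_sum => i _.
  by have := norm_mx_coord_le (y - x) 0 i; rewrite !mxE.
by rewrite sumr_const card_ord -[leLHS]mulr_natr ler_wpM2l// lerDl.
Qed.

Lemma C1_lipschitz U f u0 : open U -> Ck 1 U f -> U u0 ->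
  exists r L, [/\ 0 < r, 0 <= L & forall x y, `|x - u0| < r -> `|y - u0| < r ->
    U x /\ `|f x - f y| <= L * `|x - y|].
Proof.
move=> oU cf Uu0; have [r r0 Ur] := open_ballP oU Uu0.
have [r1 r10 H] := C1_approx oU cf Uu0 ltr01.
have s0 : 0 <= \sum_i `|'D_(e_ i) f u0| by exact: sumr_ge0.
exists (Num.min r r1), ((\sum_i `|'D_(e_ i) f u0|) + 1).
split; [by rewrite lt_min r0|exact: addr_ge0|].
move=> x y; rewrite !lt_min => /andP[xr xr1] /andP[yr yr1]; split; first exact: Ur.
have h := H y x yr1 xr1.
rewrite -(subrK (\sum_i (x 0 i - y 0 i) *: 'D_(e_ i) f u0) (f x - f y)).
apply: le_trans (ler_normD _ _) _; rewrite addrC mulrDl; apply: lerD => //.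
apply: le_trans (ler_norm_sum _ _ _) _; rewrite mulr_suml; apply: ler_sum => i _.
rewrite normrZ mulrC ler_wpM2l//.
by have := norm_mx_coord_le (x - y) 0 i; rewrite !mxE.
Qed.

Lemma mulmx_continuous (B : 'M[R]_(m, n)) : continuous (mulmxr B : 'rV[R]_m -> 'rV[R]_n).
Proof.
apply: bounded_linear_continuous; rewrite /bounded_near.
have C0 : 0 <= \sum_i \sum_j `|B i j| by apply: sumr_ge0 => i _; exact: sumr_ge0.
near=> M; rewrite /= nbhs_ballP; exists 1 => //= v.
rewrite -ball_normE /= sub0r normrN => v1.
apply: (@le_trans _ _ (\sum_i \sum_j `|B i j|)); last first.
  by near: M; apply: nbhs_pinfty_ge; rewrite num_real.
apply: norm_mx_le => // i j; rewrite mxE.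
apply: le_trans (ler_norm_sum _ _ _) _; apply: ler_sum => l _.
rewrite normrM (bigD1 j)//= -[leLHS]addr0; apply: lerD; last exact: sumr_ge0.
rewrite ler_piMl//; apply: le_trans (ltW v1).
exact: norm_mx_coord_le.
Unshelve. all: by end_near. Qed.

Lemma C1_differentiable U f u0 : open U -> Ck 1 U f -> U u0 -> differentiable f u0.
Proof.
move=> oU cf Uu0.
pose B : 'M[R]_(m, n) := \matrix_(i, j) 'D_(e_ i) f u0 0 j.
have BE v : v *m B = \sum_i v 0 i *: 'D_(e_ i) f u0.
  apply/rowP => j; rewrite mxE summxE; apply: eq_bigr => i _.
  by rewrite !mxE.
have dE : f \o shift u0 = cst (f u0) + (mulmxr B : 'rV[R]_m -> 'rV[R]_n) +o_ (0 : 'rV[R]_m) id.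
  apply/eqaddoP => e e0; have [r r0 H] := C1_approx oU cf Uu0 e0.
  apply/nbhs_ballP; exists r => // v; rewrite -ball_normE /= sub0r normrN => vr.
  have := H u0 (v + u0); rewrite subrr normr0 addrK => /(_ r0 vr).
  rewrite (eq_bigr (fun i => v 0 i *: 'D_(e_ i) f u0)); last by move=> i _; rewrite mxE addrK.
  by rewrite -BE; rewrite !fctE /= opprD addrA.
have E : 'd f u0 = mulmxr B :> ('rV[R]_m -> 'rV[R]_n).
  by apply: diff_unique dE; exact: mulmx_continuous.
apply/diff_locallyP; rewrite E; split; last exact: dE.
exact: mulmx_continuous.
Qed.

Lemma C2_lip_near_jacobian U f u0 i j : open U -> Ck 2 U f -> U u0 ->
  lip_near u0 (fun u => 'J f u i j).
Proof.
move=> oU cf Uu0.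
have [r0 r00 Ur0] := open_ballP oU Uu0.
have cD : Ck 1 U ('D_(e_ i) f) by exact: (cf.2.2 (e_ i)).
have [r [L [r_gt0 L0 H]]] := C1_lipschitz oU cD Uu0.
exists r, L; split => // u v ur vr.
have [[Uu Huv] [Uv _]] := (H _ _ ur vr, H _ _ vr ur).
have JE w : U w -> 'J f w i j = 'D_(e_ i) f w 0 j.
  move=> Uw; rewrite deriveE; first by rewrite /jacobian /lin1_mx mxE.
  by apply: C1_differentiable oU _ Uw; exact: Ck_weaken cf.
have h := le_trans (norm_mx_coordB_le _ _ 0 j) Huv.
have E := f_equal2 (fun a b : R => a - b) (JE u Uu) (JE v Uv).
exact: (eq_ind_r (fun z => `|z| <= L * `|u - v|) h E).
Qed.

End Ck_calculus.

(** * Algebra of locally Lipschitz functions and matrices *)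

Section lip_near_algebra.
Context {R : realType} {U : normedModType R} (u0 : U).
Implicit Types f g : U -> R.

Lemma lip_near_cst c : lip_near u0 (fun=> c).
Proof. by exists 1, 0; split => // u v _ _; rewrite subrr normr0 mul0r. Qed.

Lemma lip_nearD f g : lip_near u0 f -> lip_near u0 g -> lip_near u0 (fun u => f u + g u).
Proof.
move=> [r1 [L1 [r10 L10 H1]]] [r2 [L2 [r20 L20 H2]]].
exists (Num.min r1 r2), (L1 + L2); split; [by rewrite lt_min r10|exact: addr_ge0|].
move=> u v; rewrite !lt_min => /andP[u1 u2] /andP[v1 v2].
rewrite opprD addrACA mulrDl; apply: le_trans (ler_normD _ _) _.
by apply: lerD; [exact: H1|exact: H2].
Qed.

Lemma lip_near_bounded f : lip_near u0 f -> exists r C, [/\ 0 < r, 0 <= C &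
  forall u, `|u - u0| < r -> `|f u| <= C].
Proof.
move=> [r [L [r0 L0 H]]]; exists r, (L * r + `|f u0|); split => //.
  by rewrite addr_ge0// mulr_ge0// ltW.
move=> u ur; rewrite -(subrK (f u0) (f u)); apply: le_trans (ler_normD _ _) _.
rewrite lerD2r; apply: le_trans (H _ _ ur _) _; first by rewrite subrr normr0.
by rewrite ler_wpM2l// ltW.
Qed.

Lemma lip_nearM f g : lip_near u0 f -> lip_near u0 g -> lip_near u0 (fun u => f u * g u).
Proof.
move=> lf lg; have [r3 [C3 [r30 C30 H3]]] := lip_near_bounded lf.
have [r4 [C4 [r40 C40 H4]]] := lip_near_bounded lg.
case: lf lg => [r1 [L1 [r10 L10 H1]]] [r2 [L2 [r20 L20 H2]]].
exists (Num.min (Num.min r1 r2) (Num.min r3 r4)), (L1 * C4 + C3 * L2).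
split; [by rewrite !lt_min r10 r20 r30|by rewrite addr_ge0// mulr_ge0|].
move=> u v; rewrite !lt_min => /andP[/andP[u1 u2] /andP[u3 u4]] /andP[/andP[v1 v2] /andP[v3 v4]].
have -> : f u * g u - f v * g v = (f u - f v) * g u + f v * (g u - g v) by ring.
apply: le_trans (ler_normD _ _) _; rewrite [leRHS]mulrDl !normrM; apply: lerD.
  by rewrite mulrAC; apply: ler_pM => //; [exact: H1|exact: H4].
by rewrite -mulrA; apply: ler_pM => //; [exact: H3|exact: H2].
Qed.

Lemma lip_near_sum (I : Type) (s : seq I) (P : pred I) (f : I -> U -> R) :
  (forall i, P i -> lip_near u0 (f i)) -> lip_near u0 (fun u => \sum_(i <- s | P i) f i u).
Proof.
move=> H; elim: s => [|i s IH].
  by under eq_fun do rewrite big_nil; exact: lip_near_cst.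
under eq_fun do rewrite big_cons.
by case Pi: (P i) => //; apply: lip_nearD => //; exact: H.
Qed.

Lemma lip_near_prod (I : Type) (s : seq I) (P : pred I) (f : I -> U -> R) :
  (forall i, P i -> lip_near u0 (f i)) -> lip_near u0 (fun u => \prod_(i <- s | P i) f i u).
Proof.
move=> H; elim: s => [|i s IH].
  by under eq_fun do rewrite big_nil; exact: lip_near_cst.
under eq_fun do rewrite big_cons.
by case Pi: (P i) => //; apply: lip_nearM => //; exact: H.
Qed.

Lemma lip_near_ge f : lip_near u0 f -> f u0 != 0 ->
  exists2 r, 0 < r & forall u, `|u - u0| < r -> `|f u0| / 2 <= `|f u|.
Proof.
move=> [r [L [r0 L0 H]]] f0; have f00 : 0 < `|f u0| by rewrite normr_gt0.
exists (Num.min r (`|f u0| / 2 / (L + 1))).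
  by rewrite lt_min r0 !divr_gt0// ltr_wpDl.
move=> u; rewrite lt_min ltr_pdivlMr ?ltr_wpDl// => /andP[ur uL].
have := H u u0 ur; rewrite subrr normr0 => /(_ r0) h.
have := ler_normB (f u0) (f u0 - f u); rewrite opprB addrC subrK distrC.
have : 0 <= `|u - u0| by [].
move: h uL; rewrite mulrDr mulr1 (mulrC L) => h uL n0 h2.
have : `|f u0| <= `|f u| + `|f u - f u0|.
  by have := ler_normD (f u) (f u0 - f u); rewrite addrC subrK distrC addrC.
by move: n0 h uL; lra.
Qed.

Lemma lip_nearV f : lip_near u0 f -> f u0 != 0 -> lip_near u0 (fun u => (f u)^-1).
Proof.
move=> lf f0; have [r2 r20 H2] := lip_near_ge lf f0.
case: lf => [r1 [L1 [r10 L10 H1]]].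
have f00 : 0 < `|f u0| / 2 by rewrite divr_gt0// normr_gt0.
set c := `|f u0| / 2 in H2 f00.
exists (Num.min r1 r2), (L1 / c ^+ 2); split; [by rewrite lt_min r10|by rewrite divr_ge0// exprn_ge0// ltW|].
move=> u v; rewrite !lt_min => /andP[u1 u2] /andP[v1 v2].
have [hu hv] := (H2 _ u2, H2 _ v2).
have fu0 : f u != 0 by rewrite -normr_gt0 (lt_le_trans f00).
have fv0 : f v != 0 by rewrite -normr_gt0 (lt_le_trans f00).
have -> : (f u)^-1 - (f v)^-1 = (f v - f u) / (f u * f v) by field; rewrite ?fu0 ?fv0.
rewrite normrM normfV normrM distrC mulrAC.
apply: ler_pM => //; first exact: H1.
rewrite lef_pV2 ?posrE ?exprn_gt0// ?mulr_gt0 ?normr_gt0//.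
by rewrite expr2; apply: ler_pM => //; exact: ltW.
Qed.

Lemma lip_near_det {n : nat} (A : U -> 'M[R]_n) :
  (forall i j, lip_near u0 (fun u => A u i j)) -> lip_near u0 (fun u => \det (A u)).
Proof.
move=> H; apply: lip_near_sum => s _; apply: lip_nearM; first exact: lip_near_cst.
by apply: lip_near_prod => i _; exact: H.
Qed.

(** [invmx] is defined by cases on invertibility; the cofactor formula is a single expression in
    sums, products and one inverse, to which the previous lemmas apply. *)
Lemma lip_near_invmx {n : nat} (A : U -> 'M[R]_n) i j :
  (forall i j, lip_near u0 (fun u => A u i j)) -> A u0 \in unitmx ->
  lip_near u0 (fun u => (\det (A u))^-1 * (\adj (A u)) i j).
Proof.
move=> H Au; apply: lip_nearM.
  by apply: lip_nearV; [exact: lip_near_det|move: Au; rewrite unitmxE unitfE].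
under eq_fun do rewrite mxE /cofactor.
apply: lip_nearM; first exact: lip_near_cst.
apply: lip_near_det => i' j'; under eq_fun do rewrite !mxE; exact: H.
Qed.

Lemma lip_near_mulmx {m n p : nat} (A : U -> 'M[R]_(m, n)) (B : U -> 'M[R]_(n, p)) i j :
  (forall i j, lip_near u0 (fun u => A u i j)) ->
  (forall i j, lip_near u0 (fun u => B u i j)) ->
  lip_near u0 (fun u => (A u *m B u) i j).
Proof.
move=> HA HB; under eq_fun do rewrite mxE.
by apply: lip_near_sum => l _; exact: lip_nearM.
Qed.

Lemma near_unitmx {n : nat} (A : U -> 'M[R]_n) :
  (forall i j, lip_near u0 (fun u => A u i j)) -> A u0 \in unitmx ->
  exists2 r, 0 < r & forall u, `|u - u0| < r -> A u \in unitmx.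
Proof.
move=> H; rewrite unitmxE unitfE => d0.
have [r r0 Hr] := lip_near_ge (lip_near_det H) d0.
exists r => // u ur; rewrite unitmxE unitfE -normr_gt0 (lt_le_trans _ (Hr u ur))//.
by rewrite divr_gt0// normr_gt0.
Qed.

End lip_near_algebra.

(** * Charts, differentials and curves on manifolds *)

Section near_eq_diff.
Context {R : realType} {E F : normedModType R}.

Lemma near_eq_differentiable (f g : E -> F) (x : E) :
  (\forall y \near x, f y = g y) -> differentiable f x ->
  differentiable g x /\ 'd g x = 'd f x :> (E -> F).
Proof.
move=> fg df; have fgx : f x = g x by exact: nbhs_singleton fg.
have cd : continuous ('d f x) by exact: diff_continuous.
have dE : g \o shift x = cst (g x) + 'd f x +o_ (0 : E) id.
  apply/eqaddoP => e e0.
  have /eqaddoP/(_ e e0) H := diff_locally df.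
  have fg0 : \forall h \near (0 : E), f (h + x) = g (h + x).
    by move: fg; rewrite (near_shift 0); apply: filterS => h /=; rewrite subr0.
  near=> h.
  have h1 : f (h + x) = g (h + x) by near: h.
  have h2 : `|(f \o shift x - (cst (f x) + 'd f x)) h| <= e * `|h| by near: h.
  by move: h2; rewrite !fctE /= h1 fgx.
have E' : 'd g x = 'd f x :> (E -> F) by exact: diff_unique dE.
split; last exact: E'.
by apply/diff_locallyP; rewrite E'; split; [exact: cd|exact: dE].
Unshelve. all: by end_near. Qed.

End near_eq_diff.

Section chart_basics.
Context {R : realType} {n : nat} {M : manifoldType R n}.
Implicit Types (c d : chart 'rV[R]_n M) (x : M).

Lemma cdom_nbhs c x : atlas c -> cdom c x -> nbhs x (cdom c).
Proof. by move=> /atlas_chart[oc _ _ _ _] cx; exact: open_nbhs_nbhs. Qed.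

Lemma cimg_open c : atlas c -> open (cfun c @` cdom c).
Proof. by move=> /atlas_chart[]. Qed.

Lemma cfunK c x : atlas c -> cdom c x -> cinv c (cfun c x) = x.
Proof. by move=> /atlas_chart[_ _ H _ _]; exact: H. Qed.

Lemma cfun_continuous c x : atlas c -> cdom c x -> {for x, continuous (cfun c)}.
Proof. by move=> /atlas_chart[_ _ _ H _]; exact: H. Qed.

Lemma cinv_continuous c x : atlas c -> cdom c x -> {for cfun c x, continuous (cinv c)}.
Proof. by move=> /atlas_chart[_ _ _ _ H] cx; apply: H; exists x. Qed.

Lemma cinvP c u : atlas c -> (cfun c @` cdom c) u -> cdom c (cinv c u) /\ cfun c (cinv c u) = u.
Proof. by move=> ac [x cx <-]; rewrite (cfunK ac cx). Qed.

Lemma cinv_cvg c x : atlas c -> cdom c x -> cinv c u @[u --> cfun c x] --> x.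
Proof. by move=> ac cx; rewrite -[X in _ --> X](cfunK ac cx); exact: cinv_continuous. Qed.

End chart_basics.

Section chart_calculus.
Context {R : realType} {m n p : nat}.
Context {M : manifoldType R m} {N : manifoldType R n} {P : manifoldType R p}.

Definition diff_in_charts {m n} {M : manifoldType R m} {N : manifoldType R n}
    (c : chart 'rV[R]_m M) (d : chart 'rV[R]_n N) (f : M -> N) (x : M) :=
  differentiable (cfun d \o f \o cinv c) (cfun c x).

(** The first derivative gives differentials and the second makes their coefficients locally
    Lipschitz, as uniqueness of integral curves requires. *)
Definition C2map {m n} {M : manifoldType R m} {N : manifoldType R n} (f : M -> N) :=
  continuous f /\ forall c d, atlas c -> atlas d ->
    Ck 2 (cfun c @` (cdom c `&` f @^-1` cdom d)) (cfun d \o f \o cinv c).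

(** The composition of the two chart representatives coincides with the representative of g o f only
    near [cfun c x], where f still takes values in the domain of d; differentials depend only on
    germs. *)
Lemma rep_comp (c : chart 'rV[R]_m M) (d : chart 'rV[R]_n N) (e : chart 'rV[R]_p P)
    (f : M -> N) (g : N -> P) (x : M) :
  atlas c -> atlas d -> cdom c x -> cdom d (f x) -> {for x, continuous f} ->
  diff_in_charts c d f x -> diff_in_charts d e g (f x) ->
  diff_in_charts c e (g \o f) x /\
  'd (cfun e \o (g \o f) \o cinv c) (cfun c x) =
  'd (cfun e \o g \o cinv d) (cfun d (f x)) \o 'd (cfun d \o f \o cinv c) (cfun c x)
    :> (_ -> _).
Proof.
move=> ac ad cx dfx cf df dg.
have E0 : (cfun d \o f \o cinv c) (cfun c x) = cfun d (f x).
  exact: (congr1 (cfun d \o f) (cfunK ac cx)).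
have dg' : differentiable (cfun e \o g \o cinv d) ((cfun d \o f \o cinv c) (cfun c x)).
  by rewrite E0.
have dcomp := differentiable_comp df dg'.
have Ecomp := diff_comp df dg'.
have near_eq : \forall u \near cfun c x, ((cfun e \o g \o cinv d) \o (cfun d \o f \o cinv c)) u
    = (cfun e \o (g \o f) \o cinv c) u.
  have nd : \forall u \near cfun c x, cdom d (f (cinv c u)).
    exact: (@cvg_comp _ _ _ _ f _ _ _ (cinv_cvg ac cx) cf _ (cdom_nbhs ad dfx)).
  by apply: filterS nd => u du; exact: (congr1 (cfun e \o g) (cfunK ad du)).
have [D1 D2] := near_eq_differentiable near_eq dcomp.
split; first exact: D1.
apply: (etrans D2); apply: (etrans Ecomp).
exact: (congr1 (fun w : 'rV[R]_n => ('d (cfun e \o g \o cinv d) w : _ -> _)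
  \o ('d (cfun d \o f \o cinv c) (cfun c x) : _ -> _)) E0).
Qed.

End chart_calculus.

Section C2map.
Context {R : realType}.

Lemma C2_dom_open {m n} {M : manifoldType R m} {N : manifoldType R n} (f : M -> N) c d :
  continuous f -> atlas c -> atlas d -> open (cfun c @` (cdom c `&` f @^-1` cdom d)).
Proof.
move=> cf ac ad; rewrite openE => _ [x [cx dfx] <-].
have n1 : \forall u \near cfun c x, (cfun c @` cdom c) u.
  by apply: open_nbhs_nbhs; split; [exact: cimg_open|exists x].
have n2 : \forall u \near cfun c x, cdom d (f (cinv c u)).
  exact: (@cvg_comp _ _ _ _ f _ _ _ (cinv_cvg ac cx) (cf x) _ (cdom_nbhs ad dfx)).
apply: filterS2 n1 n2 => u cu du; have [h1 h2] := cinvP ac cu.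
by exists (cinv c u).
Qed.

Lemma C2map_diff {m n} {M : manifoldType R m} {N : manifoldType R n} (f : M -> N) c d x :
  C2map f -> atlas c -> atlas d -> cdom c x -> cdom d (f x) -> diff_in_charts c d f x.
Proof.
move=> [cf Cf] ac ad cx dfx.
have C1f := Ck_weaken (isT : (1 <= 2)%N) (Cf c d ac ad).
by apply: (C1_differentiable (C2_dom_open cf ac ad) C1f); exists x.
Qed.

Lemma C2map_lipschitz {m n} {M : manifoldType R m} {N : manifoldType R n} (f : M -> N) c d x :
  C2map f -> atlas c -> atlas d -> cdom c x -> cdom d (f x) ->
  exists r L, [/\ 0 < r, 0 <= L & forall u v, `|u - cfun c x| < r -> `|v - cfun c x| < r ->
    `|(cfun d \o f \o cinv c) u - (cfun d \o f \o cinv c) v| <= L * `|u - v|].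
Proof.
move=> [cf Cf] ac ad cx dfx.
have C1f := Ck_weaken (isT : (1 <= 2)%N) (Cf c d ac ad).
have [|r [L [r0 L0 H]]] := C1_lipschitz (C2_dom_open cf ac ad) C1f (u0 := cfun c x).
  by exists x.
by exists r, L; split => // u v ur vr; exact: (H u v ur vr).2.
Qed.

Lemma smooth_C2map {m n} {M : manifoldType R m} {N : manifoldType R n} (f : M -> N) :
  smooth_map f -> C2map f.
Proof.
by move=> [cf sf]; split; [exact: cf|move=> c d ac ad; exact: (sf c d ac ad 2%N)].
Qed.

(** Changes of chart are thereby chart representatives of a map, and every lemma on [C2map] applies
    to them. *)
Lemma id_C2map {m} {M : manifoldType R m} : C2map (@idfun M).
Proof.
split; first by move=> x; exact: cvg_id.
by move=> c d ac ad; exact: (atlas_compatible _ _ ac ad).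
Qed.

End C2map.

Section tangent.
Context {R : realType} {n : nat} {M : manifoldType R n}.
Implicit Types (c d : chart 'rV[R]_n M) (x : M).

(* Coordinates in the chart c of a tangent vector at x, and back. *)
Definition tcoord c x : 'rV[R]_n -> 'rV[R]_n :=
  'd (cfun c \o idfun \o cinv (chart_at x)) (cfun (chart_at x) x).

Definition tcoord_inv c x : 'rV[R]_n -> 'rV[R]_n :=
  'd (cfun (chart_at x) \o idfun \o cinv c) (cfun c x).

Lemma rep_id c x : atlas c -> cdom c x ->
  'd (cfun c \o idfun \o cinv c) (cfun c x) = id :> ('rV[R]_n -> 'rV[R]_n).
Proof.
move=> ac cx.
have near_eq : \forall u \near cfun c x, id u = (cfun c \o idfun \o cinv c) u.
  have n1 : \forall u \near cfun c x, (cfun c @` cdom c) u.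
    by apply: open_nbhs_nbhs; split; [exact: cimg_open|exists x].
  by apply: filterS n1 => u cu /=; rewrite (cinvP ac cu).2.
have [_ ->] := near_eq_differentiable near_eq (ex_diff (is_diff_def := is_diff_id (cfun c x))).
exact: (diff_val (is_diff_def := is_diff_id (cfun c x))).
Qed.

Let diff_id c d x : atlas c -> atlas d -> cdom c x -> cdom d x ->
  diff_in_charts c d (@idfun M) x.
Proof. exact: (C2map_diff id_C2map). Qed.

Let id_cont x : {for x, continuous (@idfun M)}. Proof. exact: cvg_id. Qed.

Lemma tcoordK c x : atlas c -> cdom c x -> cancel (tcoord c x) (tcoord_inv c x).
Proof.
move=> ac cx v; have [aa ax] := (atlas_chart_at x, mem_chart_at x).
have [_ H] := rep_comp (d := c) aa ac ax cx (@id_cont x) (diff_id aa ac ax cx) (diff_id ac aa cx ax).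
by have := congr1 (fun g => g v) (rep_id aa ax); rewrite H.
Qed.

Lemma tcoord_invK c x : atlas c -> cdom c x -> cancel (tcoord_inv c x) (tcoord c x).
Proof.
move=> ac cx v; have [aa ax] := (atlas_chart_at x, mem_chart_at x).
have [_ H] := rep_comp (d := chart_at x) ac aa cx ax (@id_cont x) (diff_id ac aa cx ax) (diff_id aa ac ax cx).
by have := congr1 (fun g => g v) (rep_id ac cx); rewrite H.
Qed.

End tangent.

Section differential.
Context {R : realType}.

Definition mdifferentiable {m n} {M : manifoldType R m} {N : manifoldType R n}
    (f : M -> N) (x : M) :=
  {for x, continuous f} /\ diff_in_charts (chart_at x) (chart_at (f x)) f x.

Lemma C2map_mdifferentiable {m n} {M : manifoldType R m} {N : manifoldType R n}
  (f : M -> N) x : C2map f -> mdifferentiable f x.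
Proof.
move=> Cf; split; first exact: Cf.1.
by apply: C2map_diff Cf _ _ _ _; [exact: atlas_chart_at|exact: atlas_chart_at|exact: mem_chart_at|exact: mem_chart_at].
Qed.

Lemma mdiff_comp {m n p} {M : manifoldType R m} {N : manifoldType R n}
    {P : manifoldType R p} (f : M -> N) (g : N -> P) x :
  mdifferentiable f x -> mdifferentiable g (f x) ->
  mdifferentiable (g \o f) x /\ mdiff (g \o f) x = mdiff g (f x) \o mdiff f x.
Proof.
move=> [cf df] [cg dg].
have [D1 D2] := rep_comp (atlas_chart_at x) (atlas_chart_at (f x))
  (mem_chart_at x) (mem_chart_at (f x)) cf df dg.
split; last exact: D2.
by split; [exact: (continuous_comp cf cg)|exact: D1].
Qed.

Lemma mdiff_id {m} {M : manifoldType R m} (x : M) : mdiff (@idfun M) x = id.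
Proof. exact: rep_id (atlas_chart_at x) (mem_chart_at x). Qed.

Lemma rep_mdiff {m n} {M : manifoldType R m} {N : manifoldType R n} (f : M -> N)
    c d x : C2map f -> atlas c -> atlas d -> cdom c x -> cdom d (f x) ->
  'd (cfun d \o f \o cinv c) (cfun c x) \o tcoord c x =
  tcoord d (f x) \o mdiff f x.
Proof.
move=> Cf ac ad cx dfx.
have [aa ax] := (atlas_chart_at x, mem_chart_at x).
have [ab bx] := (atlas_chart_at (f x), mem_chart_at (f x)).
have cid (y : M) : {for y, continuous (@idfun M)} by exact: cvg_id.
have [_ H1] := rep_comp aa ac ax cx (cid x) (C2map_diff id_C2map aa ac ax cx)
  (C2map_diff Cf ac ad cx dfx).
have [_ H2] := rep_comp aa ab ax bx (Cf.1 x) (C2map_diff Cf aa ab ax bx)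
  (C2map_diff id_C2map ab ad bx dfx).
exact: (etrans (esym H1) H2).
Qed.

End differential.

(** * Absolutely continuous curves and their velocities *)

Section curves.
Context {R : realType}.
Notation mu := (@lebesgue_measure R).

(** The counterpart of [velocity] for curves on the whole line, from which the latter is recovered
    by composing with [clamp]. *)
Definition vel {n} {M : manifoldType R n} (alpha : R -> M) (t : R) : 'rV[R]_n :=
  derive1 (cfun (chart_at (alpha t)) \o alpha) t.

Definition curve_derivable {n} {M : manifoldType R n} (alpha : R -> M) (t : R) :=
  derivable (cfun (chart_at (alpha t)) \o alpha) t 1.

Lemma curve_map {m n} {M : manifoldType R m} {N : manifoldType R n} (f : M -> N)
    (alpha : R -> M) c d t :
  atlas c -> cdom c (alpha t) ->
  diff_in_charts c d f (alpha t) -> {for t, continuous alpha} ->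
  derivable (cfun c \o alpha) t 1 ->
  derivable (cfun d \o f \o alpha) t 1 /\
  derive1 (cfun d \o f \o alpha) t =
    'd (cfun d \o f \o cinv c) (cfun c (alpha t)) (derive1 (cfun c \o alpha) t).
Proof.
move=> ac ca df ca_cont da.
have da' : differentiable (cfun c \o alpha) t by apply/derivable1_diffP.
have df' : differentiable (cfun d \o f \o cinv c) ((cfun c \o alpha) t) by exact: df.
have dcomp := differentiable_comp da' df'.
have Ecomp := diff_comp da' df'.
have near_eq : \forall s \near t, ((cfun d \o f \o cinv c) \o (cfun c \o alpha)) s
    = (cfun d \o f \o alpha) s.
  have nc : \forall s \near t, cdom c (alpha s) by exact: (ca_cont _ (cdom_nbhs ac ca)).
  by apply: filterS nc => s cs; exact: (congr1 (cfun d \o f) (cfunK ac cs)).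
have [D1 D2] := near_eq_differentiable near_eq dcomp.
split; first by apply/derivable1_diffP.
rewrite (derive1E' D1) (derive1E' da').
exact: (etrans (congr1 (fun g => g 1) D2) (congr1 (fun g => g 1) Ecomp)).
Qed.

Section one_manifold.
Context {n : nat} {M : manifoldType R n}.
Implicit Types (alpha : R -> M).

Lemma derivable_chart alpha c t : atlas c -> cdom c (alpha t) ->
  {for t, continuous alpha} ->
  (curve_derivable alpha t -> derivable (cfun c \o alpha) t 1 /\
     derive1 (cfun c \o alpha) t = tcoord c (alpha t) (vel alpha t)) /\
  (derivable (cfun c \o alpha) t 1 -> curve_derivable alpha t).
Proof.
move=> ac ca cont; have [aa aat] := (atlas_chart_at (alpha t), mem_chart_at (alpha t)).
split => da.
  exact: (curve_map aa aat (C2map_diff id_C2map aa ac aat ca) cont da).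
by have [] := curve_map ac ca (C2map_diff id_C2map ac aa ca aat) cont da.
Qed.

(* The charts and the restriction to short intervals are built into the
   definition, so that the notion is visibly local. *)
Definition AC_curve (a b : R) alpha := continuous alpha /\
  forall t, a <= t <= b -> exists c delta, [/\ atlas c, cdom c (alpha t), 0 < delta &
    forall s r, a <= s -> s <= r -> r <= b -> t - delta < s -> r < t + delta ->
      AC s r (cfun c \o alpha)].

End one_manifold.

Lemma near_ball (P : R -> Prop) t : (\forall s \near t, P s) ->
  exists2 e, 0 < e & forall s, t - e < s -> s < t + e -> P s.
Proof.
move=> /nbhs_ballP[e /= e0 H]; exists e => // s s1 s2; apply: H.
by rewrite -ball_normE /= ltr_distlC; apply/andP.
Qed.

Lemma window_widen (t e e' s q x : R) : t - e < s -> q < t + e -> e <= e' ->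
  s <= x -> x <= q -> t - e' < x /\ x < t + e'.
Proof. by lra. Qed.

(** In charts f is locally Lipschitz, which preserves absolute continuity. The chart d is arbitrary,
    so the case of the identity shows that an [AC_curve] is absolutely continuous in every chart and
    not only in those its definition provides. *)
Lemma AC_curve_map {m n} {M : manifoldType R m} {N : manifoldType R n} (f : M -> N)
    (alpha : R -> M) a b t d : C2map f -> AC_curve a b alpha -> a <= t <= b ->
  atlas d -> cdom d (f (alpha t)) ->
  exists2 delta, 0 < delta & 
    forall s r, a <= s -> s <= r -> r <= b -> t - delta < s -> r < t + delta ->
      AC s r (cfun d \o f \o alpha).
Proof.
move=> Cf [ca H] tab ad dfa; have [c [delta [ac cat delta0 Hac]]] := H t tab.
have [r [L [r0 L0 lip]]] := C2map_lipschitz Cf ac ad cat dfa.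
have n1 : \forall s \near t, cdom c (alpha s) by exact: (ca t _ (cdom_nbhs ac cat)).
have n2 : \forall s \near t, `|cfun c (alpha s) - cfun c (alpha t)| < r.
  have h : {for t, continuous (cfun c \o alpha)}.
    exact: (continuous_comp (ca t) (cfun_continuous ac cat)).
  have /cvgrPdist_lt/(_ r r0) h' := h.
  by apply: filterS h' => s hs; exact: (eq_ind _ (fun z => z < r) hs _ (distrC _ _)).
have [e1 e10 h1] := near_ball n1; have [e2 e20 h2] := near_ball n2.
exists (Num.min delta (Num.min e1 e2)); first by rewrite !lt_min delta0 e10.
move=> s q as_ sq qb; set e := Num.min _ _ => es eq.
have [ed ee1 ee2] : [/\ e <= delta, e <= e1 & e <= e2].
  by rewrite /e !ge_min !lexx !orbT.
have win e' x := @window_widen t e e' s q x es eq.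
have acc : AC s q (cfun c \o alpha).
  have [w1 _] := win _ s ed (lexx _) sq; have [_ w2] := win _ q ed sq (lexx _).
  exact: Hac.
apply: AC_dominated acc => x y sx xy yq.
have sy := le_trans sx xy; have xq := le_trans xy yq.
have [x1 x2] := win _ x ee1 sx xq; have [y1 y2] := win _ y ee1 sy yq.
have [x3 x4] := win _ x ee2 sx xq; have [y3 y4] := win _ y ee2 sy yq.
have [cx cy] : cdom c (alpha x) /\ cdom c (alpha y) by split; exact: h1.
have [rx ry] : `|cfun c (alpha x) - cfun c (alpha t)| < r /\
  `|cfun c (alpha y) - cfun c (alpha t)| < r by split; exact: h2.
have := lip _ _ ry rx.
have E z : cdom c (alpha z) -> (cfun d \o f \o cinv c) (cfun c (alpha z)) = (cfun d \o f \o alpha) z.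
  by move=> cz; exact: (congr1 (cfun d \o f) (cfunK ac cz)).
have EE := f_equal2 (fun u v => `|u - v| <= L * `|cfun c (alpha y) - cfun c (alpha x)|) (E y cy) (E x cx).
by move=> h; exact: (eq_ind _ (fun b : bool => is_true b) h _ EE).
Qed.

Lemma AC_curve_comp {m n} {M : manifoldType R m} {N : manifoldType R n} (f : M -> N)
    (alpha : R -> M) a b : C2map f -> AC_curve a b alpha -> AC_curve a b (f \o alpha).
Proof.
move=> Cf acA; split; first by move=> t; exact: (continuous_comp (acA.1 t) (Cf.1 _)).
move=> t tab; have [aa at_] := (atlas_chart_at (f (alpha t)), mem_chart_at (f (alpha t))).
have [delta delta0 Hd] := AC_curve_map Cf acA tab aa at_.
by exists (chart_at (f (alpha t))), delta.
Qed.

Lemma vel_map {m n} {M : manifoldType R m} {N : manifoldType R n} (f : M -> N)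
    (alpha : R -> M) t : C2map f -> {for t, continuous alpha} -> curve_derivable alpha t ->
  curve_derivable (f \o alpha) t /\ vel (f \o alpha) t = mdiff f (alpha t) (vel alpha t).
Proof.
move=> Cf ca da; have [aa at_] := (atlas_chart_at (alpha t), mem_chart_at (alpha t)).
have [ab bt] := (atlas_chart_at (f (alpha t)), mem_chart_at (f (alpha t))).
exact: (curve_map aa at_ (C2map_diff Cf aa ab at_ bt) ca da).
Qed.

Lemma lebesgue_ae_cat (P : R -> Prop) s r t :
  {ae mu, forall x, s < x < r -> P x} -> {ae mu, forall x, r < x < t -> P x} ->
  {ae mu, forall x, s < x < t -> P x}.
Proof.
move=> h1 h2; apply: lebesgue_aeS (lebesgue_aeI h1 (lebesgue_aeI h2 (lebesgue_ae_neq r))).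
move=> x [H1 [H2 xr]] /andP[sx xt]; case: (ltgtP x r) xr => // xr _.
  by apply: H1; rewrite sx.
by apply: H2; rewrite xr.
Qed.

Lemma AC_curve_ae_derivable {n} {M : manifoldType R n} (alpha : R -> M) a b :
  a <= b -> AC_curve a b alpha -> {ae mu, forall t, a < t < b -> curve_derivable alpha t}.
Proof.
move=> ab acA.
pose P s r := {ae mu, forall t, s < t < r -> curve_derivable alpha t}.
apply: (@cousin_ind R a b P ab) => [t tab|s r t _ _ _ _]; last exact: lebesgue_ae_cat.
have [c [delta [ac cat delta0 Hac]]] := acA.2 t tab.
have n1 : \forall s \near t, cdom c (alpha s) by exact: (acA.1 t _ (cdom_nbhs ac cat)).
have [e1 e10 h1] := near_ball n1.
exists (Num.min delta e1); first by rewrite lt_min delta0.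
move=> s r as_ sr rb; set e := Num.min _ _ => es er.
have [ed ee] : e <= delta /\ e <= e1 by rewrite /e !ge_min !lexx orbT.
have [h ph] : exists h, primitive s r (cfun c \o alpha) h.
  have [w1 _] := window_widen es er ed (lexx s) sr; have [_ w2] := window_widen es er ed sr (lexx r).
  by apply: AC_primitive => //; exact: Hac.
apply: lebesgue_aeS (primitive_ae_derivable ph) => x Hx sxr.
have [dx _] := Hx sxr; move: sxr => /andP[sx xr].
have [w1 w2] := window_widen es er ee (ltW sx) (ltW xr).
have cx : cdom c (alpha x) by exact: h1.
exact: (derivable_chart ac cx (acA.1 x)).2 dx.
Qed.

End curves.

(** * Curves on the unit interval and their extensions to the line *)

Section unit_interval_curves.
Context {R : realType}.

Lemma clamp_val (t : unit_interval R) : clamp (val t) = t.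
Proof.
apply: val_inj => /=; have := set_valP t; rewrite /= in_itv/= => /andP[t0 t1].
by rewrite (min_r t1) (max_r t0).
Qed.

Lemma val_clamp (t : R) : 0 <= t -> t <= 1 -> val (clamp t) = t.
Proof. by move=> t0 t1; rewrite /= (min_r t1) (max_r t0). Qed.

Lemma clamp_itv (t : R) : 0 <= val (clamp t) /\ val (clamp t) <= 1.
Proof. by have := set_valP (clamp t); rewrite /= in_itv/= => /andP[]. Qed.

Lemma continuous_clamp : continuous (@clamp R).
Proof.
apply: (@continuous_comp_initial _ _ _ (set_val : unit_interval R -> R)).
move=> x; apply/cvgrPdist_lt => e e0; near=> y.
have xy : `|y - x| < e.
  by near: y; apply: cvgr_distC_lt e0; exact: cvg_id.
rewrite distrC; apply: le_lt_trans xy; exact: (clip_lipschitz 0 1 x y).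
Unshelve. all: by end_near. Qed.

Lemma continuous_unit_val {T : topologicalType} (f : R -> T) : continuous f ->
  continuous (fun t : unit_interval R => f (val t)).
Proof.
move=> cf t; apply: (@continuous_comp _ _ _ (set_val : unit_interval R -> R) f).
  exact: initial_continuous.
exact: cf.
Qed.

Lemma AC_empty {E : normedModType R} (a b : R) (f : R -> E) : b < a -> AC a b f.
Proof.
move=> ba e e0; exists 1 => // -[|x l] /=; first by rewrite /variation big_nil.
by move=> /andP[/and3P[x1 x2 x3] _]; have := le_trans x1 (le_trans x2 x3); rewrite leNgt ba.
Qed.

Lemma abs_continuousP {E : normedModType R} (f : unit_interval R -> E)
    (a b : unit_interval R) :
  abs_continuous a b f <-> AC (val a) (val b) (f \o @clamp R).
Proof.
have [a0 b1] : 0 <= val a /\ val b <= 1.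
  by rewrite -(clamp_val a) -(clamp_val b); split; [exact: (clamp_itv _).1|exact: (clamp_itv _).2].
split=> H e e0; have [d d0 Hd] := H e e0; exists d => //.
  move=> l wl pl ld; pose x0 : R * R := (0, 0).
  pose s (i : 'I_(size l)) := @clamp R (nth x0 l i).1.
  pose t (i : 'I_(size l)) := @clamp R (nth x0 l i).2.
  have wi (i : 'I_(size l)) : within_segment (val a) (val b) (nth x0 l i).
    by apply: (allP wl); exact: mem_nth.
  have sE i : val (s i) = (nth x0 l i).1.
    have /and3P[x1 x2 x3] := wi i; apply: val_clamp; first exact: le_trans x1.
    by apply: le_trans b1; exact: le_trans x3.
  have tE i : val (t i) = (nth x0 l i).2.
    have /and3P[x1 x2 x3] := wi i; apply: val_clamp; last exact: le_trans b1.
    by apply: le_trans x2; exact: le_trans x1.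
  have := Hd (size l) s t; rewrite /variation (big_nth x0) big_mkord; apply.
  - by move=> i; rewrite sE tE; have /and3P[-> ->] := wi i.
  - move=> i j ij; rewrite !sE !tE.
    have /(pairwiseP x0) ps := pl.
    case: (ltngtP i j) => [lt|lt|/val_inj eq]; last by rewrite eq eqxx in ij.
      have := ps i j; rewrite !inE => /(_ (ltn_ord i) (ltn_ord j) lt) /orP[]; by [left|right].
    have := ps j i; rewrite !inE => /(_ (ltn_ord j) (ltn_ord i) lt) /orP[]; by [right|left].
  - rewrite (eq_bigr (fun i : 'I_(size l) => (nth x0 l i).2 - (nth x0 l i).1)).
      by move: ld; rewrite /total_length (big_nth x0) big_mkord.
    by move=> i _; rewrite sE tE.
move=> N s t wst dst lst.
pose l := [seq (val (s i), val (t i)) | i <- enum 'I_N].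
have := Hd l; rewrite /variation /l big_map big_enum/=.
rewrite (eq_bigr (fun i => `|f (t i) - f (s i)|)); last by move=> i _; rewrite !clamp_val.
apply.
- apply/allP => _ /mapP[i _ ->]; rewrite /within_segment/=.
  by have [/andP[-> ->] ->] := wst i.
- rewrite pairwise_map; have := enum_uniq 'I_N; rewrite uniq_pairwise.
  apply: sub_pairwise => i j /= /dst ij; rewrite /separated/=.
  by case: ij => ->; rewrite ?orbT.
- by rewrite /total_length big_map big_enum.
Qed.

(** [ac_curves] speaks of all charts and all intervals mapped into them, [AC_curve] of one chart
    around each time. Chart independence and [AC_local] lead from the second to the first. *)
Lemma ac_curvesP {n} {M : manifoldType R n} (alpha : unit_interval R -> M) :
  ac_curves M alpha <-> AC_curve 0 1 (alpha \o @clamp R).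
Proof.
split=> [[ca H]|[ca H]].
  have cac : continuous (alpha \o @clamp R).
    by move=> t; apply: continuous_comp; [exact: continuous_clamp|exact: ca].
  split; first exact: cac.
  move=> t t01; have [aa at_] := (atlas_chart_at (alpha (clamp t)), mem_chart_at (alpha (clamp t))).
  have [e e0 He] := near_ball (cac t _ (cdom_nbhs aa at_)).
  exists (chart_at (alpha (clamp t))), e; split => //.
  move=> s r s0 sr r1 ts rt.
  have [vs vr] : val (@clamp R s) = s /\ val (@clamp R r) = r.
    by split; apply: val_clamp => //; [exact: le_trans r1|exact: le_trans sr].
  have := (abs_continuousP (cfun (chart_at (alpha (clamp t))) \o alpha) (clamp s) (clamp r)).1.
  rewrite vs vr; apply; apply: H => // q; rewrite vs vr => /andP[sq qr].
  have := He (val q) (lt_le_trans ts sq) (le_lt_trans qr rt).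
  by rewrite /= clamp_val.
split.
  have -> : alpha = (fun t : unit_interval R => (alpha \o @clamp R) (val t)).
    by apply/funext => t /=; rewrite clamp_val.
  exact: continuous_unit_val.
move=> c a b ac dc; apply/abs_continuousP.
(* The end points in [ac_curves] are not ordered, and the condition is vacuous if b < a. *)
case: (leP (val a) (val b)) => [ab|]; last exact: AC_empty.
apply: AC_local => // t tab.
have [a0 b1] : 0 <= val a /\ val b <= 1.
  by rewrite -(clamp_val a) -(clamp_val b); split; [exact: (clamp_itv _).1|exact: (clamp_itv _).2].
have t01 : 0 <= t <= 1.
  by move: tab => /andP[t1 t2]; rewrite (le_trans a0 t1) (le_trans t2 b1).
have vt : val (@clamp R t) = t by move: t01 => /andP[]; exact: val_clamp.
have ct : cdom c (idfun ((alpha \o @clamp R) t)) by apply: dc; rewrite vt.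
have [d d0 Hd] := AC_curve_map id_C2map (conj ca H) t01 ac ct.
exists d => // s r as_ sr rb; apply: Hd => //; first exact: le_trans as_.
exact: le_trans rb b1.
Qed.

End unit_interval_curves.

(** * Translations and logarithmic derivatives in a Lie group *)

Section slices.
Context {R : realType} {E1 E2 F : normedModType R}.

(** The derivative of the slice in direction v is the slice of the derivative of f in direction (0,
    v), so the induction on k goes through. Translations are slices of the multiplication. *)
Lemma Ck_slice_r k (W : set (E1 * E2)%type) (V : set E2) (a : E1) (f : (E1 * E2)%type -> F) :
  (forall u, V u -> W (a, u)) -> Ck k W f -> Ck k V (fun u => f (a, u)).
Proof.
move=> VW; elim: k f => [|k IH] f [cf H].
  split => // u Vu; apply: (@continuous_comp _ _ _ (fun u => (a, u)) f); last exact: cf _ (VW u Vu).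
  by apply: cvg_pair; [exact: cvg_cst|exact: cvg_id].
have [df cdf] := H.
have E u v : (fun h : R => h^-1 *: (((fun u => f (a, u)) \o shift u) (h *: v) - f (a, u))) =
    (fun h : R => h^-1 *: ((f \o shift (a, u)) (h *: (0, v)) - f (a, u))).
  apply/funext => h /=; congr (_ *: (f _ - _)).
  by congr (_, _); rewrite /= scaler0 add0r.
split; first by move=> u Vu; apply: (@continuous_comp _ _ _ (fun u => (a, u)) f);
  [apply: cvg_pair; [exact: cvg_cst|exact: cvg_id]|exact: cf _ (VW u Vu)].
split=> [u v Vu|v]; first by rewrite /derivable E; exact: df (VW u Vu).
have -> : 'D_v (fun u => f (a, u)) = (fun u => ('D_(0, v) f) (a, u)).
  by apply/funext => u; rewrite /derive E.
exact: (IH ('D_(0, v) f) (cdf (0, v))).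
Qed.

Lemma Ck_slice_l k (W : set (E1 * E2)%type) (V : set E1) (b : E2) (f : (E1 * E2)%type -> F) :
  (forall u, V u -> W (u, b)) -> Ck k W f -> Ck k V (fun u => f (u, b)).
Proof.
move=> VW; elim: k f => [|k IH] f [cf H].
  split => // u Vu; apply: (@continuous_comp _ _ _ (fun u => (u, b)) f); last exact: cf _ (VW u Vu).
  by apply: cvg_pair; [exact: cvg_id|exact: cvg_cst].
have [df cdf] := H.
have E u v : (fun h : R => h^-1 *: (((fun u => f (u, b)) \o shift u) (h *: v) - f (u, b))) =
    (fun h : R => h^-1 *: ((f \o shift (u, b)) (h *: (v, 0)) - f (u, b))).
  apply/funext => h /=; congr (_ *: (f _ - _)).
  by congr (_, _); rewrite /= scaler0 add0r.
split; first by move=> u Vu; apply: (@continuous_comp _ _ _ (fun u => (u, b)) f);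
  [apply: cvg_pair; [exact: cvg_id|exact: cvg_cst]|exact: cf _ (VW u Vu)].
split=> [u v Vu|v]; first by rewrite /derivable E; exact: df (VW u Vu).
have -> : 'D_v (fun u => f (u, b)) = (fun u => ('D_(v, 0) f) (u, b)).
  by apply/funext => u; rewrite /derive E.
exact: (IH ('D_(v, 0) f) (cdf (v, 0))).
Qed.

Lemma derive_slice_r (f : (E1 * E2)%type -> F) (a : E1) (u v : E2) :
  'D_v (fun u => f (a, u)) u = 'D_(0, v) f (a, u).
Proof.
rewrite /derive.
have -> : (fun h : R => h^-1 *: (((fun u => f (a, u)) \o shift u) (h *: v) - f (a, u))) =
    (fun h : R => h^-1 *: ((f \o shift (a, u)) (h *: (0, v)) - f (a, u))).
  apply/funext => h /=; congr (_ *: (f _ - _)).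
  by congr (_, _); rewrite /= scaler0 add0r.
by [].
Qed.

End slices.

Section translations.
Context {R : realType} {n : nat} {G : lieGroupType R n}.
Implicit Types (x y : G) (c d : chart 'rV[R]_n G).

Lemma left_C2map x : C2map (fun h : G => x * h)%g.
Proof.
split.
  move=> h; apply: (@continuous_comp _ _ _ (fun h : G => (x, h)) (fun p : G * G => (p.1 * p.2)%g)).
    by apply: cvg_pair; [exact: cvg_cst|exact: cvg_id].
  exact: mulg_continuous.
move=> c d ac ad; have [ax xx] := (atlas_chart_at x, mem_chart_at x).
have sm := @mulg_smooth R n G (chart_at x) c d ax ac ad 2%N.
have := Ck_slice_r (a := cfun (chart_at x) x)
  (V := cfun c @` (cdom c `&` (fun h : G => x * h)%g @^-1` cdom d)) _ sm.
rewrite (_ : (fun u => _) = cfun d \o (fun h : G => x * h)%g \o cinv c); last first.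
  by apply/funext => u /=; rewrite cfunK.
by apply => _ [h [ch dh] <-]; exists (x, h).
Qed.

Lemma right_C2map y : C2map (fun h : G => h * y)%g.
Proof.
split.
  move=> h; apply: (@continuous_comp _ _ _ (fun h : G => (h, y)) (fun p : G * G => (p.1 * p.2)%g)).
    by apply: cvg_pair; [exact: cvg_id|exact: cvg_cst].
  exact: mulg_continuous.
move=> c d ac ad; have [ay yy] := (atlas_chart_at y, mem_chart_at y).
have sm := @mulg_smooth R n G c (chart_at y) d ac ay ad 2%N.
have := Ck_slice_l (b := cfun (chart_at y) y)
  (V := cfun c @` (cdom c `&` (fun h : G => h * y)%g @^-1` cdom d)) _ sm.
rewrite (_ : (fun u => _) = cfun d \o (fun h : G => h * y)%g \o cinv c); last first.
  by apply/funext => u /=; rewrite cfunK.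
by apply => _ [h [ch dh] <-]; exists (h, y).
Qed.

Definition ltrans x : 'rV[R]_n -> 'rV[R]_n := mdiff (fun h : G => x * h)%g 1%g.

Definition ltrans_inv x : 'rV[R]_n -> 'rV[R]_n := mdiff (fun h : G => x^-1 * h)%g x.

Lemma ltransK x : cancel (ltrans x) (ltrans_inv x).
Proof.
move=> v.
have [_ H] := mdiff_comp (C2map_mdifferentiable 1%g (left_C2map x))
  (C2map_mdifferentiable (x * 1)%g (left_C2map x^-1%g)).
have E : (fun h : G => x^-1 * h)%g \o (fun h : G => x * h)%g = idfun.
  by apply/funext => h /=; rewrite mulKg.
have := congr1 (fun g => g v) H.
by rewrite E mdiff_id mulg1 => h; exact: esym h.
Qed.

Lemma ltrans_invK x : cancel (ltrans_inv x) (ltrans x).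
Proof.
move=> v.
have [_ H] := mdiff_comp (C2map_mdifferentiable x (left_C2map x^-1%g))
  (C2map_mdifferentiable (x^-1 * x)%g (left_C2map x)).
have E : (fun h : G => x * h)%g \o (fun h : G => x^-1 * h)%g = idfun.
  by apply/funext => h /=; rewrite mulVKg.
have := congr1 (fun g => g v) H.
by rewrite E mdiff_id mulVg => h; exact: esym h.
Qed.

(* The matrix of d(L_x)_1 in the chart c at x, as a function of the coordinates of x. *)
Definition ltrans_mx c (u : 'rV[R]_n) : 'M[R]_n :=
  \matrix_(i, j) 'D_(0, delta_mx 0 i : 'rV[R]_n)
    (cfun c \o (fun p : G * G => (p.1 * p.2)%g) \o cinv (prod_chart c (chart_at (1%g : G))))
    (u, cfun (chart_at (1%g : G)) 1%g) 0 j.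

(** The entries are first derivatives of the multiplication with the second factor fixed at 1. Since
    the multiplication is smooth, they are C^1 in the first factor. *)
Lemma ltrans_mx_lip c x i j : atlas c -> cdom c x ->
  lip_near (cfun c x) (fun u => ltrans_mx c u i j).
Proof.
move=> ac cx; have [a1 c1] := (atlas_chart_at (1%g : G), mem_chart_at (1%g : G)).
have sm := @mulg_smooth R n G c (chart_at 1%g) c ac a1 ac 2%N.
set psi := (cfun c \o _ \o _) in sm.
have sm1 : Ck 1 _ ('D_(0, delta_mx 0 i : 'rV[R]_n) psi) := sm.2.2 (0, delta_mx 0 i).
have img u : (cfun c @` cdom c) u -> (cfun (prod_chart c (chart_at (1%g : G))) @`
    (cdom (prod_chart c (chart_at (1%g : G))) `&` (fun p : G * G => (p.1 * p.2)%g) @^-1` cdom c))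
    (u, cfun (chart_at (1%g : G)) 1%g).
  by move=> [y cy <-]; exists (y, 1%g) => //; split; [split|rewrite /= mulg1].
have C1 := Ck_slice_l img sm1.
have [|r [L [r0 L0 H]]] := C1_lipschitz (cimg_open ac) C1 (u0 := cfun c x).
  by exists x.
exists r, L; split => // u v ur vr.
have h := le_trans (norm_mx_coordB_le _ _ 0 j) (H u v ur vr).2.
have E w : 'D_(0, delta_mx 0 i : 'rV[R]_n) psi (w, cfun (chart_at (1%g : G)) 1%g) 0 j =
  ltrans_mx c w i j by apply: esym; exact: mxE.
exact: (eq_ind _ (fun z => `|z| <= L * `|u - v|) h _ (f_equal2 (fun a b : R => a - b) (E u) (E v))).
Qed.

Lemma ltrans_mxE c x v : atlas c -> cdom c x ->
  v *m ltrans_mx c (cfun c x) = tcoord c x (ltrans x v).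
Proof.
move=> ac cx; have [a1 c1] := (atlas_chart_at (1%g : G), mem_chart_at (1%g : G)).
have cx1 : cdom c (x * 1)%g by rewrite mulg1.
have := rep_mdiff (left_C2map x) a1 ac c1 cx1.
have -> : tcoord (chart_at (1%g : G)) 1%g = id by exact: rep_id.
move=> /(congr1 (fun g => g v)); rewrite mulg1 => /= <-.
have df := C2map_diff (left_C2map x) a1 ac c1 cx1.
have E w : 'd (cfun c \o (fun h : G => (x * h)%g) \o cinv (chart_at (1%g : G)))
    (cfun (chart_at (1%g : G)) 1%g) w = 
  'D_(0, w) (cfun c \o (fun p : G * G => (p.1 * p.2)%g) \o cinv (prod_chart c (chart_at (1%g : G))))
    (cfun c x, cfun (chart_at (1%g : G)) 1%g).
  apply: (etrans (esym (deriveE w df))).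
  have F1 : cfun c \o (fun h : G => (x * h)%g) \o cinv (chart_at (1%g : G)) =
      (fun z => (cfun c \o (fun p : G * G => (p.1 * p.2)%g) \o
         cinv (prod_chart c (chart_at (1%g : G)))) (cfun c x, z)).
    by apply/funext => z; exact: (congr1 (fun y => cfun c (y * cinv (chart_at (1%g : G)) z)%g)
      (esym (cfunK ac cx))).
  rewrite F1; exact: derive_slice_r.
rewrite [v in RHS]row_sum_delta linear_sum; apply/rowP => j; rewrite mxE summxE.
apply: eq_bigr => i _; rewrite linearZ/= E [in RHS]mxE; congr (_ * _).
by rewrite mxE.
Qed.

Lemma ltrans_mx_unit c x : atlas c -> cdom c x -> ltrans_mx c (cfun c x) \in unitmx.
Proof.
move=> ac cx; rewrite -row_free_unit -kermx_eq0; apply/rowV0P => v /sub_kermxP.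
rewrite (ltrans_mxE _ ac cx) => h.
have h1 : ltrans x v = 0.
  apply: (etrans (esym (tcoordK ac cx (ltrans x v)))).
  apply: (etrans (congr1 (tcoord_inv c x) h)); exact: linear0.
apply: (etrans (esym (ltransK x v))).
apply: (etrans (congr1 (ltrans_inv x) h1)); exact: linear0.
Qed.

(* The logarithmic derivative alpha^-1 alpha'. *)
Definition mc (alpha : R -> G) (t : R) : 'rV[R]_n := ltrans_inv (alpha t) (vel alpha t).

Lemma mc_chart (alpha : R -> G) c t : atlas c -> cdom c (alpha t) ->
  {for t, continuous alpha} -> curve_derivable alpha t ->
  derive1 (cfun c \o alpha) t = mc alpha t *m ltrans_mx c (cfun c (alpha t)).
Proof.
move=> ac ca cont da; rewrite ltrans_mxE// ltrans_invK.
by have [_ ->] := (derivable_chart ac ca cont).1 da.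
Qed.

Lemma mc_left (alpha : R -> G) x t : {for t, continuous alpha} ->
  curve_derivable alpha t -> mc (fun s => x * alpha s)%g t = mc alpha t.
Proof.
move=> cont da; have [_ H] := vel_map (left_C2map x) cont da.
rewrite /mc; have -> : vel (fun s => x * alpha s)%g t = mdiff (fun h : G => x * h)%g (alpha t) (vel alpha t) := H.
rewrite /ltrans_inv.
have [_ K] := mdiff_comp (C2map_mdifferentiable (alpha t) (left_C2map x))
  (C2map_mdifferentiable (x * alpha t)%g (left_C2map (x * alpha t)^-1%g)).
have E : (fun h : G => (x * alpha t)^-1 * h)%g \o (fun h : G => x * h)%g = (fun h => (alpha t)^-1 * h)%g.
  by apply/funext => h /=; rewrite invgM -mulgA mulKg.
by have := congr1 (fun g => g (vel alpha t)) K; rewrite E => h; exact: esym h.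
Qed.

End translations.

Section curves_of_ode.
Context {R : realType} {n : nat} {M : manifoldType R n}.
Notation mu := (@lebesgue_measure R).

(** The equation is solved in coordinates. As the solution of [ode_exists] stays in a ball for all
    times, the radius can be chosen inside the image of the chart, and [beta] never leaves the
    domain of c. *)
Lemma ode_curve {d : nat} (c : chart 'rV[R]_n M) (x0 : M) (A : 'rV[R]_n -> 'M[R]_(d, n))
    (p : R -> 'rV[R]_d) (t0 rho : R) :
  atlas c -> cdom c x0 -> row_integrable p ->
  (forall i j, lip_near (cfun c x0) (fun u => A u i j)) -> 0 < rho ->
  exists h beta, [/\ 0 < h, beta t0 = x0,
    (forall t, cdom c (beta t) /\ `|cfun c (beta t) - cfun c x0| < rho),
    AC_curve (t0 - h) (t0 + h) beta & 
    primitive (t0 - h) (t0 + h) (cfun c \o beta) (fun t => p t *m A (cfun c (beta t)))].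
Proof.
move=> ac cx ip lA rho0.
have [r r0 Hr] : exists2 r, 0 < r & forall u, `|u - cfun c x0| < r -> (cfun c @` cdom c) u.
  by apply: open_ballP; [exact: cimg_open|exists x0].
have [|h [u [h0 ut0 cu ub pu]]] := ode_exists ip lA t0 (rho := Num.min r rho).
  by rewrite lt_min r0.
have ur t : `|u t - cfun c x0| < r by have := ub t; rewrite lt_min => /andP[].
have urho t : `|u t - cfun c x0| < rho by have := ub t; rewrite lt_min => /andP[].
pose beta t := cinv c (u t).
have cb t : cdom c (beta t) := (cinvP ac (Hr _ (ur t))).1.
have cbu t : cfun c (beta t) = u t := (cinvP ac (Hr _ (ur t))).2.
have cbuE : cfun c \o beta = u by apply/funext => t; exact: cbu.
exists h, beta; split => //.
- by rewrite /beta ut0 cfunK.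
- by move=> t; split; [exact: cb|rewrite cbu; exact: urho].
- split.
    move=> t; apply: (@continuous_comp _ _ _ u (cinv c)); first exact: cu.
    by rewrite -cbu; exact: cinv_continuous.
  move=> t _; exists c, 1; split; [exact: ac|exact: cb|exact: ltr01|].
  move=> s q hs sq qh _ _; rewrite cbuE; apply: (AC_sub hs qh).
  exact: primitive_AC pu.
- by rewrite cbuE; under eq_fun do rewrite cbu.
Qed.

Lemma AC_curve_sub (alpha : R -> M) (a b a' b' : R) : a <= a' -> b' <= b ->
  AC_curve a b alpha -> AC_curve a' b' alpha.
Proof.
move=> aa bb [ca H]; split=> // t /andP[t1 t2].
have [|c [de [ac ct de0 Hd]]] := H t; first by rewrite (le_trans aa t1) (le_trans t2 bb).
exists c, de; split => // s r as_ sr rb; apply: Hd => //.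
  exact: le_trans as_.
exact: le_trans rb bb.
Qed.

(** The property propagated over intervals is the implication from agreement at the left end to
    agreement throughout. Around a time where the curves differ the Hausdorff property makes its
    premise false; around a time where they agree both solve one equation in a common chart. This is
    why an equation is required only at times of agreement. *)
Lemma curves_agree (alpha beta : R -> M) (a b : R) : a <= b ->
  AC_curve a b alpha -> AC_curve a b beta ->
  (forall t0, a <= t0 <= b -> alpha t0 = beta t0 ->
     exists c d (A : 'rV[R]_n -> 'M[R]_(d, n)) p delta,
       [/\ atlas c /\ cdom c (alpha t0), 0 < delta, row_integrable p,
           (forall i j, lip_near (cfun c (alpha t0)) (fun u => A u i j)) &
           forall gamma, gamma = alpha \/ gamma = beta ->
             {ae mu, forall t, a < t < b -> t0 - delta < t < t0 + delta ->
                derivable (cfun c \o gamma) t 1 ->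
                derive1 (cfun c \o gamma) t = p t *m A (cfun c (gamma t))}]) ->
  alpha a = beta a -> forall t, a <= t -> t <= b -> alpha t = beta t.
Proof.
move=> ab acA acB H ab0.
pose P s r := alpha s = beta s -> forall t, s <= t -> t <= r -> alpha t = beta t.
suff : P a b by apply.
apply: (@cousin_ind R a b P ab) => [t0 t0ab|s r t as_ sr rt tb Psr Prt e x sx xt]; last first.
  case: (leP x r) => [xr|/ltW rx]; first exact: Psr.
  by apply: Prt => //; apply: Psr.
have [E0|N0] := pselect (alpha t0 = beta t0); last first.
  have [A [B [nA nB AB]]] : exists A B, [/\ nbhs (alpha t0) A, nbhs (beta t0) B & A `&` B = set0].
    apply: contrapT => H0; apply: N0; apply: manifold_hausdorff => A B nA nB.
    by apply/set0P/eqP => AB0; apply: H0; exists A, B.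
  have [e1 e10 h1] := near_ball (acA.1 t0 A nA).
  have [e2 e20 h2] := near_ball (acB.1 t0 B nB).
  exists (Num.min e1 e2); first by rewrite lt_min e10.
  move=> s r as_ sr rb; set e := Num.min _ _ => es er asb; exfalso.
  have [l1 l2] : e <= e1 /\ e <= e2 by rewrite /e !ge_min !lexx orbT.
  have [w1 w2] := window_widen es er l1 (lexx s) sr; have [w3 w4] := window_widen es er l2 (lexx s) sr.
  have As : A (alpha s) := h1 s w1 w2; have Bs : B (beta s) := h2 s w3 w4.
  by have : (A `&` B) (alpha s) by [split => //; rewrite asb]; rewrite AB.
have [c [d [A [p [delta [[ac cx] delta0 ip lA ode]]]]]] := H t0 t0ab E0.
have [h [rho [h0 rho0 uniq]]] := ode_unique ip lA t0.
have near_chart gamma : AC_curve a b gamma -> gamma t0 = alpha t0 ->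
   exists2 e, 0 < e & (forall s, t0 - e < s -> s < t0 + e ->
      cdom c (gamma s) /\ `|cfun c (gamma s) - cfun c (alpha t0)| < rho) /\
     forall s r, a <= s -> s <= r -> r <= b -> t0 - e < s -> r < t0 + e ->
      AC s r (cfun c \o gamma).
  move=> acG gt0; have cg : cdom c (idfun (gamma t0)) by rewrite /= gt0.
  have [e1 e10 He1] := AC_curve_map id_C2map acG t0ab ac cg.
  have n1 : \forall s \near t0, cdom c (gamma s) by exact: (acG.1 t0 _ (cdom_nbhs ac cg)).
  have n2 : \forall s \near t0, `|cfun c (gamma s) - cfun c (alpha t0)| < rho.
    have hc : {for t0, continuous (cfun c \o gamma)}.
      exact: (continuous_comp (acG.1 t0) (cfun_continuous ac cg)).
    have /cvgrPdist_lt/(_ rho rho0) h' := hc.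
    rewrite -gt0.
    by apply: filterS h' => s hs; exact: (eq_ind _ (fun z => z < rho) hs _ (distrC _ _)).
  have [e2 e20 h2] := near_ball n1; have [e3 e30 h3] := near_ball n2.
  exists (Num.min e1 (Num.min e2 e3)); first by rewrite !lt_min e10 e20.
  set e := Num.min _ _.
  have [l1 l2 l3] : [/\ e <= e1, e <= e2 & e <= e3] by rewrite /e !ge_min !lexx !orbT.
  split=> [s s1 s2|s r as_ sr rb s1 s2].
    have [w1 w2] := window_widen s1 s2 l2 (lexx s) (lexx s).
    have [w3 w4] := window_widen s1 s2 l3 (lexx s) (lexx s).
    by split; [exact: h2|exact: h3].
  have [w1 _] := window_widen s1 s2 l1 (lexx s) sr; have [_ w2] := window_widen s1 s2 l1 sr (lexx r).
  exact: He1.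
have [e1 e10 [near1 AC1]] := near_chart alpha acA erefl.
have [e2 e20 [near2 AC2]] := near_chart beta acB (esym E0).
exists (Num.min (Num.min h delta) (Num.min e1 e2)); first by rewrite !lt_min h0 delta0 e10.
move=> s r as_ sr rb; set e := Num.min _ _ => es er asb x sx xr.
have [l1 l2 l3 l4] : [/\ e <= h, e <= delta, e <= e1 & e <= e2] by rewrite /e !ge_min !lexx !orbT.
have win e' y (le : e <= e') := @window_widen R t0 e e' s r y es er le.
have [s_e1 _] := win _ s l3 (lexx _) sr; have [_ r_e1] := win _ r l3 sr (lexx _).
have [s_e2 _] := win _ s l4 (lexx _) sr; have [_ r_e2] := win _ r l4 sr (lexx _).
have [s_h _] := win _ s l1 (lexx _) sr; have [_ r_h] := win _ r l1 sr (lexx _).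
have sol gamma : gamma = alpha \/ gamma = beta -> ode_sol A p s r (cfun c \o gamma).
  move=> /ode; apply: lebesgue_aeS => y Hy /andP[sy yr]; apply: Hy.
    by rewrite (le_lt_trans as_ sy) (lt_le_trans yr rb).
  by have [-> ->] := win _ y l2 (ltW sy) (ltW yr).
have E := uniq s r (cfun c \o alpha) (cfun c \o beta) (ltW s_h) sr (ltW r_h)
  (AC1 s r as_ sr rb s_e1 r_e1) (AC2 s r as_ sr rb s_e2 r_e2)
  (sol _ (or_introl erefl)) (sol _ (or_intror erefl)).
have inw y : s <= y -> y <= r -> (cdom c (alpha y) /\ `|cfun c (alpha y) - cfun c (alpha t0)| < rho) /\
    (cdom c (beta y) /\ `|cfun c (beta y) - cfun c (alpha t0)| < rho).
  move=> sy yr; have [w1 w2] := win _ y l3 sy yr; have [w3 w4] := win _ y l4 sy yr.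
  by split; [exact: near1|exact: near2].
have Ex : cfun c (alpha x) = cfun c (beta x).
  apply: E => //; last by rewrite /= asb.
  by move=> y sy yr; have [[_ ?] [_ ?]] := inw y sy yr.
have [[cax _] [cbx _]] := inw x sx xr.
by rewrite -(cfunK ac cax) Ex cfunK.
Qed.

End curves_of_ode.

(** * Concatenation of curves and solutions on the whole interval *)

Section concatenation.
Context {R : realType} {n : nat} {M : manifoldType R n}.
Implicit Types (alpha beta : R -> M).

Definition join (r : R) alpha beta (t : R) : M := if t <= r then alpha t else beta t.

Lemma join_left r alpha beta t : t <= r -> join r alpha beta t = alpha t.
Proof. by rewrite /join => ->. Qed.

Lemma join_right r alpha beta t : alpha r = beta r -> r <= t -> join r alpha beta t = beta t.
Proof.
rewrite /join => ab rt; case: (leP t r) => // tr.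
by rewrite (le_anti (introT andP (conj tr rt))).
Qed.

Lemma join_near_left r alpha beta t : t < r -> \forall s \near t, alpha s = join r alpha beta s.
Proof. by move=> tr; apply: filterS (lt_nbhsl tr) => s /ltW sr; rewrite join_left. Qed.

Lemma join_near_right r alpha beta t : alpha r = beta r -> r < t ->
  \forall s \near t, beta s = join r alpha beta s.
Proof. by move=> ab tr; apply: filterS (lt_nbhsr tr) => s /ltW sr; rewrite join_right. Qed.

Lemma join_continuous r alpha beta : continuous alpha -> continuous beta ->
  alpha r = beta r -> continuous (join r alpha beta).
Proof.
move=> ca cb ab t.
have [tr|rt|->] := ltgtP t r.
- have E := join_near_left alpha beta tr.
  move=> U; rewrite /= (join_left _ _ (ltW tr)) => /(ca t) HU.
  by apply: filterS2 E HU => s Es Us; exact: (eq_ind _ U Us _ Es).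
- have E := join_near_right ab rt.
  move=> U; rewrite /= (join_right ab (ltW rt)) => /(cb t) HU.
  by apply: filterS2 E HU => s Es Us; exact: (eq_ind _ U Us _ Es).
move=> U; rewrite /= (join_left _ _ (lexx r)) => HU.
have HU' := HU; rewrite ab in HU'.
have H1 : \forall s \near r, U (alpha s) := ca r U HU.
have H2 : \forall s \near r, U (beta s) := cb r U HU'.
suff H3 : \forall s \near r, U (join r alpha beta s) by exact: H3.
by apply: filterS2 H1 H2 => s h1 h2; rewrite /join; case: ifP.
Qed.

Lemma AC_curve_join alpha beta s r t : s <= r -> r <= t ->
  AC_curve s r alpha -> AC_curve r t beta -> alpha r = beta r ->
  AC_curve s t (join r alpha beta).
Proof.
move=> sr rt acA acB ab; split; first exact: join_continuous acA.1 acB.1 ab.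
move=> q /andP[sq qt].
have Ja x : x <= r -> join r alpha beta x = alpha x by exact: join_left.
have Jb x : r <= x -> join r alpha beta x = beta x by exact: join_right.
have [qr|rq|qr] := ltgtP q r.
- have [|c [de [ac cq de0 H]]] := acA.2 q; first by rewrite sq ltW.
  exists c, (Num.min de (r - q)); split => //; first by rewrite Ja// ltW.
    by rewrite lt_min de0 subr_gt0.
  move=> x y sx xy yt; set e := Num.min _ _ => ex ey.
  have [l1 l2] : e <= de /\ e <= r - q by rewrite /e !ge_min !lexx orbT.
  have [w1 _] := window_widen ex ey l1 (lexx x) xy.
  have [_ w2] := window_widen ex ey l1 xy (lexx y).
  have [_ w3] := window_widen ex ey l2 xy (lexx y).
  have yr : y <= r by rewrite addrC subrK in w3; exact: ltW.
  apply: eq_AC (H x y sx xy yr w1 w2) => z _ zy.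
  by rewrite /= Ja// (le_trans zy yr).
- have [|c [de [ac cq de0 H]]] := acB.2 q; first by rewrite qt ltW.
  exists c, (Num.min de (q - r)); split => //; first by rewrite Jb// ltW.
    by rewrite lt_min de0 subr_gt0.
  move=> x y sx xy yt; set e := Num.min _ _ => ex ey.
  have [l1 l2] : e <= de /\ e <= q - r by rewrite /e !ge_min !lexx orbT.
  have [w1 _] := window_widen ex ey l1 (lexx x) xy.
  have [_ w2] := window_widen ex ey l1 xy (lexx y).
  have [w3 _] := window_widen ex ey l2 (lexx x) xy.
  have rx : r <= x by rewrite subKr in w3; exact: ltW.
  apply: eq_AC (H x y rx xy yt w1 w2) => z xz _.
  by rewrite /= Jb// (le_trans rx xz).
rewrite {q}qr in sq qt *.
have [aa at_] := (atlas_chart_at (alpha r), mem_chart_at (alpha r)).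
have bt : cdom (chart_at (alpha r)) (idfun (beta r)) by rewrite -ab.
have rsr : s <= r <= r by rewrite sr lexx.
have rrt : r <= r <= t by rewrite rt lexx.
have [e1 e10 H1] := AC_curve_map id_C2map acA rsr aa at_.
have [e2 e20 H2] := AC_curve_map id_C2map acB rrt aa bt.
exists (chart_at (alpha r)), (Num.min e1 e2); split => //; first by rewrite Ja.
  by rewrite lt_min e10.
move=> x y sx xy yt; set e := Num.min _ _ => ex ey.
have [l1 l2] : e <= e1 /\ e <= e2 by rewrite /e !ge_min !lexx orbT.
have [w1 _] := window_widen ex ey l1 (lexx x) xy.
have [_ w2] := window_widen ex ey l1 xy (lexx y).
have [w3 _] := window_widen ex ey l2 (lexx x) xy.
have [_ w4] := window_widen ex ey l2 xy (lexx y).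
have A1 u v : x <= u -> u <= v -> v <= r -> v <= y -> AC u v (cfun (chart_at (alpha r)) \o join r alpha beta).
  move=> xu uv vr vy; have w1' := lt_le_trans w1 xu; have w2' := le_lt_trans vy w2.
  apply: eq_AC (H1 u v (le_trans sx xu) uv vr w1' w2') => z _ zv.
  by rewrite /= Ja// (le_trans zv vr).
have A2 u v : r <= u -> x <= u -> u <= v -> v <= y -> AC u v (cfun (chart_at (alpha r)) \o join r alpha beta).
  move=> ru xu uv vy; have w1' := lt_le_trans w3 xu; have w2' := le_lt_trans vy w4.
  apply: eq_AC (H2 u v ru uv (le_trans vy yt) w1' w2') => z uz _.
  by rewrite /= Jb// (le_trans ru uz).
have [yr|/ltW ry] := leP y r; first exact: A1.
have [rx|/ltW xr] := leP r x; first exact: A2.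
by apply: (@AC_cat _ _ x r y) => //; [exact: A1|exact: A2].
Qed.

End concatenation.

Section mc_solutions.
Context {R : realType} {n : nat} {G : lieGroupType R n}.
Notation mu := (@lebesgue_measure R).
Implicit Types (alpha beta : R -> G).

Lemma near_eq_mc alpha beta q : (\forall s \near q, alpha s = beta s) ->
  mc alpha q = mc beta q.
Proof.
move=> ab; have E : alpha q = beta q := nbhs_singleton ab.
rewrite /mc /vel E; congr (ltrans_inv _ _).
rewrite !derive1E; apply: near_eq_derive.
by apply: filterS ab => s /= ->.
Qed.

(** T constrains the logarithmic derivative and [Fib] the position. Integration of p takes T to be
    equality with p; horizontal lifting takes T to be orthogonality to the Lie algebra of K and
    [Fib] to be the fibre over the curve. *)
Definition mc_sol (T : R -> 'rV[R]_n -> Prop) (Fib : R -> G -> Prop) (s r : R) alpha :=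
  [/\ AC_curve s r alpha, (forall q, s <= q -> q <= r -> Fib q (alpha q)) &
      {ae mu, forall q, s < q < r -> T q (mc alpha q)}].

(** The window d is chosen before the starting point x, so solutions can be continued from wherever
    they arrive and do not stop before b. *)
Lemma mc_sol_global (T : R -> 'rV[R]_n -> Prop) (Fib : R -> G -> Prop) (a b : R) :
  a <= b ->
  (forall t0, a <= t0 <= b -> exists2 d, 0 < d &
    forall s r, a <= s -> s <= r -> r <= b -> t0 - d < s -> r < t0 + d ->
    forall x, Fib s x -> exists2 alpha, mc_sol T Fib s r alpha & alpha s = x) ->
  forall x, Fib a x -> exists2 alpha, mc_sol T Fib a b alpha & alpha a = x.
Proof.
move=> ab loc.
apply: (@cousin_ind R a b (fun s r => forall x, Fib s x ->
  exists2 alpha, mc_sol T Fib s r alpha & alpha s = x) ab loc).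
move=> s r t as_ sr rt tb Hsr Hrt x Fx.
have [alpha [acA FA TA] ax] := Hsr x Fx.
have [beta [acB FB TB] bx] := Hrt _ (FA r sr (lexx r)).
have ab' : alpha r = beta r by [].
exists (join r alpha beta); last by rewrite join_left.
split; first exact: AC_curve_join.
  move=> q sq qt; have [qr|/ltW rq] := leP q r.
    by rewrite join_left//; exact: FA.
  by rewrite join_right//; exact: FB.
apply: (@lebesgue_ae_cat _ _ s r t).
  apply: lebesgue_aeS TA => q H /andP[sq qr].
  by rewrite -(near_eq_mc (join_near_left alpha beta qr)); apply: H; rewrite sq.
apply: lebesgue_aeS TB => q H /andP[rq qt].
by rewrite -(near_eq_mc (join_near_right ab' rq)); apply: H; rewrite rq.
Qed.

(* The inverse of Q: integration of an integrable curve in the Lie algebra. *)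
Lemma mc_exists (p : R -> 'rV[R]_n) (x : G) : row_integrable p ->
  exists alpha, [/\ AC_curve 0 1 alpha, alpha 0 = x &
    {ae mu, forall t, 0 < t < 1 -> mc alpha t = p t}].
Proof.
move=> ip; pose T q v := v = p q; pose Fib (q : R) (y : G) := True.
have [t0 t001|alpha [acA _ TA] ax] := @mc_sol_global T Fib 0 1 ler01 _ x I; last by exists alpha.
have [a1 c1] := (atlas_chart_at (1%g : G), mem_chart_at (1%g : G)).
have [|h [beta [h0 bt0 cb acB pB]]] := ode_curve t0 a1 c1 ip
    (fun i j => ltrans_mx_lip i j a1 c1) (rho := 1); first exact: ltr01.
exists h => // s r s0 sr r1 hs rh y _.
(* A left translate has the same logarithmic derivative, so the one solution starting at 1 serves
   every starting point y on the same window. *)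
exists (fun t => (y * (beta s)^-1) * beta t)%g; last by rewrite mulgVK.
have acB' : AC_curve s r beta by exact: AC_curve_sub (ltW hs) (ltW rh) acB.
split; [exact: AC_curve_comp (left_C2map _) acB'|by []|].
have bae : {ae mu, forall t, s < t < r -> derivable (cfun (chart_at (1%g : G)) \o beta) t 1 /\
    derive1 (cfun (chart_at (1%g : G)) \o beta) t = p t *m ltrans_mx (chart_at (1%g : G)) (cfun (chart_at (1%g : G)) (beta t))}.
  have base := primitive_ae_derivable pB.
  apply: lebesgue_aeS base => t Ht /andP[st tr]; apply: Ht.
  by rewrite (lt_trans hs st) (lt_trans tr rh).
apply: lebesgue_aeS bae => q H sqr.
have [d1 d2] := H sqr; have cq := (cb q).1; have contq := acB.1 q.
have dq : curve_derivable beta q := (derivable_chart a1 cq contq).2 d1.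
rewrite /T mc_left//.
have := mc_chart a1 cq contq dq; rewrite d2.
by move/(can_inj (mulmxK (ltrans_mx_unit a1 cq))).
Qed.

Lemma mc_unique (p : R -> 'rV[R]_n) alpha beta : row_integrable p ->
  AC_curve 0 1 alpha -> AC_curve 0 1 beta ->
  {ae mu, forall t, 0 < t < 1 -> mc alpha t = p t} ->
  {ae mu, forall t, 0 < t < 1 -> mc beta t = p t} ->
  alpha 0 = beta 0 -> forall t, 0 <= t -> t <= 1 -> alpha t = beta t.
Proof.
move=> ip acA acB pA pB; apply: curves_agree => // t0 t001 E0.
have [ac cx] := (atlas_chart_at (alpha t0), mem_chart_at (alpha t0)).
have [e1 e10 h1] := near_ball (acA.1 t0 _ (cdom_nbhs ac cx)).
have cx' := cx; rewrite [X in cdom _ X]E0 in cx'.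
have [e2 e20 h2] := near_ball (acB.1 t0 _ (cdom_nbhs ac cx')).
exists (chart_at (alpha t0)), n, (ltrans_mx (chart_at (alpha t0))), p, (Num.min e1 e2).
split => //; [by rewrite lt_min e10|by move=> i j; exact: ltrans_mx_lip|].
set e := Num.min _ _.
have [l1 l2] : e <= e1 /\ e <= e2 by rewrite /e !ge_min !lexx orbT.
have key gamma : AC_curve 0 1 gamma -> {ae mu, forall t, 0 < t < 1 -> mc gamma t = p t} ->
    (forall t, t0 - e < t -> t < t0 + e -> cdom (chart_at (alpha t0)) (gamma t)) ->
    {ae mu, forall t, 0 < t < 1 -> t0 - e < t < t0 + e ->
                derivable (cfun (chart_at (alpha t0)) \o gamma) t 1 ->
                derive1 (cfun (chart_at (alpha t0)) \o gamma) t =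
                p t *m ltrans_mx (chart_at (alpha t0)) (cfun (chart_at (alpha t0)) (gamma t))}.
  move=> acG pG cG; apply: lebesgue_aeS pG => t H t01 /andP[te et] d1.
  have ct := cG t te et; have dq := (derivable_chart ac ct (acG.1 t)).2 d1.
  by rewrite (mc_chart ac ct (acG.1 t) dq) H.
move=> gamma [->|->]; apply: key => // t te et.
  by have [w1 w2] := window_widen te et l1 (lexx t) (lexx t); exact: h1.
by have [w1 w2] := window_widen te et l2 (lexx t) (lexx t); exact: h2.
Qed.

End mc_solutions.

(** * Horizontal lifts *)

Lemma norm_mulmx_le {R : realType} {m n : nat} (v : 'rV[R]_m) (B : 'M[R]_(m, n)) :
  `|v *m B| <= `|v| * \sum_i \sum_j `|B i j|.
Proof.
apply: norm_mx_le => [|i j].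
  by rewrite mulr_ge0// sumr_ge0// => i _; exact: sumr_ge0.
rewrite mxE mulr_sumr; apply: le_trans (ler_norm_sum _ _ _) _.
apply: ler_sum => l _; rewrite normrM; apply: ler_pM => //.
  exact: norm_mx_coord_le.
by rewrite (bigD1 j)//= lerDl sumr_ge0.
Qed.

(** Almost everywhere differentiability says nothing about a prescribed time; continuity of the
    integrand at t does. *)
Lemma primitive_derivable_at {R : realType} {n : nat} (a b t : R)
    (f h : R -> 'rV[R]_n) : primitive a b f h -> a < t -> t < b ->
  {for t, continuous h} -> derivable f t 1 /\ derive1 f t = h t.
Proof.
move=> [ih H] at_ tb ch.
have D i : is_derive t (1 : R) (fun x => f x 0 i) (h t 0 i).
  have chi : {for t, continuous (fun x => h x 0 i)}.
    exact: (@continuous_comp _ _ _ h (fun v : 'rV[R]_n => v 0 i) t ch (@coord_continuous _ _ _ 0 i _)).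
  have [d1 d2] := continuous_FTC1_closed tb (row_integrable_sub i a b ih) at_ chi.
  have fE : \forall t \near t, f a 0 i + \int[@lebesgue_measure R]_(x in `[a, t]) h x 0 i = f t 0 i.
    near=> x; rewrite [in RHS]H ?mxE//; apply/ltW.
      by near: x; exact: lt_nbhsr.
    by near: x; exact: lt_nbhsl.
  apply: (near_eq_is_derive fE).
  rewrite -[h t 0 i]add0r -d2 derive1E; apply: is_deriveD.
  exact: derivableP.
have df : derivable f t 1.
  by apply/derivable_mxP => i j; rewrite (ord1 i); exact: (ex_derive (is_derive := D j)).
split => //; rewrite derive1E derive_mx//; apply/rowP => i.
by rewrite mxE; exact: (derive_val (is_derive := D i)).
Unshelve. all: by end_near. Qed.

(** Letting eps tend to 0. The two upper bounds on eps are those under which error terms are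
    absorbed in [subgroup_tangent]. *)
Lemma le0_of_estimate {R : realType} (L B a : R) : 0 <= L -> 0 <= B ->
  (forall eps, 0 < eps -> L * eps <= 2^-1 -> eps <= 1 -> a <= eps * B) -> a <= 0.
Proof.
move=> L0 B0 estimate; apply/ler_addgt0Pr => x x0; rewrite add0r.
have L1 : 0 < 2 * (L + 1) by lra.
have B1 : 0 < B + 1 by lra.
pose eps := Num.min 1 (Num.min (1 / (2 * (L + 1))) (x / (B + 1))).
have e0 : 0 < eps by rewrite !lt_min ltr01 !divr_gt0.
have [l1 l2 l3] : [/\ eps <= 1, eps <= 1 / (2 * (L + 1)) & eps <= x / (B + 1)].
  by rewrite /eps !ge_min !lexx !orbT.
move: eps e0 l1 l2 l3 => eps e0 l1; rewrite !ler_pdivlMr// => l2 l3.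
apply: le_trans (estimate eps e0 _ l1) _; last by lra.
have : eps * (2 * (L + 1)) = 2 * (L * eps) + 2 * eps by ring.
lra.
Qed.

(** * Tangent vectors to K and the kernel of d(proj) *)

Section subgroup_tangent.
Context {R : realType} {n k : nat} {G : lieGroupType R n} {K : lieGroupType R k}.
Variable (iota : K -> G).
Hypotheses (sub : lie_subgroup iota) (compactK : compact [set: K]).

Lemma iota1 : iota 1%g = 1%g.
Proof. by case: sub => _ iM _; apply: (mulgI (iota 1%g)); rewrite -iM !mulg1. Qed.

Lemma iotaV y : iota (y^-1)%g = ((iota y)^-1)%g.
Proof. by case: sub => _ iM _; apply: (mulgI (iota y)); rewrite -iM !mulgV iota1. Qed.

Lemma iota_C2map : C2map iota.
Proof. by case: sub => _ _ [sm _]; exact: smooth_C2map. Qed.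

(* Compactness makes iota a homeomorphism onto its image. *)
Lemma iota_open (U : set K) : nbhs (1%g : K) U -> \forall x \near (1%g : G),
  forall y, x = iota y -> U y.
Proof.
rewrite nbhsE => -[V [oV V1] VU].
have cC : compact (~` V) by apply: (subclosed_compact _ compactK) => //; rewrite closedC.
have cI : compact (iota @` ~` V).
  apply: continuous_compact cC; apply: continuous_subspaceT => x.
  exact: iota_C2map.1.
have clI : closed (iota @` ~` V) by exact: compact_closed manifold_hausdorff cI.
have : nbhs (1%g : G) (~` (iota @` ~` V)).
  apply: open_nbhs_nbhs; split; first by rewrite openC.
  move=> [y Vy]; rewrite -iota1 => iy; apply: Vy.
  by case: sub => inj _ _; rewrite (inj _ _ iy).
apply: filterS => x nx y xy; apply: VU; apply: contrapT => Vy; apply: nx.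
by exists y.
Qed.

Let D := mdiff iota 1%g.
Let kmx : 'M[R]_(k, n) := lin1_mx D.
Let kmxE v : v *m kmx = D v. Proof. exact: mul_rV_lin1. Qed.

(* The lift of z to K is not known to be differentiable: z is compared with the
   linearization of iota at 1. *)
Lemma subgroup_tangent (z : R -> G) : z 0 = 1%g -> {for 0, continuous z} ->
  curve_derivable z 0 -> (\forall t \near (0 : R), exists y, z t = iota y) ->
  exists v, vel z 0 = mdiff iota 1%g v.
Proof.
move=> z0 cz dz zK.
have injD : injective D.
  by case: sub => _ _ im; exact: (im.2 1%g).
have [Lm kL] : exists Lm : 'M[R]_(n, k), kmx *m Lm = 1%:M.
  apply/row_freeP; rewrite -kermx_eq0; apply/rowV0P => v /sub_kermxP.
  by rewrite kmxE => Dv; apply: injD; rewrite Dv; apply: esym; exact: linear0.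
pose c := chart_at (1%g : G); pose b := chart_at (1%g : K).
pose f := cfun c \o iota \o cinv b.
pose e := cfun b 1%g.
have [ac c1] : atlas c /\ cdom c 1%g by split; [exact: atlas_chart_at|exact: mem_chart_at].
have [ab b1] : atlas b /\ cdom b 1%g by split; [exact: atlas_chart_at|exact: mem_chart_at].
have ci1 : cdom c (iota 1%g) by rewrite iota1.
have df : differentiable f e := C2map_diff iota_C2map ab ac b1 ci1.
have DE : 'd f e = D :> (_ -> _) by rewrite /D /mdiff iota1.
set w := vel z 0.
have dw : derivable (cfun c \o z) 0 1 /\ derive1 (cfun c \o z) 0 = w.
  exact: (eq_ind (z 0) (fun x => derivable (cfun (chart_at x) \o z) 0 1 /\
    derive1 (cfun (chart_at x) \o z) 0 = w) (conj dz erefl) 1%g z0).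
(* [Pi] vanishes exactly on the image of D: if w Pi = 0 then w = (w Lm) kmx. The goal becomes w Pi =
   0, which is estimated by difference quotients. *)
pose Pi : 'M[R]_n := 1%:M - Lm *m kmx.
pose CL := \sum_i \sum_j `|Lm i j|; pose CP := \sum_i \sum_j `|Pi i j|.
have CL0 : 0 <= CL by apply: sumr_ge0 => i _; exact: sumr_ge0.
have CP0 : 0 <= CP by apply: sumr_ge0 => i _; exact: sumr_ge0.
have kPi : kmx *m Pi = 0 by rewrite mulmxBr mulmx1 mulmxA kL mul1mx subrr.
have estimate eps : 0 < eps -> CL * eps <= 2^-1 -> eps <= 1 ->
    `|w *m Pi| <= eps * (CP + 2 * (CL * (`|w| + 1)) * CP).
  move=> eps0 epsL eps1.
  have /eqaddoP/(_ eps eps0) oE := diff_locally df.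
  have /nbhs_ballP[de /= de0 Hde] := oE.
  have nU : nbhs (1%g : K) [set y | cdom b y /\ `|cfun b y - e| < de].
    apply: filterI; first exact: cdom_nbhs.
    have /cvgrPdist_lt/(_ de de0) h' : {for 1%g, continuous (cfun b)} by exact: cfun_continuous.
    by apply: filterS h' => y hy; exact: (eq_ind _ (fun z => z < de) hy _ (distrC _ _)).
  have n1 : \forall t \near (0 : R), forall y, z t = iota y -> cdom b y /\ `|cfun b y - e| < de.
    have h := iota_open nU; rewrite -z0 in h; exact: (cz _ h).
  have n2 : \forall t \near (0 : R)^', `|w - t^-1 *: (cfun c (z t) - cfun c 1%g)| < eps.
    have [d1 d2] := dw.
    have h : (fun t : R => t^-1 *: (((cfun c \o z) \o shift 0) (t *: (1 : R)) - (cfun c \o z) 0)) @ 0^' --> w.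
      by rewrite -d2 derive1E; exact: d1.
    have /cvgrPdist_lt/(_ eps eps0) h' := h.
    apply: filterS h' => t ht.
    have Et : t *: (1 : R) + 0 = t by rewrite addr0; exact: mulr1.
    have ht2 := eq_ind _ (fun s => `|w - t^-1 *: (cfun c (z s) - cfun c (z 0))| < eps) ht t Et.
    exact: (eq_ind _ (fun s => `|w - t^-1 *: (cfun c (z t) - cfun c s)| < eps) ht2 1%g z0).
  have n3 : \forall t \near (0 : R)^', [/\ exists y, z t = iota y,
      forall y, z t = iota y -> cdom b y /\ `|cfun b y - e| < de,
      `|w - t^-1 *: (cfun c (z t) - cfun c 1%g)| < eps & t != 0].
    near=> t; split.
    - by near: t; exact: nbhs_dnbhs zK.
    - by near: t; exact: nbhs_dnbhs n1.
    - by near: t.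
    - by near: t; exact: nbhs_dnbhs_neq.
  have [t [[y zy] ty wt t0]] := @filter_ex _ _ (Proper_dnbhs_numFieldType 0) _ n3.
  have [by_ yde] := ty y zy.
  pose v := cfun b y - e; pose De := cfun c (z t) - cfun c 1%g.
  have rem : `|De - D v| <= eps * `|v|.
    have := Hde v; rewrite -ball_normE /= sub0r normrN => /(_ yde).
    have -> : (f \o shift e - (cst (f e) + 'd f e)) v = De - D v.
      rewrite !fctE /= DE /De /v subrK /f /= (cfunK ab by_) /e (cfunK ab b1) iota1 -zy.
      by rewrite opprD addrA.
    by [].
  (* Injectivity of D bounds the increment v in K by the increment [De] in G: the error eps |v| is
     absorbed on the left because CL eps is at most 1/2. *)
  have vL : `|v| <= 2 * (CL * `|De|).
    have h1 : `|v| <= `|D v| * CL.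
      have := norm_mulmx_le (v *m kmx) Lm; rewrite -mulmxA kL mulmx1 kmxE; exact.
    have h2 : `|D v| <= `|De| + eps * `|v|.
      rewrite -(subKr De (D v)); apply: le_trans (ler_normB _ _) _.
      by rewrite lerD2l.
    have h3 : `|v| <= (`|De| + eps * `|v|) * CL by exact: le_trans h1 (ler_wpM2r CL0 h2).
    have h4 : `|v| * (CL * eps) <= `|v| * 2^-1 by rewrite ler_wpM2l.
    have h5 : (`|De| + eps * `|v|) * CL = CL * `|De| + `|v| * (CL * eps) by ring.
    rewrite h5 in h3; lra.
  have wDe : `|t^-1 *: De| <= `|w| + 1.
    rewrite -(subKr w (t^-1 *: De)); apply: le_trans (ler_normB _ _) _.
    by rewrite lerD2l; apply: le_trans (ltW wt) eps1.
  have DvPi : D v *m Pi = 0 by rewrite -kmxE -mulmxA kPi mulmx0.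
  have aux (a a' w' : 'rV[R]_n) (r : R) (N : 'M[R]_n) : a' *m N = 0 ->
      w' *m N = (w' - r *: a) *m N + (r *: (a - a')) *m N.
    move=> aN; rewrite -mulmxDl scalerBr addrA subrK mulmxBl -scalemxAl aN.
    by rewrite scaler0 subr0.
  rewrite (aux De (D v) w t^-1 Pi DvPi).
  apply: le_trans (ler_normD _ _) _; rewrite mulrDr; apply: lerD.
    exact: (le_trans (norm_mulmx_le _ _) (ler_wpM2r CP0 (ltW wt))).
  have ti : `|t^-1| * `|De| <= `|w| + 1 by rewrite -normrZ.
  have r1 : `|t^-1 *: (De - D v)| <= eps * (2 * (CL * (`|w| + 1))).
    rewrite normrZ; apply: (le_trans (ler_wpM2l (normr_ge0 _) rem)).
    have p0 : `|t^-1| * (eps * `|v|) <= eps * (2 * (CL * (`|t^-1| * `|De|))).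
      have -> : eps * (2 * (CL * (`|t^-1| * `|De|))) = `|t^-1| * (eps * (2 * (CL * `|De|))) by ring.
      exact: (ler_wpM2l (normr_ge0 _) (ler_wpM2l (ltW eps0) vL)).
    apply: (le_trans p0); apply: (ler_wpM2l (ltW eps0)).
    exact: (ler_wpM2l (ler0n _ 2) (ler_wpM2l CL0 ti)).
  apply: (le_trans (norm_mulmx_le _ _)).
  have -> : eps * (2 * (CL * (`|w| + 1)) * CP) = eps * (2 * (CL * (`|w| + 1))) * CP by ring.
  exact: (ler_wpM2r CP0 r1).
suff wPi : w *m Pi = 0.
  exists (w *m Lm); apply: esym; rewrite -/D -kmxE -mulmxA.
  by apply/eqP; rewrite eq_sym -subr_eq0 -{1}(mulmx1 w) -mulmxBr -/Pi wPi.
apply/eqP; rewrite -normr_le0; apply: (le0_of_estimate CL0 _ estimate).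
have W0 : 0 <= `|w| + 1 := addr_ge0 (normr_ge0 w) ler01.
exact: (addr_ge0 CP0 (mulr_ge0 (mulr_ge0 (ler0n _ 2) (mulr_ge0 CL0 W0)) CP0)).
Unshelve. all: by end_near. Qed.

End subgroup_tangent.

Section horizontal_fields.
Context {R : realType} {n m : nat} {G : lieGroupType R n} {M : manifoldType R m}.
Variable proj : G -> M.
Hypothesis sproj : submersion proj.
Implicit Types (c : chart 'rV[R]_n G) (d : chart 'rV[R]_m M) (x : G).

Lemma submersion_C2map : C2map proj.
Proof. exact: smooth_C2map sproj.1. Qed.

Definition rep_mx c d (u : 'rV[R]_n) : 'M[R]_(n, m) := 'J (cfun d \o proj \o cinv c) u.

(** The differential of [proj] composed with left translation, as a map from T_1 G to coordinates in
    d. Vectors are rows, so matrices act from the right. *)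
Definition proj_mx c d (u : 'rV[R]_n) : 'M[R]_(n, m) := ltrans_mx c u *m rep_mx c d u.

Lemma rep_mxE c d x v : atlas c -> cdom c x -> atlas d -> cdom d (proj x) ->
  v *m rep_mx c d (cfun c x) = 'd (cfun d \o proj \o cinv c) (cfun c x) v.
Proof.
move=> ac cx ad dx; have df := C2map_diff submersion_C2map ac ad cx dx.
exact: (etrans (esym (deriveEjacobian v df)) (deriveE v df)).
Qed.

Lemma proj_mxE c d x v : atlas c -> cdom c x -> atlas d -> cdom d (proj x) ->
  v *m proj_mx c d (cfun c x) = tcoord d (proj x) (mdiff proj x (ltrans x v)).
Proof.
move=> ac cx ad dx; rewrite /proj_mx mulmxA (ltrans_mxE v ac cx) (rep_mxE _ ac cx ad dx).
exact: (congr1 (fun g => g (ltrans x v)) (rep_mdiff submersion_C2map ac ad cx dx)).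
Qed.

Lemma proj_mx_lip c d x i j : atlas c -> cdom c x -> atlas d -> cdom d (proj x) ->
  lip_near (cfun c x) (fun u => proj_mx c d u i j).
Proof.
move=> ac cx ad dx; apply: lip_near_mulmx => k l; first exact: ltrans_mx_lip.
apply: (C2_lip_near_jacobian (U := cfun c @` (cdom c `&` proj @^-1` cdom d))).
- exact: C2_dom_open submersion_C2map.1 ac ad.
- exact: submersion_C2map.2.
- by exists x.
Qed.

Lemma proj_mx_onto c d x (w : 'rV[R]_m) : atlas c -> cdom c x -> atlas d -> cdom d (proj x) ->
  exists v, v *m proj_mx c d (cfun c x) = w.
Proof.
move=> ac cx ad dx; have [v Hv] := sproj.2 x (tcoord_inv d (proj x) w).
exists (ltrans_inv x v); rewrite (proj_mxE _ ac cx ad dx) ltrans_invK Hv.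
exact: tcoord_invK.
Qed.

Lemma proj_chart_near c d x : atlas c -> cdom c x -> atlas d -> cdom d (proj x) ->
  exists2 r, 0 < r & forall y, cdom c y -> `|cfun c y - cfun c x| < r -> cdom d (proj y).
Proof.
move=> ac cx ad dx.
have [|r r0 H] := open_ballP (C2_dom_open submersion_C2map.1 ac ad) (u0 := cfun c x).
  by exists x.
exists r => // y cy yr; have [z [cz dz] zy] := H _ yr.
by rewrite -(cfunK ac cy) -zy (cfunK ac cz).
Qed.

(* The rows of J span a subspace of T_1 G on which the differential of proj is
   invertible near the point considered; lift_mx is the resulting right inverse
   of that differential (lift_mxK), with inverses written through adjugates so
   that it is visibly Lipschitz in u. *)
Definition lift_coef c d (J : 'M[R]_(m, n)) u : 'M[R]_(m, n) :=
  let S := J *m proj_mx c d u in (\det S)^-1 *: (\adj S *m J).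

Definition lift_mx c d (J : 'M[R]_(m, n)) u : 'M[R]_(m, n) :=
  lift_coef c d J u *m ltrans_mx c u.

Lemma lift_coefK c d J u : J *m proj_mx c d u \in unitmx ->
  lift_coef c d J u *m proj_mx c d u = 1%:M.
Proof.
move=> Su; rewrite /lift_coef -scalemxAl -mulmxA mul_adj_mx.
by rewrite scale_scalar_mx mulVr// -unitmxE.
Qed.

Lemma lift_mxK c d J u : J *m proj_mx c d u \in unitmx ->
  lift_mx c d J u *m rep_mx c d u = 1%:M.
Proof. by move=> Su; rewrite /lift_mx -mulmxA; exact: lift_coefK. Qed.

Lemma lift_mx_lip c d J x i j : atlas c -> cdom c x -> atlas d -> cdom d (proj x) ->
  J *m proj_mx c d (cfun c x) \in unitmx ->
  lip_near (cfun c x) (fun u => lift_mx c d J u i j).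
Proof.
move=> ac cx ad dx Su.
have lS k l : lip_near (cfun c x) (fun u => (J *m proj_mx c d u) k l).
  by apply: lip_near_mulmx => a b; [exact: lip_near_cst|exact: proj_mx_lip].
apply: lip_near_mulmx => k l; last exact: ltrans_mx_lip.
have -> : (fun u => lift_coef c d J u k l) =
    (fun u => \sum_a ((\det (J *m proj_mx c d u))^-1 * (\adj (J *m proj_mx c d u)) k a) * J a l).
  apply/funext => u; rewrite /lift_coef !mxE mulr_sumr; apply: eq_bigr => a _.
  by rewrite mulrA.
apply: lip_near_sum => a _; apply: lip_nearM; last exact: lip_near_cst.
exact: (lip_near_invmx (A := fun u => J *m proj_mx c d u)).
Qed.

Lemma derive1_proj c d (gamma : R -> G) t : atlas c -> cdom c (gamma t) -> atlas d -> cdom d (proj (gamma t)) ->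
  {for t, continuous gamma} -> derivable (cfun c \o gamma) t 1 ->
  derivable (cfun d \o proj \o gamma) t 1 /\
  derive1 (cfun d \o proj \o gamma) t =
    derive1 (cfun c \o gamma) t *m rep_mx c d (cfun c (gamma t)).
Proof.
move=> ac cg ad dg cont dc.
have df := C2map_diff submersion_C2map ac ad cg dg.
have [d1 d2] := curve_map ac cg df cont dc.
by split; [exact: d1|rewrite d2 (rep_mxE _ ac cg ad dg)].
Qed.

End horizontal_fields.

Lemma lip_near_row_continuous {R : realType} {U : normedModType R} {n : nat}
    (f : U -> 'rV[R]_n) u0 : (forall j, lip_near u0 (fun u => f u 0 j)) ->
  {for u0, continuous f}.
Proof.
move=> lf; have [r [L [r0 L0 H]]] := lip_near_fin lf.
apply/cvgrPdist_lt => e e0; near=> u.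
have ur : `|u - u0| < r.
  near: u; apply/nbhs_ballP; exists r => // u; rewrite -ball_normE /=.
  by rewrite distrC.
have ue : `|u0 - u| < e / (L + 1).
  near: u; apply/nbhs_ballP; exists (e / (L + 1)) => /=; first by rewrite divr_gt0// ltr_wpDl.
  by move=> u; rewrite -ball_normE.
have le1 : `|f u0 - f u| <= L * `|u0 - u|.
  apply: norm_mx_le => [|i j]; first by rewrite mulr_ge0.
  rewrite (ord1 i) !mxE; apply: H => //; by rewrite subrr normr0.
apply: (le_lt_trans le1); rewrite ltr_pdivlMr ?ltr_wpDl// in ue.
apply: le_lt_trans ue; rewrite mulrC ler_wpM2l// lerDl; exact: ler01.
Unshelve. all: by end_near. Qed.

Section kernel.
Context {R : realType} {n k m : nat} {G : lieGroupType R n} {K : lieGroupType R k}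
  {M : manifoldType R m}.
Variables (iota : K -> G) (proj : G -> M).
Hypotheses (sub : lie_subgroup iota) (compactK : compact [set: K])
  (hom : homogeneous_space iota proj).

Let sproj : submersion proj. Proof. by case: hom. Qed.

(** The map sending y in K to proj (x y) is constant, and its differential at 1 is the left-hand
    side. *)
Lemma mdiff_proj_iota x v : mdiff proj x (ltrans x (mdiff iota 1%g v)) = 0.
Proof.
have [d1 e1] := mdiff_comp (C2map_mdifferentiable (1%g : K) (iota_C2map sub))
  (C2map_mdifferentiable (iota 1%g) (left_C2map x)).
have [_ e2] := mdiff_comp d1 (C2map_mdifferentiable (x * iota 1)%g (submersion_C2map sproj)).
have E : proj \o ((fun h : G => x * h)%g \o iota) = cst (proj x).
  apply/funext => y /=; apply/esym; case: hom => _ H _; apply/H; by exists y.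
have h0 : mdiff (cst (proj x) : K -> M) 1%g v = 0.
  exact: (congr1 (fun f : 'rV[R]_k -> 'rV[R]_m => f v)
    (diff_cst (cfun (chart_at (proj x)) (proj x)) (cfun (chart_at (1%g : K)) 1%g))).
have := congr1 (fun f => f v) e2; rewrite E e1 /= => h.
have h2 := etrans (esym h) h0.
have := eq_ind _ (fun y => mdiff proj (x * y)%g (mdiff (fun h : G => x * h)%g y (mdiff iota 1%g v)) = 0)
  h2 _ (iota1 sub).
by rewrite mulg1.
Qed.

(* Subtracting from the left invariant field of w the lift of its projection gives
   a field whose integral curve through x projects to a point, hence stays in the
   coset x iota(K), and has logarithmic derivative w at x. *)
Lemma mdiff_proj_kernel x w : mdiff proj x (ltrans x w) = 0 ->
  exists v, w = mdiff iota 1%g v.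
Proof.
move=> pw; pose c := chart_at x; pose d := chart_at (proj x).
have [ac cx] : atlas c /\ cdom c x by split; [exact: atlas_chart_at|exact: mem_chart_at].
have [ad dx] : atlas d /\ cdom d (proj x) by split; [exact: atlas_chart_at|exact: mem_chart_at].
have [J JN] : exists J, J *m proj_mx proj c d (cfun c x) = 1%:M.
  apply/row_fullP; rewrite -sub1mx; apply/row_subP => i; apply/submxP.
  have [v Hv] := proj_mx_onto sproj (row i 1%:M) ac cx ad dx.
  by exists v.
have lS i j : lip_near (cfun c x) (fun u => (J *m proj_mx proj c d u) i j).
  by apply: lip_near_mulmx => a b; [exact: lip_near_cst|exact: proj_mx_lip].
have Su : J *m proj_mx proj c d (cfun c x) \in unitmx by rewrite JN unitmx1.
pose A u := ltrans_mx c u - proj_mx proj c d u *m lift_mx proj c d J u.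
have lA i j : lip_near (cfun c x) (fun u => A u i j).
  have -> : (fun u => A u i j) = (fun u => ltrans_mx c u i j +
      -1 * (proj_mx proj c d u *m lift_mx proj c d J u) i j).
    by apply/funext => u; rewrite [LHS]mxE [X in _ + X]mxE mulN1r.
  apply: lip_nearD; first exact: ltrans_mx_lip.
  apply: lip_nearM; first exact: lip_near_cst.
  by apply: lip_near_mulmx => a b; [exact: proj_mx_lip|exact: lift_mx_lip].
have wN : w *m proj_mx proj c d (cfun c x) = 0.
  rewrite (proj_mxE sproj w ac cx ad dx) pw; exact: linear0.
have wA : w *m A (cfun c x) = w *m ltrans_mx c (cfun c x).
  by rewrite mulmxBr mulmxA wN mul0mx subr0.
(* The constant w is cut off outside [-1, 1] to be integrable on the line. *)
pose p (t : R) : 'rV[R]_n := (\1_`[(-1), 1] t : R) *: w.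
have p1 t : -1 <= t -> t <= 1 -> p t = w.
  move=> t1 t2; rewrite /p indicE mem_set ?scale1r//=.
  by rewrite in_itv /= t1 t2.
have ip : row_integrable p.
  move=> i.
  have h := integrableZr measurableT (w 0 i) (@integrable_indic_itv R (-1) 1 true false).
  by apply: eq_integrable h => // t _; rewrite /= mxE EFinM.
have [r1 r10 Hr1] := near_unitmx lS Su.
have [r2 r20 Hr2] := proj_chart_near sproj ac cx ad dx.
have [|h [beta [h0 b0 cb acB pB]]] := ode_curve 0 ac cx ip lA (rho := Num.min r1 r2).
  by rewrite lt_min r10.
have cbt t : [/\ cdom c (beta t), J *m proj_mx proj c d (cfun c (beta t)) \in unitmx &
    cdom d (proj (beta t))].
  have [c1] := cb t; rewrite lt_min => /andP[c2 c3].
  exact: (And3 c1 (Hr1 _ c2) (Hr2 _ c1 c3)).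
rewrite sub0r add0r in acB pB.
have z0h : -h <= 0 <= h by rewrite oppr_le0 ltW.
have db0 : cdom d (proj (beta 0)) by rewrite b0.
have [e1 e10 He1] := AC_curve_map (submersion_C2map sproj) acB z0h ad db0.
pose e := Num.min h (Num.min 1 e1) / 2.
have [e0 eh le1 ee1] : [/\ 0 < e, e <= h, e <= 1 & e < e1].
  have m0 : 0 < Num.min h (Num.min 1 e1) by rewrite !lt_min h0 ltr01.
  have [m1 m2 m3] : [/\ Num.min h (Num.min 1 e1) <= h, Num.min h (Num.min 1 e1) <= 1 &
      Num.min h (Num.min 1 e1) <= e1] by rewrite !ge_min !lexx !orbT.
  by rewrite /e; move: (Num.min h _) m0 m1 m2 m3 => y *; split; lra.
have const t : -e <= t -> t <= e -> exists y, beta t = (x * iota y)%g.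
  move=> t1 t2.
  (* The projected curve is absolutely continuous with derivative 0 almost everywhere, because
     [lift_mxK] makes the two terms of A cancel under d(proj). *)
  suff Ed : (cfun d \o proj \o beta) t = cfun d (proj x).
    have Ep : proj (beta t) = proj x.
      have [_ _ dt] := cbt t; rewrite -(cfunK ad dt) -[RHS](cfunK ad dx).
      exact: congr1 Ed.
    by have [_ Hf _] := hom; have /Hf[y Hy] := esym Ep; exists y.
  have ee : -e <= e by lra.
  have ACf : AC (-e) e (cfun d \o proj \o beta) by apply: He1; lra.
  have ACc : AC (-e) e (cst (cfun d (proj x)) : R -> 'rV[R]_m).
    by apply: (AC_dominated (L := 0) _ ACf) => a b *; rewrite mul0r subrr normr0.
  have n0 : - e <= 0 by lra.
  apply: (eq_of_ae_derive ACf ACc n0 (ltW e0)) t1 t2; first by rewrite /= b0.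
  have base := primitive_ae_derivable pB.
  apply: lebesgue_aeS base => s Hs /andP[s1 s2] _ _.
  have [|ds1 ds2] := Hs; first by apply/andP; split; lra.
  have [cs us dps] := cbt s.
  have [_ ->] := derive1_proj sproj ac cs ad dps (acB.1 s) ds1.
  have -> : derive1 (cst (cfun d (proj x)) : R -> 'rV[R]_m) s = 0.
    by rewrite derive1E derive_cst.
  rewrite ds2 -mulmxA /A mulmxBl -mulmxA (lift_mxK us) mulmx1.
  by rewrite [X in _ *m (X - _)](_ : _ = proj_mx proj c d (cfun c (beta s))) // subrr mulmx0.
(* The velocity is needed at time 0 itself, hence the continuity of the right-hand side there. *)
have chB : {for 0, continuous (fun t => p t *m A (cfun c (beta t)))}.
  have cw : {for cfun c x, continuous (fun u => w *m A u)}.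
    apply: lip_near_row_continuous => j.
    by apply: lip_near_mulmx => a b; [exact: lip_near_cst|exact: lA].
  have cB : {for 0, continuous (cfun c \o beta)}.
    have cx' := cx; rewrite -b0 in cx'.
    exact: (continuous_comp (acB.1 0) (cfun_continuous ac cx')).
  have cw' : {for (cfun c \o beta) 0, continuous (fun u => w *m A u)} by rewrite /= b0.
  have cwb : {for 0, continuous (fun t => w *m A (cfun c (beta t)))} := continuous_comp cB cw'.
  have En : \forall t \near (0 : R), w *m A (cfun c (beta t)) = p t *m A (cfun c (beta t)).
    near=> t; rewrite p1//; apply/ltW; near: t.
      apply: lt_nbhsr; by rewrite ltrN10.
    apply: lt_nbhsl; exact: ltr01.
  move=> U; rewrite /= p1 ?lerN10 ?ler01// => /cwb HU.
  by apply: filterS2 En HU => t Et Ut; exact: (eq_ind _ U Ut _ Et).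
have nh0 : -h < 0 by rewrite oppr_lt0.
have [d1 d2] := primitive_derivable_at pB nh0 h0 chB.
have [cb0 _ _] := cbt 0.
have dq := (derivable_chart ac cb0 (acB.1 0)).2 d1.
have mc0 : mc beta 0 = w.
  have h1 := etrans (esym (mc_chart ac cb0 (acB.1 0) dq)) d2.
  have h2 := eq_ind _ (fun y => mc beta 0 *m ltrans_mx c (cfun c y) = p 0 *m A (cfun c y)) h1 _ b0.
  have p0 : p 0 = w by apply: p1; rewrite ?lerN10 ?ler01.
  rewrite p0 wA in h2.
  exact: (can_inj (mulmxK (ltrans_mx_unit ac cx)) h2).
have [dz vz] := vel_map (left_C2map x^-1%g) (acB.1 0) dq.
have cz : continuous ((fun h : G => x^-1 * h)%g \o beta).
  by move=> t; exact: (continuous_comp (acB.1 t) ((left_C2map x^-1%g).1 (beta t))).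
have z1 : ((fun h : G => x^-1 * h)%g \o beta) 0 = 1%g by rewrite /= b0 mulVg.
have zK : \forall t \near (0 : R), exists y, ((fun h : G => x^-1 * h)%g \o beta) t = iota y.
  near=> t; have t1 : -e <= t by apply/ltW; near: t; apply: lt_nbhsr; rewrite oppr_lt0.
  have t2 : t <= e by apply/ltW; near: t; exact: lt_nbhsl.
  by have [y Hy] := const t t1 t2; exists y; rewrite /= Hy mulKg.
have [v Hv] := subgroup_tangent sub compactK z1 (cz 0) dz zK.
exists v; rewrite -mc0 -Hv vz.
exact: (congr1 (fun y => mdiff (fun h : G => y^-1 * h)%g (beta 0) (vel beta 0)) b0).
Unshelve. all: by end_near. Qed.

End kernel.

(** * Invariant metrics, orthogonal complements and the adjoint action *)

Section invariant_metric.
Context {R : realType} {n k : nat} {G : lieGroupType R n} {K : lieGroupType R k}.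
Variables (iota : K -> G) (g : G -> 'rV[R]_n -> 'rV[R]_n -> R).
Hypotheses (sub : lie_subgroup iota) (riem : riemannian_metric g)
  (linv : left_invariant g) (binv : bi_invariant_wrt iota g).

Lemma metricZl x a u w : g x (a *: u) w = a * g x u w.
Proof.
have h := metric_linear riem x a u 0 w; rewrite addr0 in h; rewrite h.
have := metric_linear riem x 1 0 0 w; rewrite scaler0 addr0 mul1r -{1}(addr0 (g x 0 w)).
by move=> /addrI <-; rewrite addr0.
Qed.

Lemma metricDl x u v w : g x (u + v) w = g x u w + g x v w.
Proof. by have := metric_linear riem x 1 u v w; rewrite scale1r mul1r. Qed.

Lemma metricZr x a u w : g x w (a *: u) = a * g x w u.
Proof. by rewrite (Defs.metric_sym riem) metricZl (Defs.metric_sym riem). Qed.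

Lemma metricDr x u v w : g x w (u + v) = g x w u + g x w v.
Proof. by rewrite (Defs.metric_sym riem) metricDl !(Defs.metric_sym riem x w). Qed.

Lemma metric0l x w : g x 0 w = 0.
Proof. by rewrite -(scale0r 0) metricZl mul0r. Qed.

Lemma metric_suml x (I : Type) (s : seq I) (P : pred I) (F : I -> 'rV[R]_n) w :
  g x (\sum_(i <- s | P i) F i) w = \sum_(i <- s | P i) g x (F i) w.
Proof.
by elim/big_rec2: _ => [|i y z _ <-]; [exact: metric0l|exact: metricDl].
Qed.

Definition gram x : 'M[R]_n := \matrix_(i, j) g x (delta_mx 0 i) (delta_mx 0 j).

Lemma gramE x u v : g x u v = (u *m gram x *m v^T) 0 0.
Proof.
have E w : g x u w = \sum_i u 0 i * g x (delta_mx 0 i) w.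
  rewrite {1}(row_sum_delta u) metric_suml; apply: eq_bigr => i _; exact: metricZl.
rewrite (Defs.metric_sym riem) {1}(row_sum_delta v) metric_suml mxE; apply: eq_bigr => j _.
rewrite metricZl (Defs.metric_sym riem) E mulrC [v^T _ _]mxE [(_ *m _) 0 j]mxE.
by congr (_ * _); apply: eq_bigr => i _; rewrite mxE.
Qed.

Lemma metric_ge0 x v : 0 <= g x v v.
Proof.
have [->|/(metric_pos riem x)/ltW//] := eqVneq v 0.
by rewrite metric0l.
Qed.

Lemma metric_eq0 x v : g x v v = 0 -> v = 0.
Proof.
by move=> v0; apply: contrapT => /eqP/(metric_pos riem x); rewrite v0 ltxx.
Qed.

Local Notation perp := (lie_perp iota g).

Lemma lie_perp0 : perp 0.
Proof. by move=> w _; exact: metric0l. Qed.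

Lemma lie_perpD u v : perp u -> perp v -> perp (u + v).
Proof. by move=> pu pv w kw; rewrite metricDl pu// pv// addr0. Qed.

Lemma lie_perpZ a v : perp v -> perp (a *: v).
Proof. by move=> pv w kw; rewrite metricZl pv// mulr0. Qed.

Lemma lie_perp_mulmx {m : nat} (w : 'rV[R]_m) (J : 'M[R]_(m, n)) :
  (forall i, perp (row i J)) -> perp (w *m J).
Proof.
move=> pJ; rewrite mulmx_sum_row; elim/big_rec: _ => [|i v _ pv]; first exact: lie_perp0.
by apply: lie_perpD => //; exact: lie_perpZ.
Qed.

Lemma lie_perp_iota v : perp (mdiff iota 1%g v) -> mdiff iota 1%g v = 0.
Proof. by move=> pv; apply: (@metric_eq0 1%g); apply: pv; exists v. Qed.

(** Orthogonal projection by the normal equations: S is the Gram matrix of the images of the basis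
    vectors of the Lie algebra of K, invertible because the metric is positive and the differential
    of [iota] injective. *)
Lemma lie_decomposition w : exists v p, perp p /\ w = mdiff iota 1%g v + p.
Proof.
pose kmx : 'M[R]_(k, n) := lin1_mx (mdiff iota 1%g).
have kmxE v : v *m kmx = mdiff iota 1%g v by exact: mul_rV_lin1.
have injD : injective (mdiff iota 1%g).
  by case: sub => _ _ im; exact: (im.2 1%g).
pose S := kmx *m gram 1%g *m kmx^T.
have Su : S \in unitmx.
  rewrite -row_free_unit -kermx_eq0; apply/rowV0P => v /sub_kermxP vS.
  have : g 1%g (v *m kmx) (v *m kmx) = 0.
    rewrite gramE trmx_mul.
    have -> : v *m kmx *m gram 1%g *m (kmx^T *m v^T) = v *m S *m v^T by rewrite /S !mulmxA.
    by rewrite vS mul0mx mxE.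
  move/metric_eq0; rewrite kmxE => Dv; apply: injD; rewrite Dv.
  by apply: esym; exact: linear0.
pose v := w *m gram 1%g *m kmx^T *m invmx S.
exists v, (w - v *m kmx); split; last by rewrite -kmxE addrC subrK.
move=> _ [u _ <-]; rewrite -kmxE gramE trmx_mul.
have -> : (w - v *m kmx) *m gram 1%g *m (kmx^T *m u^T) =
    (w *m gram 1%g *m kmx^T - v *m S) *m u^T by rewrite /S !mulmxBl !mulmxA.
by rewrite /v mulmxKV// subrr mul0mx mxE.
Qed.

End invariant_metric.

Section adjoint.
Context {R : realType} {n : nat} {G : lieGroupType R n}.
Implicit Types (x y : G).

Lemma conj_C2map y : mdifferentiable (fun x : G => y * x * y^-1)%g 1%g /\
  Ad y = mdiff (fun x : G => x * y^-1)%g y \o ltrans y.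
Proof.
have [d1 e1] := mdiff_comp (C2map_mdifferentiable 1%g (left_C2map y))
  (C2map_mdifferentiable (y * 1)%g (right_C2map y^-1%g)).
split; first exact: d1.
rewrite /Ad; apply: (etrans e1).
exact: (congr1 (fun z => mdiff (fun x : G => x * y^-1)%g z \o ltrans y) (mulg1 y)).
Qed.

(** Differentiates (x y)^-1 (h y) = y^-1 (x^-1 h) y with respect to h at x. *)
Lemma mdiff_right y x v :
  ltrans_inv (x * y)%g (mdiff (fun h : G => h * y)%g x v) = Ad y^-1%g (ltrans_inv x v).
Proof.
have [d1 e1] := mdiff_comp (C2map_mdifferentiable x (right_C2map y))
  (C2map_mdifferentiable (x * y)%g (left_C2map (x * y)^-1%g)).
have [dA _] := conj_C2map y^-1%g.
have dA' : mdifferentiable (fun z : G => y^-1 * z * y^-1^-1)%g (x^-1 * x)%g by rewrite mulVg.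
have [d2 e2] := mdiff_comp (C2map_mdifferentiable x (left_C2map x^-1%g)) dA'.
have E : (fun h : G => (x * y)^-1 * h)%g \o (fun h : G => h * y)%g =
  (fun z : G => y^-1 * z * y^-1^-1)%g \o (fun h : G => x^-1 * h)%g.
  by apply/funext => h /=; rewrite invgM invgK !mulgA.
have h1 := congr1 (fun f => f v) e1; have h2 := congr1 (fun f => f v) e2.
apply: (etrans (esym h1)); rewrite E; apply: (etrans h2).
exact: (congr1 (fun z => mdiff (fun z : G => y^-1 * z * y^-1^-1)%g z (ltrans_inv x v)) (mulVg x)).
Qed.

Lemma mc_right (alpha : R -> G) y t : {for t, continuous alpha} ->
  curve_derivable alpha t -> mc (fun s => alpha s * y)%g t = Ad y^-1%g (mc alpha t).
Proof.
move=> cont da; have [_ H] := vel_map (right_C2map y) cont da.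
rewrite -[RHS]mdiff_right /mc.
exact: (congr1 (ltrans_inv (alpha t * y)%g) H).
Qed.

Lemma AdK y : cancel (Ad y) (Ad y^-1%g).
Proof.
move=> v; have [dA _] := conj_C2map y.
have [dB _] := conj_C2map y^-1%g.
have y1 : (y * 1 * y^-1)%g = 1%g :> G by rewrite mulg1 mulgV.
have dB' : mdifferentiable (fun z : G => y^-1 * z * y^-1^-1)%g (y * 1 * y^-1)%g by rewrite y1.
have [_ e] := mdiff_comp dA dB'.
have E : (fun z : G => y^-1 * z * y^-1^-1)%g \o (fun z : G => y * z * y^-1)%g = idfun.
  by apply/funext => h /=; rewrite invgK !mulgA mulVg mul1g -mulgA mulVg mulg1.
have h := congr1 (fun f => f v) e; rewrite E mdiff_id in h.
apply: esym; apply: (etrans h).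
exact: (congr1 (fun z => mdiff (fun z : G => y^-1 * z * y^-1^-1)%g z (Ad y v)) y1).
Qed.

Lemma AdVK y : cancel (Ad y^-1%g) (Ad y).
Proof. by have := AdK y^-1%g; rewrite invgK. Qed.

End adjoint.

Section adjoint_subgroup.
Context {R : realType} {n k : nat} {G : lieGroupType R n} {K : lieGroupType R k}.
Variables (iota : K -> G) (g : G -> 'rV[R]_n -> 'rV[R]_n -> R).
Hypotheses (sub : lie_subgroup iota) (riem : riemannian_metric g)
  (linv : left_invariant g) (binv : bi_invariant_wrt iota g).

(** Conjugation by [iota y] is a left translation followed by right translation by an element of K,
    and both preserve the metric. *)
Lemma Ad_isometry y u v : g 1%g (Ad (iota y) u) (Ad (iota y) v) = g 1%g u v.
Proof.
have [_ ->] := conj_C2map (iota y).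
have h1 := linv (iota y) 1%g u v.
have h2 := (binv (y^-1)%g).2 (iota y * 1)%g (ltrans (iota y) u) (ltrans (iota y) v).
rewrite (iotaV sub) in h2.
have h3 := etrans h2 h1.
have h4 := eq_ind _ (fun z => g (z * (iota y)^-1)%g
  (mdiff (fun x : G => x * (iota y)^-1)%g z (ltrans (iota y) u))
  (mdiff (fun x : G => x * (iota y)^-1)%g z (ltrans (iota y) v)) = g 1%g u v) h3 _ (mulg1 _).
rewrite mulgV in h4; exact: h4.
Qed.

Lemma Ad_iota y v : Ad (iota y) (mdiff iota 1%g v) = mdiff iota 1%g (Ad y v).
Proof.
have [_ iM _] := sub.
have [dA _] := conj_C2map (iota y); have [dB _] := conj_C2map y.
have dA' : mdifferentiable (fun z : G => iota y * z * (iota y)^-1)%g (iota 1%g) by rewrite (iota1 sub).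
have [_ e1] := mdiff_comp (C2map_mdifferentiable (1%g : K) (iota_C2map sub)) dA'.
have [_ e2] := mdiff_comp dB (C2map_mdifferentiable (y * 1 * y^-1)%g (iota_C2map sub)).
have E : (fun z : G => iota y * z * (iota y)^-1)%g \o iota =
  iota \o (fun z : K => y * z * y^-1)%g.
  by apply/funext => h /=; rewrite !iM (iotaV sub).
have h1 := congr1 (fun f => f v) e1; have h2 := congr1 (fun f => f v) e2.
rewrite E in h1.
have y1 : (y * 1 * y^-1)%g = 1%g :> K by rewrite mulg1 mulgV.
have h3 := etrans (esym h1) h2.
have h4 := eq_ind _ (fun z => mdiff (fun z : G => iota y * z * (iota y)^-1)%g z (mdiff iota 1%g v) =
   mdiff iota (y * 1 * y^-1)%g (Ad y v)) h3 _ (iota1 sub).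
exact: (eq_ind _ (fun z => Ad (iota y) (mdiff iota 1%g v) = mdiff iota z (Ad y v)) h4 _ y1).
Qed.

Lemma Ad_lie_perp y v : lie_perp iota g v -> lie_perp iota g (Ad (iota y) v).
Proof.
move=> pv _ [u _ <-].
have : mdiff iota 1%g u = Ad (iota y) (mdiff iota 1%g (Ad y^-1%g u)).
  by rewrite Ad_iota AdVK.
by move=> ->; rewrite Ad_isometry; apply: pv; exists (Ad y^-1%g u).
Qed.

Lemma left_invariant_norm x v : g x v v = g 1%g (ltrans_inv x v) (ltrans_inv x v).
Proof.
have := linv x^-1%g x v v; rewrite mulVg => h; exact: esym h.
Qed.

End adjoint_subgroup.

(** * Existence and uniqueness of horizontal lifts *)

Section horizontal_lifts.
Context {R : realType} {n k m : nat} {G : lieGroupType R n} {K : lieGroupType R k}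
  {M : manifoldType R m}.
Variables (iota : K -> G) (proj : G -> M) (g : G -> 'rV[R]_n -> 'rV[R]_n -> R).
Hypotheses (sub : lie_subgroup iota) (compactK : compact [set: K])
  (hom : homogeneous_space iota proj) (riem : riemannian_metric g)
  (linv : left_invariant g) (binv : bi_invariant_wrt iota g).
Notation mu := (@lebesgue_measure R).
Local Notation perp := (lie_perp iota g).
Implicit Types (alpha beta : R -> G) (gamma : R -> M).

Let sproj : submersion proj. Proof. by case: hom. Qed.

(** Preimages of the coordinate vectors exist since [proj] is a submersion. Removing their
    components in the Lie algebra of K makes them horizontal and does not change their images. *)
Lemma horizontal_frame c d x : atlas c -> cdom c x -> atlas d -> cdom d (proj x) ->
  exists J : 'M[R]_(m, n), (forall i, perp (row i J)) /\ J *m proj_mx proj c d (cfun c x) = 1%:M.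
Proof.
move=> ac cx ad dx.
have /choice[v Hv] : forall i : 'I_m, exists v, perp v /\
    v *m proj_mx proj c d (cfun c x) = row i 1%:M.
  move=> i; have [w Hw] := proj_mx_onto sproj (row i 1%:M) ac cx ad dx.
  have [v [p [pp wE]]] := lie_decomposition sub riem w.
  exists p; split => //; rewrite -Hw wE mulmxDl (proj_mxE sproj (mdiff _ _ _) ac cx ad dx).
  by rewrite (mdiff_proj_iota sub hom) [tcoord _ _ _]linear0 add0r.
exists (\matrix_i v i); split=> [i|]; first by rewrite rowK; exact: (Hv i).1.
by apply/row_matrixP => i; rewrite row_mul rowK; exact: (Hv i).2.
Qed.

(** By [mdiff_proj_kernel] p lies in the Lie algebra of K, which meets its orthogonal complement
    only in 0. *)
Lemma horizontal_unique c d x p : atlas c -> cdom c x -> atlas d -> cdom d (proj x) ->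
  perp p -> p *m proj_mx proj c d (cfun c x) = 0 -> p = 0.
Proof.
move=> ac cx ad dx pp; rewrite (proj_mxE sproj p ac cx ad dx) => h.
have h0 : mdiff proj x (ltrans x p) = 0.
  rewrite -(tcoordK ad dx (mdiff proj x (ltrans x p))) h; exact: linear0.
have [v pv] := mdiff_proj_kernel sub compactK hom h0.
by rewrite pv (lie_perp_iota riem)// -pv.
Qed.

(** Both sides are horizontal and have the same projection. The formula stays valid away from the
    point where J was normalised, as long as J *m proj_mx is invertible. *)
Lemma lift_coef_unique c d x J p : atlas c -> cdom c x -> atlas d -> cdom d (proj x) ->
  (forall i, perp (row i J)) -> J *m proj_mx proj c d (cfun c x) \in unitmx -> perp p ->
  p = (p *m proj_mx proj c d (cfun c x)) *m lift_coef proj c d J (cfun c x).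
Proof.
move=> ac cx ad dx pJ Su pp; apply/eqP; rewrite -subr_eq0; apply/eqP.
apply: (horizontal_unique ac cx ad dx); last first.
  by rewrite mulmxBl -[X in _ - X]mulmxA (lift_coefK Su) mulmx1 subrr.
apply: (lie_perpD riem) => //; rewrite -scaleN1r; apply: (lie_perpZ riem).
by rewrite /lift_coef scalemxAl mulmxA; exact: (lie_perp_mulmx riem).
Qed.

Lemma lift_coef_perp c d J u (y : 'rV[R]_m) : (forall i, perp (row i J)) ->
  perp (y *m lift_coef proj c d J u).
Proof.
by move=> pJ; rewrite /lift_coef scalemxAl mulmxA; exact: (lie_perp_mulmx riem).
Qed.

(** Supplies the integrable coefficient of the lifting equation, the derivative of [gamma] in a
    chart. The equation needs it defined on the line, while [gamma] matters only on [0, 1]. *)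
Lemma primitive_at_center gamma t0 d : AC_curve 0 1 gamma -> 0 <= t0 <= 1 ->
  atlas d -> cdom d (gamma t0) ->
  exists e y, [/\ 0 < e, row_integrable y,
    (forall t, t0 - e < t -> t < t0 + e -> cdom d (gamma t)) &
    {ae mu, forall t, 0 < t < 1 -> t0 - e < t < t0 + e ->
       derivable (cfun d \o gamma) t 1 /\ derive1 (cfun d \o gamma) t = y t}].
Proof.
move=> acG t001 ad dg; have [e1 e10 He1] := AC_curve_map id_C2map acG t001 ad dg.
have [e2 e20 He2] := near_ball (acG.1 t0 _ (cdom_nbhs ad dg)).
(* Halving leaves room for the closed interval [a, b] inside the open windows. *)
pose e := Num.min e1 e2 / 2.
have [e0 ee1 ee2] : [/\ 0 < e, e < e1 & e < e2].
  have m0 : 0 < Num.min e1 e2 by rewrite !lt_min e10.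
  have [m1 m2] : Num.min e1 e2 <= e1 /\ Num.min e1 e2 <= e2 by rewrite !ge_min !lexx orbT.
  by rewrite /e; move: (Num.min _ _) m0 m1 m2 => y *; split; lra.
pose a := Num.max 0 (t0 - e); pose b := Num.min 1 (t0 + e).
have [t1 t2] := andP t001.
have [a0 aE] : 0 <= a /\ t0 - e <= a by rewrite /a !le_max !lexx orbT.
have [b1 bE] : b <= 1 /\ b <= t0 + e by rewrite /b !ge_min !lexx orbT.
have at0 : a <= t0 by rewrite ge_max t1 gerBl ltW.
have t0b : t0 <= b by rewrite le_min t2 lerDl ltW.
have ab := le_trans at0 t0b.
have w1 : t0 - e1 < a by apply: lt_le_trans aE; rewrite ltrD2l ltrN2.
have w2 : b < t0 + e1 by apply: (le_lt_trans bE); rewrite ltrD2l.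
have [y py] := AC_primitive ab (He1 a b a0 ab b1 w1 w2).
exists e, y; split => //; first exact: py.1.
  by move=> t h1 h2; have [v1 v2] := window_widen h1 h2 (ltW ee2) (lexx t) (lexx t); exact: He2.
have base := primitive_ae_derivable py.
apply: lebesgue_aeS base => t Ht /andP[h1 h2] /andP[h3 h4]; apply: Ht.
by rewrite gt_max h1 h3 lt_min h2 h4.
Qed.

(** The lifting equation is solved from one point of the fibre over [gamma t0]. The projection of
    the solution has the derivative of [gamma] by [lift_mxK], and its logarithmic derivative is a
    combination of the horizontal rows of J. *)
Lemma horizontal_lift_near gamma t0 : AC_curve 0 1 gamma -> 0 <= t0 <= 1 ->
  exists e beta, [/\ 0 < e,
    forall s r, 0 <= s -> s <= r -> r <= 1 -> t0 - e < s -> r < t0 + e ->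
      AC_curve s r beta,
    (forall t, 0 <= t <= 1 -> t0 - e < t < t0 + e -> proj (beta t) = gamma t) &
    {ae mu, forall t, t0 - e < t < t0 + e -> curve_derivable beta t /\ perp (mc beta t)}].
Proof.
move=> acG t001.
have [x0 px0] : exists x, proj x = gamma t0 by case: hom => /(_ (gamma t0)).
pose c := chart_at x0; pose d := chart_at (gamma t0).
have [ac cx] : atlas c /\ cdom c x0 by split; [exact: atlas_chart_at|exact: mem_chart_at].
have [ad dg] : atlas d /\ cdom d (gamma t0) by split; [exact: atlas_chart_at|exact: mem_chart_at].
have dx : cdom d (proj x0) by rewrite px0.
have [J [pJ JN]] := horizontal_frame ac cx ad dx.
have Su : J *m proj_mx proj c d (cfun c x0) \in unitmx by rewrite JN unitmx1.
have lS i j : lip_near (cfun c x0) (fun u => (J *m proj_mx proj c d u) i j).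
  by apply: lip_near_mulmx => a b; [exact: lip_near_cst|exact: proj_mx_lip].
have [e1 [y [e10 iy de1 ae1]]] := primitive_at_center acG t001 ad dg.
have [r1 r10 Hr1] := near_unitmx lS Su.
have [r2 r20 Hr2] := proj_chart_near sproj ac cx ad dx.
have [|h [beta [h0 b0 cb acB pB]]] := ode_curve t0 ac cx iy
    (fun i j => lift_mx_lip sproj i j ac cx ad dx Su) (rho := Num.min r1 r2).
  by rewrite lt_min r10.
have cbt t : [/\ cdom c (beta t), J *m proj_mx proj c d (cfun c (beta t)) \in unitmx &
    cdom d (proj (beta t))].
  have [c1] := cb t; rewrite lt_min => /andP[c2 c3].
  exact: (And3 c1 (Hr1 _ c2) (Hr2 _ c1 c3)).
have z0h : t0 - h <= t0 <= t0 + h by rewrite gerBl lerDl ltW.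
have db0 : cdom d (proj (beta t0)) by rewrite b0.
have [e2 e20 He2] := AC_curve_map (submersion_C2map sproj) acB z0h ad db0.
have [e3 e30 He3] := AC_curve_map id_C2map acG t001 ad dg.
pose e := Num.min h (Num.min e1 (Num.min e2 e3)).
have [e0 eh ee1 ee2 ee3] : [/\ 0 < e, e <= h, e <= e1, e <= e2 & e <= e3].
  by rewrite /e !lt_min h0 e10 e20 e30 !ge_min !lexx !orbT.
exists e, beta; split => //.
- move=> s r _ sr _ s1 r1'.
  have [w1 _] := window_widen s1 r1' eh (lexx s) sr; have [_ w2] := window_widen s1 r1' eh sr (lexx r).
  exact: AC_curve_sub (ltW w1) (ltW w2) acB.
- move=> t t01 tw.
  suff Ed : (cfun d \o proj \o beta) t = (cfun d \o gamma) t.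
    have [_ _ dt] := cbt t; have [w1 w2] := andP tw.
    have [v1 v2] := window_widen w1 w2 ee1 (lexx t) (lexx t).
    rewrite -(cfunK ad dt) -[RHS](cfunK ad (de1 t v1 v2)); exact: congr1 Ed.
  (* [a, b] is the interval between t0 and t, in whichever order they come. *)
  have [a [b [[ab at0 t0b] [at_ tb] [a0 b1] [aw bw]]]] : exists a b, [/\ [/\ a <= b, a <= t0 & t0 <= b],
      a <= t /\ t <= b, 0 <= a /\ b <= 1 & t0 - e < a /\ b < t0 + e].
    have [[h1 h2] [h3 h4]] := (andP t01, andP t001); have [h5 h6] := andP tw.
    have [tt|/ltW tt] := leP t t0.
      by exists t, t0; do !split => //; rewrite ltrDl.
    by exists t0, t; do !split => //; rewrite gtrBl.
  have [u1 u2] := window_widen aw bw eh (lexx a) ab; have [_ u3] := window_widen aw bw eh ab (lexx b).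
  have [v1 _] := window_widen aw bw ee2 (lexx a) ab; have [_ v2] := window_widen aw bw ee2 ab (lexx b).
  have [x1 _] := window_widen aw bw ee3 (lexx a) ab; have [_ x2] := window_widen aw bw ee3 ab (lexx b).
  have AC1 := He2 a b (ltW u1) ab (ltW u3) v1 v2.
  have AC2 := He3 a b a0 ab b1 x1 x2.
  have E0 : (cfun d \o proj \o beta) t0 = (cfun d \o idfun \o gamma) t0.
    by rewrite /= b0 px0.
  apply: (eq_of_ae_derive AC1 AC2 at0 t0b E0 _ at_ tb).
  apply: lebesgue_aeS (lebesgue_aeI (primitive_ae_derivable pB) ae1) => q [q1 q2] /andP[aq qb] _ _.
  have qw : t0 - h < q < t0 + h by rewrite (lt_trans u1 aq) (lt_trans qb u3).
  have [d1 d2] := q1 qw.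
  have q01 : 0 < q < 1 by rewrite (le_lt_trans a0 aq) (lt_le_trans qb b1).
  have qw1 : t0 - e1 < q < t0 + e1.
    by have [-> ->] := window_widen aw bw ee1 (ltW aq) (ltW qb).
  have [_ d3] := q2 q01 qw1.
  have [cq Sq dq] := cbt q.
  have [_ d4] := derive1_proj sproj ac cq ad dq (acB.1 q) d1.
  rewrite d4 d2 -mulmxA (lift_mxK Sq) mulmx1; exact: esym d3.
apply: lebesgue_aeS (primitive_ae_derivable pB) => q H /andP[s1 s2].
have [w1 w2] := window_widen s1 s2 eh (lexx q) (lexx q).
have [|d1 d2] := H; first by rewrite w1.
have [cq Sq _] := cbt q; have dq := (derivable_chart ac cq (acB.1 q)).2 d1.
split; first exact: dq.
have h1 := etrans (esym (mc_chart ac cq (acB.1 q) dq)) d2.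
have -> : mc beta q = y q *m lift_coef proj c d J (cfun c (beta q)).
  by apply: (can_inj (mulmxK (ltrans_mx_unit ac cq))); rewrite h1 /lift_mx mulmxA.
exact: lift_coef_perp.
Qed.

Lemma iota_translate alpha y s r : AC_curve s r alpha ->
  {ae mu, forall t, s < t < r -> perp (mc alpha t)} ->
  AC_curve s r (fun t => alpha t * iota y)%g /\
  {ae mu, forall t, s < t < r -> perp (mc (fun t => alpha t * iota y)%g t)}.
Proof.
move=> acA pA; split; first exact: AC_curve_comp (right_C2map (iota y)) acA.
have [rs|sr] := leP r s.
  by apply: lebesgue_aeS pA => t _ /andP[t1 t2]; have := lt_le_trans (lt_trans t1 t2) rs; rewrite ltxx.
apply: lebesgue_aeS (lebesgue_aeI pA (AC_curve_ae_derivable (ltW sr) acA)) => t [p1 d1] tsr.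
rewrite (mc_right _ (acA.1 t) (d1 tsr)) -(iotaV sub).
exact: (Ad_lie_perp sub linv binv _ (p1 tsr)).
Qed.

Lemma horizontal_lift gamma : AC_curve 0 1 gamma ->
  exists alpha, [/\ AC_curve 0 1 alpha,
    (forall q, 0 <= q -> q <= 1 -> proj (alpha q) = gamma q) &
    {ae mu, forall q, 0 < q < 1 -> perp (mc alpha q)}].
Proof.
move=> acG; have [onto fib _] := hom; have [x px] := onto (gamma 0).
have [t0 t001|alpha [? ? ?] _] := @mc_sol_global R n G (fun _ v => perp v)
  (fun q y => proj y = gamma q) 0 1 ler01 _ x px; last by exists alpha.
have [e [beta [e0 acB pB mB]]] := horizontal_lift_near acG t001.
exists e => // s r s0 sr r1 sw rw z pz.
have inw q : s <= q -> q <= r -> t0 - e < q < t0 + e.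
  by move=> sq qr; have [-> ->] := window_widen sw rw (lexx e) sq qr.
have in1 q : s <= q -> q <= r -> 0 <= q <= 1.
  by move=> sq qr; rewrite (le_trans s0 sq) (le_trans qr r1).
(* The prescribed starting point z and [beta s] lie in the same fibre, so a right translate of
   [beta] by an element of K starts at z. *)
have /fib[y zE] : proj (beta s) = proj z by rewrite pz pB// ?in1 ?inw.
have mB' : {ae mu, forall t, s < t < r -> perp (mc beta t)}.
  apply: lebesgue_aeS mB => q H /andP[sq qr]; exact: (H (inw q (ltW sq) (ltW qr))).2.
have [ac2 m2] := iota_translate y (acB s r s0 sr r1 sw rw) mB'.
exists (fun t => beta t * iota y)%g; last by rewrite zE.
split => // q sq qr; rewrite -(pB q (in1 q sq qr) (inw q sq qr)).
by apply/esym/fib; exists y.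
Qed.

(** By [lift_coef_unique] a horizontal curve solves the lifting equation of its own projection.
    Curves with equal projections thus solve one and the same equation. *)
Lemma horizontal_lift_unique alpha beta : AC_curve 0 1 alpha -> AC_curve 0 1 beta ->
  (forall q, 0 <= q -> q <= 1 -> proj (alpha q) = proj (beta q)) ->
  {ae mu, forall q, 0 < q < 1 -> perp (mc alpha q)} ->
  {ae mu, forall q, 0 < q < 1 -> perp (mc beta q)} ->
  alpha 0 = beta 0 -> forall t, 0 <= t -> t <= 1 -> alpha t = beta t.
Proof.
move=> acA acB pAB hA hB; apply: curves_agree => // t0 t001 E0.
pose c := chart_at (alpha t0); pose d := chart_at (proj (alpha t0)).
have [ac cx] : atlas c /\ cdom c (alpha t0) by split; [exact: atlas_chart_at|exact: mem_chart_at].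
have [ad dx] : atlas d /\ cdom d (proj (alpha t0)) by split; [exact: atlas_chart_at|exact: mem_chart_at].
have [J [pJ JN]] := horizontal_frame ac cx ad dx.
have Su : J *m proj_mx proj c d (cfun c (alpha t0)) \in unitmx by rewrite JN unitmx1.
have lS i j : lip_near (cfun c (alpha t0)) (fun u => (J *m proj_mx proj c d u) i j).
  by apply: lip_near_mulmx => a b; [exact: lip_near_cst|exact: proj_mx_lip].
have acP := AC_curve_comp (submersion_C2map sproj) acA.
have [e1 [y [e10 iy de1 ae1]]] := primitive_at_center acP t001 ad dx.
have [r1 r10 Hr1] := near_unitmx lS Su.
have chart_near alpha' : AC_curve 0 1 alpha' -> alpha' t0 = alpha t0 ->
    exists2 e, 0 < e & forall t, t0 - e < t -> t < t0 + e -> cdom c (alpha' t) /\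
      J *m proj_mx proj c d (cfun c (alpha' t)) \in unitmx.
  move=> acG gt0; have cg : cdom c (alpha' t0) by rewrite gt0.
  have n1 : \forall t \near t0, cdom c (alpha' t) by exact: (acG.1 t0 _ (cdom_nbhs ac cg)).
  have n2 : \forall t \near t0, `|cfun c (alpha' t) - cfun c (alpha t0)| < r1.
    have hc : {for t0, continuous (cfun c \o alpha')}.
      exact: (continuous_comp (acG.1 t0) (cfun_continuous ac cg)).
    have /cvgrPdist_lt/(_ r1 r10) h' := hc.
    rewrite -gt0.
    by apply: filterS h' => s hs; exact: (eq_ind _ (fun z => z < r1) hs _ (distrC _ _)).
  have [e2 e20 h2] := near_ball n1; have [e3 e30 h3] := near_ball n2.
  exists (Num.min e2 e3); first by rewrite lt_min e20.
  have [l1 l2] : Num.min e2 e3 <= e2 /\ Num.min e2 e3 <= e3 by rewrite !ge_min !lexx orbT.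
  move=> t t1 t2; have [w1 w2] := window_widen t1 t2 l1 (lexx t) (lexx t).
  have [w3 w4] := window_widen t1 t2 l2 (lexx t) (lexx t).
  exact: (conj (h2 t w1 w2) (Hr1 _ (h3 t w3 w4))).
have [e2 e20 near2] := chart_near alpha acA erefl.
have [e3 e30 near3] := chart_near beta acB (esym E0).
exists c, m, (lift_mx proj c d J), y, (Num.min e1 (Num.min e2 e3)); split => //.
- by rewrite !lt_min e10 e20.
- by move=> i j; exact: lift_mx_lip.
set e := Num.min _ _.
have [ee1 ee2 ee3] : [/\ e <= e1, e <= e2 & e <= e3] by rewrite /e !ge_min !lexx !orbT.
have key alpha' : AC_curve 0 1 alpha' -> {ae mu, forall q, 0 < q < 1 -> perp (mc alpha' q)} ->
    (forall q, 0 <= q -> q <= 1 -> proj (alpha q) = proj (alpha' q)) ->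
    (forall t, t0 - e < t -> t < t0 + e -> cdom c (alpha' t) /\
      J *m proj_mx proj c d (cfun c (alpha' t)) \in unitmx) ->
    {ae mu, forall t, 0 < t < 1 -> t0 - e < t < t0 + e -> derivable (cfun c \o alpha') t 1 ->
       derive1 (cfun c \o alpha') t = y t *m lift_mx proj c d J (cfun c (alpha' t))}.
  move=> acG hG pG cG; apply: lebesgue_aeS (lebesgue_aeI hG ae1) => t [hG_t ae1_t] t01 /andP[tw1 tw2] dt.
  have [ct St] := cG t tw1 tw2.
  have [w1 w2] := window_widen tw1 tw2 ee1 (lexx t) (lexx t).
  have tw' : t0 - e1 < t < t0 + e1 by rewrite w1 w2.
  have [_ yE] := ae1_t t01 tw'.
  have [t1 t2] := andP t01.
  have dpt : cdom d (proj (alpha' t)) by rewrite -(pG t (ltW t1) (ltW t2)); exact: de1.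
  have dq := (derivable_chart ac ct (acG.1 t)).2 dt.
  have [_ d4] := derive1_proj sproj ac ct ad dpt (acG.1 t) dt.
  have mcE := mc_chart ac ct (acG.1 t) dq.
  have En : \forall s \near t, (cfun d \o (proj \o alpha)) s = (cfun d \o proj \o alpha') s.
    near=> s; apply: (congr1 (cfun d)); apply: pG; apply/ltW; near: s.
      exact: lt_nbhsr.
    exact: lt_nbhsl.
  have yE' : y t = mc alpha' t *m proj_mx proj c d (cfun c (alpha' t)).
    rewrite -yE; apply: (etrans (y := derive1 (cfun d \o proj \o alpha') t)).
      by rewrite !derive1E; exact: near_eq_derive.
    by rewrite d4 mcE /proj_mx mulmxA.
  rewrite mcE (lift_coef_unique ac ct ad dpt pJ St (hG_t t01)) -yE' /lift_mx mulmxA.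
  by [].
move=> alpha' [->|->].
  apply: (key alpha acA hA) => [q _ _|t tw1 tw2]; first exact: erefl.
  by have [w1 w2] := window_widen tw1 tw2 ee2 (lexx t) (lexx t); exact: near2.
apply: (key beta acB hB pAB) => t tw1 tw2.
by have [w1 w2] := window_widen tw1 tw2 ee3 (lexx t) (lexx t); exact: near3.
Unshelve. all: by end_near. Qed.

End horizontal_lifts.

(** * Square root velocities *)

Section logarithmic_derivative.
Context {R : realType}.
Notation mu := (@lebesgue_measure R).

Lemma row_integrable_cat {n : nat} (r : R) (p1 p2 : R -> 'rV[R]_n) :
  row_integrable p1 -> row_integrable p2 ->
  row_integrable (fun t => if t <= r then p1 t else p2 t).
Proof.
move=> i1 i2 i.
have cut (A : set R) p : measurable A -> row_integrable p ->
    mu.-integrable setT (EFin \o (fun t => p t 0 i * (\1_A t : R))).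
  move=> mA ip.
  apply: (@integrableMl _ _ _ mu setT measurableT (EFin \o (fun x => p x 0 i))
    (\1_A : R -> R) (ip i)); first exact: measurable_indic.
  exists 1; split => [|M CM x _]; first by rewrite num_real.
  by apply: le_trans (ltW CM); rewrite /= indicE; case: (_ \in _); rewrite ?normr1 ?normr0.
have m1 : measurable (`]-oo, r] : set R) by exact: measurable_itv.
have m2 : measurable (`]r, +oo[ : set R) by exact: measurable_itv.
have h := integrableD measurableT (cut _ p1 m1 i1) (cut _ p2 m2 i2).
apply: eq_integrable h => // t _ /=; rewrite -EFinD; congr EFin.
rewrite !indicE; case: (leP t r) => tr.
  rewrite mem_set /= ?in_itv//= memNset ?mulr1 ?mulr0 ?addr0//=.
  by rewrite in_itv /= andbT; apply/negP; rewrite -leNgt.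
rewrite memNset /= ?mem_set ?mulr1 ?mulr0 ?add0r//= in_itv /= ?andbT//.
by apply/negP; rewrite -ltNge.
Qed.

(** In a chart the logarithmic derivative is the coordinate derivative, which is integrable, times
    the inverse of [ltrans_mx], which is bounded along a short piece of the curve. *)
Lemma mc_integrable {n : nat} {G : lieGroupType R n} (alpha : R -> G) : AC_curve 0 1 alpha ->
  exists p, row_integrable p /\ {ae mu, forall t, 0 < t < 1 -> mc alpha t = p t}.
Proof.
move=> acA; pose P s r := exists p, row_integrable p /\
  {ae mu, forall t, s < t < r -> mc alpha t = p t}.
apply: (@cousin_ind R 0 1 P ler01) => [t0 t001|s r t _ _ _ _ [p [ip mp]] [q [iq mq]]]; last first.
  exists (fun t => if t <= r then p t else q t); split; first exact: row_integrable_cat.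
  apply: (@lebesgue_ae_cat _ _ s r t).
    by apply: lebesgue_aeS mp => x H /andP[sx xr]; rewrite (ltW xr) H// sx.
  apply: lebesgue_aeS mq => x H /andP[rx xt].
  by rewrite ifN -?ltNge// H// rx.
pose d := chart_at (alpha t0).
have [ad dx] : atlas d /\ cdom d (alpha t0) by split; [exact: atlas_chart_at|exact: mem_chart_at].
have [e1 [y [e10 iy de1 ae1]]] := primitive_at_center acA t001 ad dx.
pose B u : 'M[R]_n := (\det (ltrans_mx d u))^-1 *: \adj (ltrans_mx d u).
have lB (ij : 'I_n * 'I_n) : lip_near (cfun d (alpha t0)) (fun u => B u ij.1 ij.2).
  have -> : (fun u => B u ij.1 ij.2) =
      (fun u => (\det (ltrans_mx d u))^-1 * (\adj (ltrans_mx d u)) ij.1 ij.2).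
    by apply/funext => u; exact: mxE.
  by apply: lip_near_invmx; [move=> i j; exact: ltrans_mx_lip|exact: ltrans_mx_unit].
have [r [L [r0 L0 HL]]] := lip_near_fin lB.
have n2 : \forall t \near t0, `|cfun d (alpha t) - cfun d (alpha t0)| < r.
  have hc : {for t0, continuous (cfun d \o alpha)}.
    exact: (continuous_comp (acA.1 t0) (cfun_continuous ad dx)).
  have /cvgrPdist_lt/(_ r r0) h' := hc.
  by apply: filterS h' => s hs; exact: (eq_ind _ (fun z => z < r) hs _ (distrC _ _)).
have [e2 e20 He2] := near_ball n2.
pose e := Num.min e1 e2 / 2.
have [e0 ee1 ee2] : [/\ 0 < e, e < e1 & e < e2].
  have m0 : 0 < Num.min e1 e2 by rewrite !lt_min e10.
  have [m1 m2] : Num.min e1 e2 <= e1 /\ Num.min e1 e2 <= e2 by rewrite !ge_min !lexx orbT.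
  by rewrite /e; move: (Num.min _ _) m0 m1 m2 => x *; split; lra.
pose a := t0 - e; pose b := t0 + e.
have ab : a <= b by rewrite /a /b; lra.
(* Clipping the time keeps w near the base point for every t, so [B (w t)] is bounded and measurable
   on the line. *)
pose w t := cfun d (alpha (clip a b t)).
have cw t : t0 - e2 < clip a b t /\ clip a b t < t0 + e2.
  by have := clip_ge a b t; have := clip_le t ab; rewrite /a /b; lra.
have wd t : cdom d (alpha (clip a b t)).
  by apply: de1; have := clip_ge a b t; have := clip_le t ab; rewrite /a /b; lra.
have wr t : `|w t - cfun d (alpha t0)| < r by have [c1 c2] := cw t; exact: He2.
have contw : continuous w.
  have cclip : continuous (clip a b).
    move=> x; apply/cvgrPdist_lt => eps eps0; near=> z.
    apply: le_lt_trans (clip_lipschitz a b z x) _.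
    by near: z; apply: cvgr_dist_lt; [exact: cvg_id|].
  move=> t; apply: (@continuous_comp _ _ _ (fun t => alpha (clip a b t)) (cfun d)).
    exact: (continuous_comp (cclip t) (acA.1 (clip a b t))).
  exact: (cfun_continuous ad (wd t)).
have mB i j : measurable_fun setT (fun t => B (w t) i j).
  apply: continuous_measurable_fun => t; apply/cvgrPdist_le => eps eps0; near=> s.
  apply: le_trans (HL (i, j) _ _ (wr t) (wr s)) _.
  have ws : `|w t - w s| <= eps / (L + 1).
    near: s; apply: cvgr_dist_le; first exact: contw.
    by rewrite divr_gt0// ltr_wpDl.
  apply: le_trans (ler_wpM2l L0 ws) _.
  rewrite mulrCA ger_pMr// ler_pdivrMr ?ltr_wpDl//; lra.
have bB t i j : `|B (w t) i j| <= \sum_i \sum_j `|B (cfun d (alpha t0)) i j| + L * r.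
  have h1 : `|B (w t) i j - B (cfun d (alpha t0)) i j| <= L * r.
    apply: le_trans (HL (i, j) _ _ (wr t) _) _; first by rewrite subrr normr0.
    by rewrite ler_wpM2l// ltW.
  have h2 : `|B (cfun d (alpha t0)) i j| <= \sum_i \sum_j `|B (cfun d (alpha t0)) i j|.
    rewrite (bigD1 i)//= (bigD1 j)//= -addrA lerDl addr_ge0 ?sumr_ge0// => i' _.
    by rewrite sumr_ge0.
  have tri (x z : R) : `|x| <= `|z| + `|x - z|.
    by rewrite -{1}(subrK z x) [leRHS]addrC; exact: ler_normD.
  exact: (le_trans (tri _ _) (lerD h2 h1)).
exists e => // s q s0 sq q1 sw qw; exists (fun t => y t *m B (w t)); split.
  exact: row_integrable_mulmx mB bB.
have ader := AC_curve_ae_derivable ler01 acA.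
apply: lebesgue_aeS (lebesgue_aeI ae1 ader) => t [H1 H2] /andP[st tq].
have t01 : 0 < t < 1 by rewrite (le_lt_trans s0 st) (lt_le_trans tq q1).
have [w1 w2] := window_widen sw qw (ltW ee1) (ltW st) (ltW tq).
have [w3 w4] := window_widen sw qw (lexx e) (ltW st) (ltW tq).
have [|_ <-] := H1 t01; first by rewrite w1.
have ct := de1 t w1 w2.
rewrite (mc_chart ad ct (acA.1 t) (H2 t01)).
have wE : w t = cfun d (alpha t) by rewrite /w clip_id// ltW.
have Eu := ltrans_mx_unit ad ct; rewrite unitmxE in Eu.
by rewrite wE /B -mulmxA -scalemxAr mul_mx_adj scale_scalar_mx mulVr// mulmx1.
Unshelve. all: by end_near. Qed.

End logarithmic_derivative.

Section norm_and_square_root.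
Context {R : realType} {n : nat} {G : lieGroupType R n}.
Variable g : G -> 'rV[R]_n -> 'rV[R]_n -> R.
Hypothesis riem : riemannian_metric g.
Notation mu := (@lebesgue_measure R).
Local Notation N := (metric_norm g 1%g).

Lemma metric_norm_sqr v : N v ^+ 2 = g 1%g v v.
Proof. by rewrite sqr_sqrtr//; exact: metric_ge0. Qed.

Lemma metric_norm_ge0 v : 0 <= N v.
Proof. exact: sqrtr_ge0. Qed.

Lemma metric_normZ a v : N (a *: v) = `|a| * N v.
Proof.
rewrite /metric_norm (metricZl riem) (metricZr riem) mulrA -expr2.
by rewrite sqrtrM ?sqr_ge0// sqrtr_sqr.
Qed.

Lemma metric_norm_eq0 v : N v = 0 -> v = 0.
Proof.
move=> v0; apply: (metric_eq0 riem (x := 1%g)).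
by rewrite -metric_norm_sqr v0 expr0n.
Qed.

Lemma metric_cauchy u v : `|g 1%g u v| <= N u * N v.
Proof.
have [->|v0] := eqVneq v 0.
  by rewrite (Defs.metric_sym riem) (metric0l riem) normr0 mulr_ge0// metric_norm_ge0.
have gv := metric_pos riem 1%g v0.
rewrite -(@ler_pXn2r _ 2)// ?nnegrE ?mulr_ge0 ?metric_norm_ge0//.
rewrite exprMn !metric_norm_sqr real_normK ?num_real//.
(* The coefficient for which u - a v is orthogonal to v. *)
pose a := g 1%g u v / g 1%g v v.
have := metric_ge0 riem 1%g (u + (- a) *: v).
rewrite (metricDl riem) !(metricDr riem) !(metricZl riem) !(metricZr riem).
rewrite (Defs.metric_sym riem 1%g v u) => h.
have aE : a * g 1%g v v = g 1%g u v by rewrite /a divfK// gt_eqF.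
move: aE h gv; move: (g 1%g u v) (g 1%g v v) (g 1%g u u) (a) => x z w b <- h z0.
nra.
Qed.

(** Coordinates are inner products with the dual basis b, to which Cauchy-Schwarz applies. With
    [metric_norm_le_sum] this makes N equivalent to the coordinate norm, so integrability may be
    tested in either. *)
Lemma coord_metric_norm : exists2 C, 0 <= C & forall (v : 'rV[R]_n) i, `|v 0 i| <= C * N v.
Proof.
have Gu : gram g 1%g \in unitmx.
  rewrite -row_free_unit -kermx_eq0; apply/rowV0P => v /sub_kermxP vG.
  by apply: (metric_eq0 riem (x := 1%g)); rewrite (gramE riem) vG mul0mx mxE.
pose b i : 'rV[R]_n := (invmx (gram g 1%g) *m delta_mx i 0)^T.
have bE (v : 'rV[R]_n) i : v 0 i = g 1%g v (b i).
  by rewrite (gramE riem) trmxK -mulmxA mulKVmx// -colE mxE.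
exists (\sum_i N (b i)) => [|v i]; first by apply: sumr_ge0 => i _; exact: metric_norm_ge0.
rewrite bE; apply: le_trans (metric_cauchy _ _) _.
rewrite mulrC ler_wpM2r ?metric_norm_ge0// (bigD1 i)//= lerDl.
by apply: sumr_ge0 => j _; exact: metric_norm_ge0.
Qed.

Lemma metric_norm_le_sum : exists2 C, 0 <= C & forall v : 'rV[R]_n, N v <= C * \sum_i `|v 0 i|.
Proof.
pose C2 := \sum_i \sum_j `|gram g 1%g i j|.
have C20 : 0 <= C2 by apply: sumr_ge0 => i _; apply: sumr_ge0.
exists (Num.sqrt C2) => [|v]; first exact: sqrtr_ge0.
have S0 : 0 <= \sum_i `|v 0 i| by apply: sumr_ge0.
have le1 i : `|v 0 i| <= \sum_i `|v 0 i| by rewrite (bigD1 i)//= lerDl sumr_ge0.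
rewrite -(@ler_pXn2r _ 2)// ?nnegrE ?mulr_ge0 ?metric_norm_ge0 ?sqrtr_ge0//.
rewrite metric_norm_sqr exprMn sqr_sqrtr// (gramE riem).
apply: le_trans (ler_norm _) _; rewrite mxE; apply: le_trans (ler_norm_sum _ _ _) _.
rewrite /C2 exchange_big /= mulr_suml; apply: ler_sum => j _; rewrite !mxE normrM mulr_suml.
apply: le_trans (ler_wpM2r (normr_ge0 _) (ler_norm_sum _ _ _)) _.
rewrite mulr_suml; apply: ler_sum => i _; rewrite normrM mulrAC mulrC expr2.
by apply: ler_wpM2l => //; exact: ler_pM.
Qed.

Lemma measurable_metric (D : set R) (q : R -> 'rV[R]_n) : measurable D ->
  (forall i, measurable_fun D (fun t => q t 0 i)) ->
  measurable_fun D (fun t => g 1%g (q t) (q t)).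
Proof.
move=> mD mq.
have -> : (fun t => g 1%g (q t) (q t)) =
    (fun t => \sum_j (\sum_i q t 0 i * gram g 1%g i j) * q t 0 j).
  apply/funext => t; rewrite (gramE riem) mxE; apply: eq_bigr => j _.
  by rewrite !mxE.
apply: measurable_sum => j; apply: measurable_funM; last exact: mq.
by apply: measurable_sum => i; apply: measurable_funM; [exact: mq|exact: measurable_cst].
Qed.

Lemma measurable_metric_norm (D : set R) (q : R -> 'rV[R]_n) : measurable D ->
  (forall i, measurable_fun D (fun t => q t 0 i)) ->
  measurable_fun D (fun t => N (q t)).
Proof.
move=> mD mq; apply: (@measurableT_comp _ _ _ _ _ _ (@Num.sqrt R)); last exact: measurable_metric.
by apply: continuous_measurable_fun; exact: sqrt_continuous.
Qed.

(* q = p / sqrt |p|, with inverse p = |q| q; it vanishes at p = 0. *)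
Definition root_scale (p : 'rV[R]_n) := (Num.sqrt (N p))^-1 *: p.

Lemma root_scaleK p : N (root_scale p) *: root_scale p = p.
Proof.
have [->|p0] := eqVneq p 0; first by rewrite /root_scale !scaler0.
have Np : 0 < N p by rewrite lt_def metric_norm_ge0 andbT; apply: contra_neq p0; exact: metric_norm_eq0.
have sp : 0 < Num.sqrt (N p) by rewrite sqrtr_gt0.
rewrite /root_scale metric_normZ ger0_norm ?invr_ge0 ?sqrtr_ge0//.
rewrite scalerA -{2}(sqr_sqrtr (ltW Np)) expr2 mulrA mulVf ?gt_eqF// mul1r mulfV ?gt_eqF//.
by rewrite scale1r.
Qed.

Lemma scale_rootK q : root_scale (N q *: q) = q.
Proof.
have [->|q0] := eqVneq q 0; first by rewrite /root_scale !scaler0.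
have Nq : N q != 0 by apply: contra_neq q0; exact: metric_norm_eq0.
rewrite /root_scale metric_normZ ger0_norm ?metric_norm_ge0// -expr2 sqrtr_sqr.
by rewrite ger0_norm ?metric_norm_ge0// scalerA mulVf// scale1r.
Qed.

(** The square of the norm of [root_scale p] is the norm of p. *)
Lemma root_scale_integrable p : row_integrable p -> square_integrable g (root_scale \o p).
Proof.
move=> ip.
have mp i : measurable_fun setT (fun t => p t 0 i).
  by apply: (measurable_EFinP _ _).1; exact: (measurable_int _ (ip i)).
have mN : measurable_fun setT (fun t => N (p t)) by exact: measurable_metric_norm.
split=> [i|].
  have -> : (fun t => (root_scale \o p) t 0 i) = (fun t => N (p t) `^ (- 2^-1) * p t 0 i).
    by apply/funext => t; rewrite /= mxE powRN powR12_sqrt// metric_norm_ge0.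
  apply: measurable_funTS; apply: measurable_funM; last exact: mp.
  exact: (measurableT_comp (measurable_powR _)).
have [C C0 HC] := metric_norm_le_sum.
have E t : metric_norm g 1%g ((root_scale \o p) t) ^+ 2 = N (p t).
  rewrite /= expr2 -{1}[N (root_scale _)]ger0_norm ?metric_norm_ge0//.
  by rewrite -metric_normZ root_scaleK.
under eq_integral do rewrite E.
have iN : mu.-integrable setT (EFin \o (fun t => N (p t))).
  have h : mu.-integrable setT (EFin \o (fun t => C * \sum_i `|p t 0 i|)).
    by have := integrableZl measurableT C (integrable_sum_norm ip); apply: eq_integrable.
  apply: (le_integrable measurableT _ _ h); first exact/measurable_EFinP.
  move=> t _; rewrite /= lee_fin ger0_norm ?metric_norm_ge0//.
  exact: le_trans (HC (p t)) (ler_norm _).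
have iN' : mu.-integrable `[0 : R, 1] (EFin \o (fun t => N (p t))).
  by apply: integrableS iN => //; exact: measurable_itv.
by apply: integrable_lty iN'; exact: measurable_itv.
Qed.

Lemma square_integrable_scale q : square_integrable g q ->
  exists p, row_integrable p /\ forall t, 0 <= t <= 1 -> p t = N (q t) *: q t.
Proof.
move=> [mq iq]; have [C C0 HC] := coord_metric_norm.
(* Square integrability concerns [0, 1] only, whereas [row_integrable] refers to the whole line;
   hence the extension by 0. *)
pose p (t : R) : 'rV[R]_n := if 0 <= t <= 1 then N (q t) *: q t else 0.
exists p; split => [i|t t01]; last by rewrite /p t01.
have mD : measurable (`[0, 1] : set R) by exact: measurable_itv.
have mN : measurable_fun `[0 : R, 1] (fun t => N (q t)) by exact: measurable_metric_norm.
have -> : EFin \o (fun t => p t 0 i) = (fun t => (N (q t) * q t 0 i)%:E) \_ `[0 : R, 1].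
  apply/funext => t; rewrite /= patchE mem_setE in_itv /= /p.
  by case: ifP => _; rewrite mxE.
apply/integrable_restrict => //; rewrite setTI.
have i2 : mu.-integrable `[0 : R, 1] (EFin \o (fun t => N (q t) ^+ 2)).
  apply/integrableP; split.
    by apply/measurable_EFinP; exact: measurable_funX.
  by under eq_integral => t _ do rewrite /= ger0_norm ?sqr_ge0//.
have h : mu.-integrable `[0 : R, 1] (EFin \o (fun t => C * N (q t) ^+ 2)).
  have := integrableZl _ C i2; move=> /(_ (measurable_itv _)).
  by apply: eq_integrable => //; exact: measurable_itv.
apply: le_integrable h; first exact: measurable_itv.
  by apply/measurable_EFinP; apply: measurable_funM => //; exact: mq.
move=> t _; rewrite /= lee_fin normrM ger0_norm ?metric_norm_ge0//.
apply: le_trans (ler_wpM2l (metric_norm_ge0 _) (HC (q t) i)) _.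
by rewrite mulrCA expr2 ler_norm.
Qed.

End norm_and_square_root.

Section unit_interval_restriction.
Context {R : realType}.
Notation mu := (@lebesgue_measure R).

Lemma eq_unit_interval {T : Type} (f h : unit_interval R -> T) :
  (forall t, 0 <= t -> t <= 1 -> f (clamp t) = h (clamp t)) -> f = h.
Proof.
move=> fh; apply/funext => t; rewrite -(clamp_val t).
have [t0 t1] := clamp_itv (val t); rewrite clamp_val in t0 t1.
exact: fh.
Qed.

Lemma lebesgue_ae_closed (P : R -> Prop) : {ae mu, forall t, 0 < t < 1 -> P t} ->
  {ae mu, forall t, 0 <= t <= 1 -> P t}.
Proof.
move=> h; apply: lebesgue_aeS (lebesgue_aeI h (lebesgue_aeI (@lebesgue_ae_neq R 0) (@lebesgue_ae_neq R 1))).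
by move=> t [H [t0 t1]] /andP[h0 h1]; apply: H; rewrite !lt_neqAle h0 h1 eq_sym t0 t1.
Qed.

Lemma AC_curve_eq {n : nat} {M : manifoldType R n} (alpha beta : R -> M) a b :
  continuous beta -> (forall t, a <= t -> t <= b -> alpha t = beta t) ->
  AC_curve a b alpha -> AC_curve a b beta.
Proof.
move=> cb ab [_ H]; split => // t tab.
have [c [d [ac ca d0 Hd]]] := H t tab; have [t1 t2] := andP tab.
exists c, d; split => //; first by rewrite -ab.
move=> s r as_ sr rb ts rt; apply: eq_AC (Hd s r as_ sr rb ts rt) => q sq qr.
by rewrite /= ab// ?(le_trans as_)// (le_trans qr).
Qed.

Lemma ac_curves_restrict {n : nat} {M : manifoldType R n} (beta : R -> M) :
  AC_curve 0 1 beta -> ac_curves M (fun t => beta (val t)).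
Proof.
move=> acB; apply/ac_curvesP; apply: (AC_curve_eq _ _ acB).
  have cu := continuous_unit_val acB.1.
  by move=> t; exact: (continuous_comp (@continuous_clamp R t) (cu (clamp t))).
by move=> t t0 t1; exact: (esym (congr1 beta (val_clamp t0 t1))).
Qed.

Lemma ac_curves_comp {m n : nat} {M : manifoldType R m} {N : manifoldType R n} (f : M -> N)
  alpha : C2map f -> ac_curves M alpha -> ac_curves N (f \o alpha).
Proof. by move=> Cf /ac_curvesP acA; apply/ac_curvesP; exact: AC_curve_comp Cf acA. Qed.

Lemma mc_restrict {n : nat} {G : lieGroupType R n} (beta : R -> G) t : 0 < t < 1 ->
  mc ((fun t : unit_interval R => beta (val t)) \o @clamp R) t = mc beta t.
Proof.
move=> /andP[t0 t1]; apply: near_eq_mc; near=> s.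
apply: (congr1 beta); apply: val_clamp; apply/ltW; near: s; [exact: lt_nbhsr|exact: lt_nbhsl].
Unshelve. all: by end_near. Qed.

End unit_interval_restriction.

Section square_root_velocity.
Context {R : realType} {n : nat} {G : lieGroupType R n}.
Variable g : G -> 'rV[R]_n -> 'rV[R]_n -> R.
Hypotheses (riem : riemannian_metric g) (linv : left_invariant g).
Notation mu := (@lebesgue_measure R).
Local Notation N := (metric_norm g 1%g).
Implicit Types alpha beta : unit_interval R -> G.

(** Left invariance turns the norm at alpha(t) into the norm at 1, and the separate case of zero
    velocity agrees with [root_scale] at 0. *)
Lemma srvE alpha t : srv g alpha t = root_scale g (mc (alpha \o @clamp R) t).
Proof.
rewrite /srv; have -> : velocity alpha t = vel (alpha \o @clamp R) t by [].
case: eqP => [v0|_].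
  rewrite /mc v0 /root_scale; have -> : ltrans_inv ((alpha \o @clamp R) t) 0 = 0 by exact: linear0.
  by rewrite scaler0.
by rewrite /root_scale /metric_norm (left_invariant_norm linv).
Qed.

(** Square integrability puts q into its own class; without such a representative a class can be
    empty. No such condition is placed on f, which will be [srv g alpha]. *)
Lemma L2_classP f q : square_integrable g q ->
  L2_class g f = L2_class g q <-> {ae mu, forall t, 0 <= t <= 1 -> f t = q t}.
Proof.
move=> sq; split=> [E|E].
  have : L2_class g q q by split => //; apply: aeW.
  by rewrite -E => -[_]; apply: lebesgue_aeS => t H t01; rewrite H.
apply/seteqP; split=> p [sp pE]; split => //.
  by apply: lebesgue_aeS (lebesgue_aeI pE E) => t [H1 H2] t01; rewrite H1// H2.
by apply: lebesgue_aeS (lebesgue_aeI pE E) => t [H1 H2] t01; rewrite H1// H2.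
Qed.

(** Replaces the pointwise defined [srv g alpha] by a representative built from an integrable p, to
    which the inverse formula p = |q| q applies. *)
Lemma srv_integrable alpha : ac_curves G alpha -> exists p, [/\ row_integrable p,
  {ae mu, forall t, 0 < t < 1 -> mc (alpha \o @clamp R) t = p t},
  square_integrable g (root_scale g \o p) &
  L2_class g (srv g alpha) = L2_class g (root_scale g \o p)].
Proof.
move=> /ac_curvesP/mc_integrable[p [ip mp]]; exists p.
have sp := root_scale_integrable riem ip; split => //.
apply/(L2_classP _ sp); apply: lebesgue_ae_closed; apply: lebesgue_aeS mp => t H t01.
by rewrite srvE H.
Qed.

Lemma srv_map_inj alpha beta : ac_curves G alpha -> ac_curves G beta ->
  srv_map g alpha = srv_map g beta -> alpha = beta.
Proof.
move=> acA acB EQ.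
have E0 : alpha (clamp 0) = beta (clamp 0) := congr1 fst EQ.
have E : L2_class g (srv g alpha) = L2_class g (srv g beta) := congr1 snd EQ.
have [p [ip mp sp cp]] := srv_integrable acA; have [q [iq mq sq cq]] := srv_integrable acB.
apply: eq_unit_interval.
move/ac_curvesP in acA; move/ac_curvesP in acB.
apply: (mc_unique iq acA acB _ mq E0).
have pq := (L2_classP _ sq).1 (etrans (esym cp) (etrans E cq)).
apply: lebesgue_aeS (lebesgue_aeI mp pq) => t [H1 H2] t01.
have [t0 t1] := andP t01.
have tc : 0 <= t <= 1 by rewrite !ltW.
exact: (etrans (H1 t01) (etrans (esym (root_scaleK riem (p t)))
  (etrans (congr1 (fun v => N v *: v) (H2 tc)) (root_scaleK riem (q t))))).
Qed.

Lemma srv_map_onto x q : square_integrable g q ->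
  exists2 alpha, ac_curves G alpha & srv_map g alpha = (x, L2_class g q).
Proof.
move=> sq; have [p [ip pE]] := square_integrable_scale riem sq.
have [beta [acB b0 mB]] := mc_exists x ip.
exists (fun t => beta (val t)); first exact: ac_curves_restrict.
rewrite /srv_map val_clamp ?lexx ?ler01// b0; congr (_, _).
apply/(L2_classP _ sq); apply: lebesgue_ae_closed; apply: lebesgue_aeS mB => t H t01.
have [t0 t1] := andP t01.
by rewrite srvE mc_restrict// H// pE ?ltW// (scale_rootK riem).
Qed.

End square_root_velocity.

(** * Compatibility with the action of K *)

Section subgroup_action.
Context {R : realType} {n k : nat} {G : lieGroupType R n} {K : lieGroupType R k}.
Variables (iota : K -> G) (g : G -> 'rV[R]_n -> 'rV[R]_n -> R).
Hypotheses (sub : lie_subgroup iota) (riem : riemannian_metric g)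
  (linv : left_invariant g) (binv : bi_invariant_wrt iota g).
Notation mu := (@lebesgue_measure R).
Local Notation N := (metric_norm g 1%g).
Local Notation perp := (lie_perp iota g).
Implicit Types alpha beta : unit_interval R -> G.

Definition right_translate alpha y : unit_interval R -> G := fun t => (alpha t * iota y)%g.

Lemma ac_right_translate alpha y : ac_curves G alpha -> ac_curves G (right_translate alpha y).
Proof. exact: ac_curves_comp (right_C2map (iota y)). Qed.

Lemma metric_norm_Ad y v : N (Ad (iota y) v) = N v.
Proof. by rewrite /metric_norm (Ad_isometry sub linv binv). Qed.

Lemma AdZ (x : G) a v : Ad x (a *: v) = a *: Ad x v.
Proof. exact: linearZ. Qed.

Lemma square_integrable_Ad y q : square_integrable g q -> square_integrable g (Ad (iota y) \o q).
Proof.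
move=> [mq iq]; split => [i|].
  have -> : (fun t => (Ad (iota y) \o q) t 0 i) =
      (fun t => \sum_j q t 0 j * lin1_mx (Ad (iota y)) j i).
    apply/funext => t; rewrite /= -[LHS](congr1 (fun v : 'rV[R]_n => v 0 i) (mul_rV_lin1 _ (q t))).
    by rewrite mxE.
  by apply: measurable_sum => j; apply: measurable_funM; [exact: mq|exact: measurable_cst].
by under eq_integral do rewrite /= metric_norm_Ad.
Qed.

Lemma L2_class_Ad y f : [set Ad (iota y)^-1%g \o q | q in L2_class g f] =
  L2_class g (Ad (iota y)^-1%g \o f).
Proof.
apply/seteqP; split=> [_ [q [sq qf] <-]|p [sp pf]].
  split; first by rewrite -(iotaV sub); exact: square_integrable_Ad.
  by apply: lebesgue_aeS qf => t H t01; rewrite /= H.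
exists (Ad (iota y) \o p); last by apply/funext => t /=; rewrite AdK.
split; first exact: square_integrable_Ad.
by apply: lebesgue_aeS pf => t H t01; rewrite /= H//= AdVK.
Qed.

Lemma srv_right_translate alpha y : ac_curves G alpha ->
  srv_map g (right_translate alpha y) = K_act iota (srv_map g alpha) y.
Proof.
move=> acA; rewrite /K_act /= L2_class_Ad /srv_map; congr (_, _).
have [p [ip mp sp cp]] := srv_integrable riem linv acA.
have [q [iq mq sq cq]] := srv_integrable riem linv (ac_right_translate y acA).
have sAp : square_integrable g (Ad (iota y)^-1%g \o (root_scale g \o p)).
  by rewrite -(iotaV sub); exact: square_integrable_Ad.
move/(L2_classP _ sp) in cp.
apply: (etrans (y := L2_class g (Ad (iota y)^-1%g \o (root_scale g \o p)))); last first.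
  apply/esym; apply/(L2_classP _ sAp).
  by apply: lebesgue_aeS cp => t H t01; rewrite /= H.
apply/(L2_classP _ sAp); apply: lebesgue_ae_closed.
move/ac_curvesP in acA; have dA := AC_curve_ae_derivable ler01 acA.
apply: lebesgue_aeS (lebesgue_aeI mp dA) => t [H1 H2] t01.
rewrite (srvE linv).
have -> : mc (right_translate alpha y \o @clamp R) t = Ad (iota y)^-1%g (p t).
  by rewrite -H1//; exact: (mc_right (iota y) (acA.1 t) (H2 t01)).
by rewrite /root_scale /= AdZ -(iotaV sub) metric_norm_Ad.
Qed.

Lemma root_scale_perp p : perp (root_scale g p) <-> perp p.
Proof.
split=> h; last exact: (lie_perpZ riem).
by rewrite -(root_scaleK riem p); exact: (lie_perpZ riem).
Qed.

Lemma L2_space_srv alpha : ac_curves G alpha ->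
  L2_space g perp (L2_class g (srv g alpha)) <->
  {ae mu, forall t, 0 < t < 1 -> perp (mc (alpha \o @clamp R) t)}.
Proof.
move=> acA; have [p [ip mp sp cp]] := srv_integrable riem linv acA; rewrite cp; split.
  move=> [q [sq pq] /esym/(L2_classP _ sq) E].
  apply: lebesgue_aeS (lebesgue_aeI mp (lebesgue_aeI pq E)) => t [H1 [H2 H3]] t01.
  have tc : 0 <= t <= 1 by have [t0 t1] := andP t01; rewrite !ltW.
  by rewrite H1//; apply/root_scale_perp; rewrite -[root_scale _ _]/((root_scale g \o p) t) H3//; exact: H2.
move=> hp; exists (root_scale g \o p) => //; split => //.
apply: lebesgue_ae_closed; apply: lebesgue_aeS (lebesgue_aeI mp hp) => t [H1 H2] t01.
by apply/root_scale_perp; rewrite -H1//; exact: H2.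
Qed.

(** Q is injective and carries right translation of curves to the action, so the group law is
    applied to curves, where it is associativity in G. *)
Lemma K_orbit_translate alpha beta : ac_curves G alpha -> ac_curves G beta ->
  K_orbit iota (srv_map g alpha) = K_orbit iota (srv_map g beta) <->
  exists y, beta = right_translate alpha y.
Proof.
move=> acA acB; split=> [E|[y yE]].
  (* The chosen element of the orbit is the image under Q of the translate of [beta] by 1, so
     injectivity of Q compares two translated curves. *)
  have : K_orbit iota (srv_map g beta) (K_act iota (srv_map g beta) 1%g) by exists 1%g.
  rewrite -E => -[y _ yE]; exists y.
  have h := etrans (srv_right_translate y acA) (etrans yE (esym (srv_right_translate 1%g acB))).
  rewrite (srv_map_inj riem linv (ac_right_translate y acA) (ac_right_translate 1%g acB) h).
  by apply/funext => t; rewrite /right_translate (iota1 sub) mulg1.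
have [_ iM _] := sub.
apply/seteqP; split=> _ [z _ <-].
  exists (y^-1 * z)%g; first exact: I.
  have h : right_translate beta (y^-1 * z)%g = right_translate alpha z.
    by apply/funext => t; rewrite yE /right_translate -mulgA -iM mulVKg.
  exact: (etrans (esym (srv_right_translate _ acB)) (etrans (congr1 (srv_map g) h) (srv_right_translate _ acA))).
exists (y * z)%g; first exact: I.
have h : right_translate alpha (y * z)%g = right_translate beta z.
  by apply/funext => t; rewrite yE /right_translate -mulgA -iM.
exact: (etrans (esym (srv_right_translate _ acA)) (etrans (congr1 (srv_map g) h) (srv_right_translate _ acB))).
Qed.

End subgroup_action.

(** * The induced bijection *)

Theorem mainTheorem4 (R : realType) (n k m : nat)
    (G : lieGroupType R n) (K : lieGroupType R k) (M : manifoldType R m)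
    (iota : K -> G) (proj : G -> M) (g : G -> 'rV[R]_n -> 'rV[R]_n -> R) :
  lie_subgroup iota ->
  compact [set: K] ->
  homogeneous_space iota proj ->
  riemannian_metric g ->
  left_invariant g ->
  bi_invariant_wrt iota g ->
  let X := [set: G] `*` L2_space g (lie_perp iota g) in
  exists F : set (G * set (R -> 'rV[R]_n)) -> (unit_interval R -> M),
    set_bij [set K_orbit iota x | x in X] (ac_curves M) F /\
    forall x, X x -> exists alpha : unit_interval R -> G,
      unique (fun beta => ac_curves G beta /\ srv_map g beta = x) alpha /\
      F (K_orbit iota x) = proj \o alpha.
Proof.
move=> sub compactK hom riem linv binv X.
have [_ fib sproj] := hom.
have Xlift x : X x -> exists alpha, ac_curves G alpha /\ srv_map g alpha = x.
  case: x => x c [_ /= [q [sq _] <-]].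
  by have [alpha ? ?] := srv_map_onto riem linv x sq; exists alpha.
have Xsrv alpha : ac_curves G alpha -> X (srv_map g alpha) <->
    {ae @lebesgue_measure R, forall t, 0 < t < 1 -> lie_perp iota g (mc (alpha \o @clamp R) t)}.
  move=> acA; split=> [[_ h]|h].
    exact: ((L2_space_srv iota riem linv acA).1 h).
  by split; [exact: I|exact: ((L2_space_srv iota riem linv acA).2 h)].
pose over O alpha := ac_curves G alpha /\ K_orbit iota (srv_map g alpha) = O.
(* F projects an arbitrarily chosen curve whose image under Q generates the orbit O. Two choices
   differ by right translation by K, which [proj] does not see. The constant curve is a default
   value for sets that are no such orbits. *)
pose F O : unit_interval R -> M :=
  if pselect (exists alpha, over O alpha) is left e then proj \o projT1 (cid e) else fun=> proj 1%g.
have FE alpha : ac_curves G alpha -> F (K_orbit iota (srv_map g alpha)) = proj \o alpha.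
  move=> acA; rewrite /F; case: pselect => [e|[]]; last by exists alpha.
  have [acB EB] := projT2 (cid e); move: (projT1 _) acB EB => beta acB EB.
  have [y ->] := (K_orbit_translate sub riem linv binv acB acA).1 EB.
  by apply/funext => t; apply/fib; exists y.
exists F; split; last first.
  move=> x Xx; have [alpha [acA Ax]] := Xlift x Xx; exists alpha; split.
    split=> [|beta [acB Bx]]; first by [].
    exact: (srv_map_inj riem linv acA acB (etrans Ax (esym Bx))).
  by rewrite -Ax; exact: FE.
split.
- move=> _ [x Xx <-]; have [alpha [acA Ax]] := Xlift x Xx.
  rewrite -Ax FE//; exact: ac_curves_comp (submersion_C2map sproj) acA.
- move=> O1 O2; rewrite !inE => -[x Xx <-] [x' Xx' <-] FF.
  have [alpha [acA Ax]] := Xlift x Xx; have [beta [acB Bx]] := Xlift x' Xx'.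
  have E : proj \o alpha = proj \o beta := etrans (esym (FE alpha acA))
    (etrans (congr1 (fun z => F (K_orbit iota z)) Ax)
      (etrans FF (etrans (congr1 (fun z => F (K_orbit iota z)) (esym Bx)) (FE beta acB)))).
  rewrite -Ax -Bx.
  have pE t : proj (alpha t) = proj (beta t) := congr1 (fun f => f t) E.
  apply: ((K_orbit_translate sub riem linv binv acA acB).2 _).
  (* The starting points lie in one fibre and differ by some y in K. The translate of [alpha] by y
     and [beta] are then horizontal curves with the same projection and the same starting point. *)
  have /fib[y y0] := pE (clamp 0); exists y.
  have hA : X (srv_map g alpha) by rewrite Ax.
  have hB : X (srv_map g beta) by rewrite Bx.
  move/(Xsrv _ acA) in hA; move/(Xsrv _ acB) in hB.
  apply/esym/eq_unit_interval.
  move/ac_curvesP in acA; move/ac_curvesP in acB.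
  have [acA' hA'] := iota_translate sub linv binv y acA hA.
  apply: (horizontal_lift_unique sub compactK hom riem acA' acB _ hA' hB) => [q _ _|].
    by rewrite -[RHS]pE; apply/esym/fib; exists y.
  by rewrite /= y0.
- move=> gamma acC; have /ac_curvesP acC' := acC.
  (* A lift exists, and its horizontality is what places its image under Q in X. *)
  have [alpha [acA pA hA]] := horizontal_lift sub hom riem linv binv acC'.
  pose beta := (fun t : unit_interval R => alpha (val t)).
  have acB : ac_curves G beta := ac_curves_restrict acA.
  exists (K_orbit iota (srv_map g beta)); last first.
    rewrite FE//; apply: eq_unit_interval => t t0 t1.
    exact: (etrans (congr1 (fun s => proj (alpha s)) (val_clamp t0 t1)) (pA t t0 t1)).
  exists (srv_map g beta) => //; apply/(Xsrv _ acB).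
  by apply: lebesgue_aeS hA => t H t01; rewrite mc_restrict//; exact: H.
Qed.
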